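(* Let $n\ge1$, let $A(n)$ be the $n\times n$ matrix with $A_{ii}=-2$, $A_{ij}=-1$ if $|i-j|=1$, and $A_{ij}=0$ otherwise; let $\mathfrak{g}=\mathfrak{g}(A(n))$, $\mathcal{I}=\{1,\ldots,n\}$, and let $\rho\in\mathfrak{h}^*$ be the (unique) Weyl vector, $\rho(\alpha_i^\vee)=-1$ for all $i$. Let $V\neq 0$ be any highest weight $\mathfrak{g}$-module with highest weight $\rho$. (a) Let $\mu=\rho-\sum_{i=1}^nX_i\alpha_i$, with $(X_1,\ldots,X_n)\in\mathbb{Z}_{\ge0}^n$, be a solution to $$X_1^2+\cdots+X_n^2-2(X_1+\cdots+X_n)+\sum_{i=1}^{n-1}X_iX_{i+1}=0,$$ equivalently to $$(X_1-1)^2+\sum_{i=1}^{n-1}(X_i+X_{i+1}-1)^2+(X_n-1)^2-(n+1)=0.$$ Then $V_\mu$ contains a non-zero maximal vector if and only if $(X_1,\ldots,X_n)$ has independent support and has the following form: there are pairwise non-adjacent nodes $1\le i_1<\cdots<i_k\le n$ with $X_{i_1}=\cdots=X_{i_k}=2$ and $X_i=0$ for all other $i$. (b) $V=\mathbb{M}(\rho,\mathcal{H}_V)$. So every highest weight module $V$ with highest weight $\rho$ (not only the simple one) admits an explicit presentation by its minimal holes, i.e. $V=M(\rho)/\big\langle(\prod_{h\in H}f_h^2)M(\rho)_\rho : H\in\mathcal{H}_V^{\min}\big\rangle$. In particular $L(\rho)=\dfrac{M(\rho)}{\langle f_1^2M(\rho)_\rho,\ldots,f_n^2M(\rho)_\rho\rangle}$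 (so $L(\rho)$ is of parabolic Verma type). (c) $\mathrm{char}\,L(\rho)=\mathrm{char}\,\mathbb{M}\big(\rho,\{\{1\},\ldots,\{n\}\}\big)$, and more generally $$\mathrm{char}\,V=\mathrm{char}\,\mathbb{M}(\rho,\mathcal{H}_V)=\frac{\displaystyle\sum_{\mu}\ \sum_{\substack{H_1,\ldots,H_r\in\mathcal{H}_V^{\min}\text{ s.t.}\\ H_1\cup\cdots\cup H_r=\mathrm{supp}(\rho-\mu)}}(-1)^r e^{\mu}}{\prod_{\alpha\in\Delta^+}(1-e^{-\alpha})^{\dim\mathfrak{g}_\alpha}},$$ where $\mu$ runs over the weights of the form described in (a), i.e. $\mu=\rho-\sum_{i\in I}2\alpha_i$ with $I\subseteq\mathcal{I}$ (possibly empty) having no two adjacent elements, and the inner sum is over subsets $\{H_1,\ldots,H_r\}$ of $\mathcal{H}_V^{\min}$, $r\ge0$ (for $\mu=\rho$ the only contribution is $r=0$).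
   Context: The Borcherds--Kac--Moody Lie algebra $\mathfrak{g}(A(n))$ over $\mathbb{C}$ has Cartan subalgebra $\mathfrak{h}$ with basis the simple co-roots $\alpha_i^\vee$ ($A(n)$ is nondegenerate), simple roots $\alpha_i\in\mathfrak{h}^*$ with $\alpha_j(\alpha_i^\vee)=A_{ij}$, and is generated by $\mathfrak{h},e_i,f_i$ ($i\in\mathcal{I}$) with $[\mathfrak{h},\mathfrak{h}]=0$, $[h,e_i]=\alpha_i(h)e_i$, $[h,f_i]=-\alpha_i(h)f_i$, $[e_i,f_j]=\delta_{ij}\alpha_i^\vee$, and $[e_i,e_j]=[f_i,f_j]=0$ when $A_{ij}=0$. $\Delta^+$ is the set of positive roots and $\mathfrak{g}_\alpha$ are the root spaces. $M(\rho)$ is the Verma module with highest weight $\rho$ and $L(\rho)$ its simple quotient; a highest weight module of highest weight $\rho$ is a nonzero quotient of $M(\rho)$. $V_\mu$ is the $\mu$-weight space of $V$. A maximal vector is a nonzero weight vector killed by all $e_i$. $\mathrm{char}\,V=\sum_\mu\dim V_\mu\, e^\mu$; $\mathrm{supp}(\sum_i c_i\alpha_i)=\{i:c_i\neq0\}$, and the support of $(X_1,\ldots,X_n)$ is $\{i: X_i\ne 0\}$. Nodes $i,j$ are adjacent iff $|i-j|=1$, and a subset of $\mathcal{I}$ is independent if no two of its elements are adjacent. Holes of $V$: $\mathcal{H}_V=\{\emptyset\ne H\subseteq\mathcal{I}\text{ independent}: (\prod_{h\in H}f_h^2)V_\rho=0\}$; $\mathcal{H}_V^{\min}$ is the set of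 inclusion-minimal elements (minimal holes) of $\mathcal{H}_V$. For a collection $\mathcal{H}$ of nonempty independent subsets, the higher order Verma module is $\mathbb{M}(\rho,\mathcal{H})=M(\rho)/\big\langle(\prod_{h\in H}f_h^2)M(\rho)_\rho : H\in\mathcal{H}\big\rangle$, where $\langle\cdots\rangle$ denotes the submodule generated.
   Formalization: In (a) the ''if'' direction fails when V_μ = 0 (e.g. n = 1, V = L(ρ), X_1 = 2: f_1² kills the highest weight vector), so the equivalence is proved for V with V_μ ≠ 0, and without this proviso for V = M(ρ). *)

(* Defs.v *)
From HB Require Import structures.
From mathcomp Require Import all_boot all_order all_algebra.
From mathcomp Require Import generic_quotient complex mpoly.
From mathcomp Require Import boolp classical_sets reals.

Set Implicit Arguments.
Unset Strict Implicit.
Unset Printing Implicit Defensive.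

Import GRing.Theory.
Local Open Scope ring_scope.
Local Open Scope quotient_scope.

HB.mixin Record isLieAlgebra (K : fieldType) L of GRing.Lmodule K L := {
  lie : L -> L -> L;
  lie_linearl : forall y, linear (fun x => lie x y);
  lie_linearr : forall x, linear (lie x);
  liexx : forall x, lie x x = 0;
  lie_jacobi : forall x y z,
    lie x (lie y z) + lie y (lie z x) + lie z (lie x y) = 0 }.

#[short(type="lieAlgType")]
HB.structure Definition LieAlgebra (K : fieldType) :=
  { L of isLieAlgebra K L & GRing.Lmodule K L }.

HB.mixin Record isLieModule (K : fieldType) (g : lieAlgType K) V
    of GRing.Lmodule K V := {
  act : g -> V -> V;
  act_linearl : forall v, linear (fun x => act x v);
  act_linearr : forall x, linear (act x);
  act_lie : forall x y v, act (lie x y) v = act x (act y v) - act y (act x v) }.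

#[short(type="lieModType")]
HB.structure Definition LieModule (K : fieldType) (g : lieAlgType K) :=
  { V of isLieModule K g V & GRing.Lmodule K V }.

Section ModuleNotions.
Variables (K : fieldType) (g : lieAlgType K).

Definition is_module_hom (V W : lieModType g) (phi : V -> W) : Prop :=
  linear phi /\ forall (x : g) (v : V), phi (act x v) = act x (phi v).

Definition module_iso (V W : lieModType g) : Prop :=
  exists phi : V -> W, is_module_hom phi /\ bijective phi.

Definition is_submodule (V : lieModType g) (N : set V) : Prop :=
  [/\ N 0, (forall (k : K) (v w : V), N v -> N w -> N (k *: v + w))
    & (forall (x : g) (v : V), N v -> N (act x v))].

Definition span_submodule (V : lieModType g) (S : set V) : set V :=
  fun v => forall N : set V, is_submodule N -> (forall w, S w -> N w) -> N v.

Definition proper_submodule (V : lieModType g) (N : set V) : Prop :=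
  is_submodule N /\ exists v, ~ N v.

End ModuleNotions.

Section QuotientModule.
Variables (K : fieldType) (g : lieAlgType K) (V : lieModType g) (S : set V).

Lemma span_is_submodule : is_submodule (span_submodule S).
Proof.
split=> [N [] //|k v w Sv Sw N subN SN|x v Sv N subN SN].
- by case: (subN) => _ linN _; apply: linN; [apply: Sv | apply: Sw].
- by case: (subN) => _ _ actN; apply: actN; apply: Sv.
Qed.

Let span0 : span_submodule S 0. Proof. by case: span_is_submodule. Qed.
Let spanP k v w : span_submodule S v -> span_submodule S w ->
  span_submodule S (k *: v + w).
Proof. by case: span_is_submodule => _ + _; apply. Qed.
Let spanA x v : span_submodule S v -> span_submodule S (act x v).
Proof. by case: span_is_submodule => _ _; apply. Qed.

Definition quot_rel (v w : V) : bool := `[< span_submodule S (v - w) >].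

Lemma quot_rel_equiv : equiv_class_of quot_rel.
Proof.
split=> [v|v w|w v u].
- by apply/asboolP; rewrite subrr.
- by apply/asboolP/asboolP => /(spanP (-1)) /(_ span0);
    rewrite addr0 scaleN1r opprB.
- move=> /asboolP vw /asboolP wu; apply/asboolP.
  by have := spanP 1 vw wu; rewrite scale1r addrA subrK.
Qed.

Canonical quot_rel_equiv_rel := EquivRelPack quot_rel_equiv.

Definition quot_module := {eq_quot quot_rel}.
HB.instance Definition _ := Choice.on quot_module.
HB.instance Definition _ := Quotient.on quot_module.

Definition quot_proj : V -> quot_module := \pi_quot_module.

Lemma quot_projP v w :
  quot_proj v = quot_proj w <-> span_submodule S (v - w).
Proof.
split; first by move/eqP; rewrite /quot_proj eqmodE => /asboolP.
by move=> vw; apply/eqP; rewrite /quot_proj eqmodE; apply/asboolP.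
Qed.

Lemma quot_repr v : span_submodule S (repr (quot_proj v) - v).
Proof. by apply/quot_projP; rewrite /quot_proj reprK. Qed.

Definition quot_add (a b : quot_module) := quot_proj (repr a + repr b).
Definition quot_opp (a : quot_module) := quot_proj (- repr a).
Definition quot_scale (k : K) (a : quot_module) := quot_proj (k *: repr a).
Definition quot_act (x : g) (a : quot_module) := quot_proj (act x (repr a)).

Lemma quot_ind (P : quot_module -> Prop) :
  (forall v, P (quot_proj v)) -> forall a, P a.
Proof. by move=> Pv a; rewrite -[a]reprK; apply: Pv. Qed.

Lemma quot_addE v w :
  quot_add (quot_proj v) (quot_proj w) = quot_proj (v + w).
Proof.
apply/quot_projP; rewrite opprD addrACA -[X in X + _]scale1r.
by apply: spanP; apply: quot_repr.
Qed.

Lemma quot_scaleE k v : quot_scale k (quot_proj v) = quot_proj (k *: v).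
Proof.
apply/quot_projP; rewrite -scalerBr -[X in span_submodule _ X]addr0.
by apply: spanP => //; apply: quot_repr.
Qed.

Lemma quot_oppE v : quot_opp (quot_proj v) = quot_proj (- v).
Proof. by rewrite -scaleN1r -quot_scaleE /quot_scale scaleN1r. Qed.

Lemma actBr (x : g) (v w : V) : act x (v - w) = act x v - act x w.
Proof.
have := act_linearr x (-1) w v; rewrite !scaleN1r => actN.
by rewrite addrC actN addrC.
Qed.

Lemma quot_actE x v : quot_act x (quot_proj v) = quot_proj (act x v).
Proof.
by apply/quot_projP; rewrite -actBr; apply: spanA; apply: quot_repr.
Qed.

Fact quot_addA : associative quot_add.
Proof.
move=> a b c; elim/quot_ind: a => u; elim/quot_ind: b => v.
by elim/quot_ind: c => w; rewrite !quot_addE addrA.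
Qed.
Fact quot_addC : commutative quot_add.
Proof. by move=> a b; rewrite /quot_add addrC. Qed.
Fact quot_add0 : left_id (quot_proj 0) quot_add.
Proof. by elim/quot_ind=> v; rewrite quot_addE add0r. Qed.
Fact quot_addN : left_inverse (quot_proj 0) quot_opp quot_add.
Proof. by elim/quot_ind=> v; rewrite quot_oppE quot_addE addNr. Qed.

HB.instance Definition _ := GRing.isZmodule.Build quot_module
  quot_addA quot_addC quot_add0 quot_addN.

Fact quot_scaleA a b v :
  quot_scale a (quot_scale b v) = quot_scale (a * b) v.
Proof. by elim/quot_ind: v => v; rewrite !quot_scaleE scalerA. Qed.
Fact quot_scale1 : left_id 1 quot_scale.
Proof. by elim/quot_ind=> v; rewrite quot_scaleE scale1r. Qed.
Fact quot_scaleDr : right_distributive quot_scale +%R.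
Proof.
move=> k; elim/quot_ind=> v; elim/quot_ind=> w.
by rewrite /GRing.add /= quot_addE !quot_scaleE quot_addE scalerDr.
Qed.
Fact quot_scaleDl v : {morph quot_scale^~ v : a b / a + b}.
Proof.
move=> a b; elim/quot_ind: v => v.
by rewrite !quot_scaleE [RHS]quot_addE scalerDl.
Qed.

HB.instance Definition _ := GRing.Zmodule_isLmodule.Build K quot_module
  quot_scaleA quot_scale1 quot_scaleDr quot_scaleDl.

Fact quot_act_linearl v : linear (quot_act^~ v).
Proof.
move=> k x y; elim/quot_ind: v => v; rewrite !quot_actE act_linearl.
by rewrite -[LHS]quot_addE -quot_scaleE.
Qed.
Fact quot_act_linearr x : linear (quot_act x).
Proof.
move=> k; elim/quot_ind=> v; elim/quot_ind=> w.
rewrite [k *: _]quot_scaleE [_ + _]quot_addE !quot_actE act_linearr.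
by rewrite -[LHS]quot_addE -quot_scaleE.
Qed.
Fact quot_act_lie x y v : quot_act (lie x y) v =
  quot_act x (quot_act y v) - quot_act y (quot_act x v).
Proof.
elim/quot_ind: v => v; rewrite !quot_actE act_lie.
by rewrite [- quot_proj _]quot_oppE [RHS]quot_addE.
Qed.

HB.instance Definition _ := isLieModule.Build K g quot_module
  quot_act_linearl quot_act_linearr quot_act_lie.

End QuotientModule.

(* The Lie algebra with generators X and relations R is the set of      *)
(* formal Lie expressions in X, modulo the congruence generated by the  *)
(* Lie algebra axioms and R.                                            *)
Inductive lie_term (K X : Type) : Type :=
| LGen of X
| LZero
| LAdd of lie_term K X & lie_term K X
| LScale of K & lie_term K X
| LBr of lie_term K X & lie_term K X.
Arguments LGen {K X}.
Arguments LZero {K X}.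

HB.instance Definition _ (K X : Type) := gen_eqMixin (lie_term K X).
HB.instance Definition _ (K X : Type) := gen_choiceMixin (lie_term K X).

Section PresentedLieAlgebra.
Variables (K : fieldType) (X : Type).
Variable R : lie_term K X -> lie_term K X -> Prop.

Inductive lie_cong : lie_term K X -> lie_term K X -> Prop :=
| lc_rel s t : R s t -> lie_cong s t
| lc_refl s : lie_cong s s
| lc_sym s t : lie_cong s t -> lie_cong t s
| lc_trans s t u : lie_cong s t -> lie_cong t u -> lie_cong s u
| lc_add s s' t t' :
    lie_cong s s' -> lie_cong t t' -> lie_cong (LAdd s t) (LAdd s' t')
| lc_scale k s s' : lie_cong s s' -> lie_cong (LScale k s) (LScale k s')
| lc_br s s' t t' :
    lie_cong s s' -> lie_cong t t' -> lie_cong (LBr s t) (LBr s' t')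
| lc_addA s t u : lie_cong (LAdd s (LAdd t u)) (LAdd (LAdd s t) u)
| lc_addC s t : lie_cong (LAdd s t) (LAdd t s)
| lc_add0 s : lie_cong (LAdd LZero s) s
| lc_addN s : lie_cong (LAdd (LScale (-1) s) s) LZero
| lc_scaleA a b s : lie_cong (LScale a (LScale b s)) (LScale (a * b) s)
| lc_scale1 s : lie_cong (LScale 1 s) s
| lc_scaleDr k s t :
    lie_cong (LScale k (LAdd s t)) (LAdd (LScale k s) (LScale k t))
| lc_scaleDl a b s :
    lie_cong (LScale (a + b) s) (LAdd (LScale a s) (LScale b s))
| lc_brl k s t u :
    lie_cong (LBr (LAdd (LScale k s) t) u) (LAdd (LScale k (LBr s u)) (LBr t u))
| lc_brr k s t u :
    lie_cong (LBr u (LAdd (LScale k s) t)) (LAdd (LScale k (LBr u s)) (LBr u t))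
| lc_brxx s : lie_cong (LBr s s) LZero
| lc_jacobi s t u :
    lie_cong (LAdd (LAdd (LBr s (LBr t u)) (LBr t (LBr u s))) (LBr u (LBr s t)))
             LZero.

Definition lie_congb s t : bool := `[< lie_cong s t >].

Lemma lie_congb_equiv : equiv_class_of lie_congb.
Proof.
split=> [s|s t|t s u].
- by apply/asboolP; apply: lc_refl.
- by apply/asboolP/asboolP => /lc_sym.
- by move=> /asboolP st /asboolP tu; apply/asboolP; apply: lc_trans tu.
Qed.

Canonical lie_congb_equiv_rel := EquivRelPack lie_congb_equiv.

Definition presented_lie := {eq_quot lie_congb}.
HB.instance Definition _ := Choice.on presented_lie.
HB.instance Definition _ := Quotient.on presented_lie.

Definition lie_class : lie_term K X -> presented_lie := \pi_presented_lie.

Lemma lie_classP s t : lie_class s = lie_class t <-> lie_cong s t.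
Proof.
split; first by move/eqP; rewrite /lie_class eqmodE => /asboolP.
by move=> st; apply/eqP; rewrite /lie_class eqmodE; apply/asboolP.
Qed.

Lemma lie_repr s : lie_cong (repr (lie_class s)) s.
Proof. by apply/lie_classP; rewrite /lie_class reprK. Qed.

Lemma lie_class_ind (P : presented_lie -> Prop) :
  (forall s, P (lie_class s)) -> forall a, P a.
Proof. by move=> Ps a; rewrite -[a]reprK; apply: Ps. Qed.

Definition pl_add (a b : presented_lie) := lie_class (LAdd (repr a) (repr b)).
Definition pl_scale (k : K) (a : presented_lie) :=
  lie_class (LScale k (repr a)).
Definition pl_opp (a : presented_lie) := pl_scale (-1) a.
Definition pl_br (a b : presented_lie) := lie_class (LBr (repr a) (repr b)).

Lemma pl_addE s t : pl_add (lie_class s) (lie_class t) = lie_class (LAdd s t).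
Proof. by apply/lie_classP; apply: lc_add; apply: lie_repr. Qed.
Lemma pl_scaleE k s : pl_scale k (lie_class s) = lie_class (LScale k s).
Proof. by apply/lie_classP; apply: lc_scale; apply: lie_repr. Qed.
Lemma pl_brE s t : pl_br (lie_class s) (lie_class t) = lie_class (LBr s t).
Proof. by apply/lie_classP; apply: lc_br; apply: lie_repr. Qed.

Fact pl_addA : associative pl_add.
Proof.
elim/lie_class_ind=> s; elim/lie_class_ind=> t; elim/lie_class_ind=> u.
by rewrite !pl_addE; apply/lie_classP; apply: lc_addA.
Qed.
Fact pl_addC : commutative pl_add.
Proof.
elim/lie_class_ind=> s; elim/lie_class_ind=> t.
by rewrite !pl_addE; apply/lie_classP; apply: lc_addC.
Qed.
Fact pl_add0 : left_id (lie_class LZero) pl_add.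
Proof.
by elim/lie_class_ind=> s; rewrite pl_addE; apply/lie_classP; apply: lc_add0.
Qed.
Fact pl_addN : left_inverse (lie_class LZero) pl_opp pl_add.
Proof.
elim/lie_class_ind=> s; rewrite /pl_opp pl_scaleE pl_addE.
by apply/lie_classP; apply: lc_addN.
Qed.

HB.instance Definition _ := GRing.isZmodule.Build presented_lie
  pl_addA pl_addC pl_add0 pl_addN.

Fact pl_scaleA a b v : pl_scale a (pl_scale b v) = pl_scale (a * b) v.
Proof.
elim/lie_class_ind: v => s; rewrite !pl_scaleE.
by apply/lie_classP; apply: lc_scaleA.
Qed.
Fact pl_scale1 : left_id 1 pl_scale.
Proof.
by elim/lie_class_ind=> s; rewrite pl_scaleE; apply/lie_classP; apply: lc_scale1.
Qed.
Fact pl_scaleDr : right_distributive pl_scale +%R.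
Proof.
move=> k; elim/lie_class_ind=> s; elim/lie_class_ind=> t.
rewrite [X in pl_scale k X]pl_addE !pl_scaleE [RHS]pl_addE.
by apply/lie_classP; apply: lc_scaleDr.
Qed.
Fact pl_scaleDl v : {morph pl_scale^~ v : a b / a + b}.
Proof.
move=> a b; elim/lie_class_ind: v => s; rewrite !pl_scaleE [RHS]pl_addE.
by apply/lie_classP; apply: lc_scaleDl.
Qed.

HB.instance Definition _ := GRing.Zmodule_isLmodule.Build K presented_lie
  pl_scaleA pl_scale1 pl_scaleDr pl_scaleDl.

Fact pl_br_linearl y : linear (pl_br^~ y).
Proof.
move=> k; elim/lie_class_ind: y => u.
elim/lie_class_ind=> s; elim/lie_class_ind=> t.
rewrite [k *: _]pl_scaleE [X in pl_br X]pl_addE !pl_brE.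
rewrite [k *: _]pl_scaleE [RHS]pl_addE.
by apply/lie_classP; apply: lc_brl.
Qed.
Fact pl_br_linearr x : linear (pl_br x).
Proof.
move=> k; elim/lie_class_ind: x => u.
elim/lie_class_ind=> s; elim/lie_class_ind=> t.
rewrite [k *: _]pl_scaleE [X in pl_br _ X]pl_addE !pl_brE.
rewrite [k *: _]pl_scaleE [RHS]pl_addE.
by apply/lie_classP; apply: lc_brr.
Qed.
Fact pl_brxx x : pl_br x x = 0.
Proof.
by elim/lie_class_ind: x => s; rewrite pl_brE; apply/lie_classP; apply: lc_brxx.
Qed.
Fact pl_jacobi x y z :
  pl_br x (pl_br y z) + pl_br y (pl_br z x) + pl_br z (pl_br x y) = 0.
Proof.
elim/lie_class_ind: x => s; elim/lie_class_ind: y => t.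
elim/lie_class_ind: z => u; rewrite !pl_brE [X in X + _]pl_addE [LHS]pl_addE.
by apply/lie_classP; apply: lc_jacobi.
Qed.

HB.instance Definition _ := isLieAlgebra.Build K presented_lie
  pl_br_linearl pl_br_linearr pl_brxx pl_jacobi.

Definition lie_gen (x : X) : presented_lie := lie_class (LGen x).

End PresentedLieAlgebra.

(* As a left g-module, U(g) is the free g-module on one generator 1,    *)
(* i.e. the formal expressions in 1 modulo the congruence generated by  *)
(* the g-module axioms.                                                 *)
Inductive env_term (K g : Type) : Type :=
| UOne
| UZero
| UAdd of env_term K g & env_term K g
| UScale of K & env_term K g
| UAct of g & env_term K g.
Arguments UOne {K g}.
Arguments UZero {K g}.

HB.instance Definition _ (K g : Type) := gen_eqMixin (env_term K g).
HB.instance Definition _ (K g : Type) := gen_choiceMixin (env_term K g).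

Section EnvelopingModule.
Variables (K : fieldType) (g : lieAlgType K).

Inductive env_cong : env_term K g -> env_term K g -> Prop :=
| uc_refl s : env_cong s s
| uc_sym s t : env_cong s t -> env_cong t s
| uc_trans s t u : env_cong s t -> env_cong t u -> env_cong s u
| uc_add s s' t t' :
    env_cong s s' -> env_cong t t' -> env_cong (UAdd s t) (UAdd s' t')
| uc_scale k s s' : env_cong s s' -> env_cong (UScale k s) (UScale k s')
| uc_act x s s' : env_cong s s' -> env_cong (UAct x s) (UAct x s')
| uc_addA s t u : env_cong (UAdd s (UAdd t u)) (UAdd (UAdd s t) u)
| uc_addC s t : env_cong (UAdd s t) (UAdd t s)
| uc_add0 s : env_cong (UAdd UZero s) s
| uc_addN s : env_cong (UAdd (UScale (-1) s) s) UZero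
| uc_scaleA a b s : env_cong (UScale a (UScale b s)) (UScale (a * b) s)
| uc_scale1 s : env_cong (UScale 1 s) s
| uc_scaleDr k s t :
    env_cong (UScale k (UAdd s t)) (UAdd (UScale k s) (UScale k t))
| uc_scaleDl a b s :
    env_cong (UScale (a + b) s) (UAdd (UScale a s) (UScale b s))
| uc_actl k x y s :
    env_cong (UAct (k *: x + y) s) (UAdd (UScale k (UAct x s)) (UAct y s))
| uc_actr k x s t :
    env_cong (UAct x (UAdd (UScale k s) t)) (UAdd (UScale k (UAct x s)) (UAct x t))
| uc_lie x y s :
    env_cong (UAct (lie x y) s)
             (UAdd (UAct x (UAct y s)) (UScale (-1) (UAct y (UAct x s)))).

Definition env_congb s t : bool := `[< env_cong s t >].

Lemma env_congb_equiv : equiv_class_of env_congb.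
Proof.
split=> [s|s t|t s u].
- by apply/asboolP; apply: uc_refl.
- by apply/asboolP/asboolP => /uc_sym.
- by move=> /asboolP st /asboolP tu; apply/asboolP; apply: uc_trans tu.
Qed.

Canonical env_congb_equiv_rel := EquivRelPack env_congb_equiv.

Definition env_module := {eq_quot env_congb}.
HB.instance Definition _ := Choice.on env_module.
HB.instance Definition _ := Quotient.on env_module.

Definition env_class : env_term K g -> env_module := \pi_env_module.

Lemma env_classP s t : env_class s = env_class t <-> env_cong s t.
Proof.
split; first by move/eqP; rewrite /env_class eqmodE => /asboolP.
by move=> st; apply/eqP; rewrite /env_class eqmodE; apply/asboolP.
Qed.

Lemma env_repr s : env_cong (repr (env_class s)) s.
Proof. by apply/env_classP; rewrite /env_class reprK. Qed.

Lemma env_class_ind (P : env_module -> Prop) :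
  (forall s, P (env_class s)) -> forall a, P a.
Proof. by move=> Ps a; rewrite -[a]reprK; apply: Ps. Qed.

Definition env_add (a b : env_module) := env_class (UAdd (repr a) (repr b)).
Definition env_scale (k : K) (a : env_module) := env_class (UScale k (repr a)).
Definition env_opp (a : env_module) := env_scale (-1) a.
Definition env_act (x : g) (a : env_module) := env_class (UAct x (repr a)).

Lemma env_addE s t : env_add (env_class s) (env_class t) = env_class (UAdd s t).
Proof. by apply/env_classP; apply: uc_add; apply: env_repr. Qed.
Lemma env_scaleE k s : env_scale k (env_class s) = env_class (UScale k s).
Proof. by apply/env_classP; apply: uc_scale; apply: env_repr. Qed.
Lemma env_actE x s : env_act x (env_class s) = env_class (UAct x s).
Proof. by apply/env_classP; apply: uc_act; apply: env_repr. Qed.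

Fact env_addA : associative env_add.
Proof.
elim/env_class_ind=> s; elim/env_class_ind=> t; elim/env_class_ind=> u.
by rewrite !env_addE; apply/env_classP; apply: uc_addA.
Qed.
Fact env_addC : commutative env_add.
Proof.
elim/env_class_ind=> s; elim/env_class_ind=> t.
by rewrite !env_addE; apply/env_classP; apply: uc_addC.
Qed.
Fact env_add0 : left_id (env_class UZero) env_add.
Proof.
by elim/env_class_ind=> s; rewrite env_addE; apply/env_classP; apply: uc_add0.
Qed.
Fact env_addN : left_inverse (env_class UZero) env_opp env_add.
Proof.
elim/env_class_ind=> s; rewrite /env_opp env_scaleE env_addE.
by apply/env_classP; apply: uc_addN.
Qed.

HB.instance Definition _ := GRing.isZmodule.Build env_module
  env_addA env_addC env_add0 env_addN.

Fact env_scaleA a b v : env_scale a (env_scale b v) = env_scale (a * b) v.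
Proof.
elim/env_class_ind: v => s; rewrite !env_scaleE.
by apply/env_classP; apply: uc_scaleA.
Qed.
Fact env_scale1 : left_id 1 env_scale.
Proof.
by elim/env_class_ind=> s; rewrite env_scaleE; apply/env_classP; apply: uc_scale1.
Qed.
Fact env_scaleDr : right_distributive env_scale +%R.
Proof.
move=> k; elim/env_class_ind=> s; elim/env_class_ind=> t.
rewrite [X in env_scale k X]env_addE !env_scaleE [RHS]env_addE.
by apply/env_classP; apply: uc_scaleDr.
Qed.
Fact env_scaleDl v : {morph env_scale^~ v : a b / a + b}.
Proof.
move=> a b; elim/env_class_ind: v => s; rewrite !env_scaleE [RHS]env_addE.
by apply/env_classP; apply: uc_scaleDl.
Qed.

HB.instance Definition _ := GRing.Zmodule_isLmodule.Build K env_module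
  env_scaleA env_scale1 env_scaleDr env_scaleDl.

Fact env_act_linearl v : linear (env_act^~ v).
Proof.
move=> k x y; elim/env_class_ind: v => s; rewrite !env_actE.
rewrite [k *: env_class _]env_scaleE [RHS]env_addE.
by apply/env_classP; apply: uc_actl.
Qed.
Fact env_act_linearr x : linear (env_act x).
Proof.
move=> k; elim/env_class_ind=> s; elim/env_class_ind=> t.
rewrite [k *: _]env_scaleE [X in env_act _ X]env_addE !env_actE.
rewrite [k *: _]env_scaleE [RHS]env_addE.
by apply/env_classP; apply: uc_actr.
Qed.
Fact env_act_lie x y v :
  env_act (lie x y) v = env_act x (env_act y v) - env_act y (env_act x v).
Proof.
elim/env_class_ind: v => s; rewrite !env_actE.
rewrite [- _]env_scaleE [RHS]env_addE.
by apply/env_classP; apply: uc_lie.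
Qed.

HB.instance Definition _ := isLieModule.Build K g env_module
  env_act_linearl env_act_linearr env_act_lie.

Definition env_one : env_module := env_class UOne.

End EnvelopingModule.

(* The Cartan subalgebra is the space of row vectors, the i-th basis    *)
(* vector being the i-th simple co-root (A(n) is nondegenerate); its    *)
(* dual is the space of column vectors, mu(h) being the product h mu.   *)
Definition adjacent (n : nat) (i j : 'I_n) : bool :=
  (i.+1 == j :> nat) || (j.+1 == i :> nat).

Definition independent (n : nat) (I : {set 'I_n}) : bool :=
  [forall i in I, forall j in I, ~~ adjacent i j].

Section BKM.
Variables (K : fieldType) (n : nat).

Definition cartan_mx : 'M[K]_n :=
  \matrix_(i, j) (if i == j then - 2%:R else if adjacent i j then -1 else 0).

Definition cartan := 'rV[K]_n.
Definition weight := 'cV[K]_n.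

Definition wpair (mu : weight) (h : cartan) : K := (h *m mu) 0 0.
Definition coroot (i : 'I_n) : cartan := delta_mx 0 i.
Definition simple_root (j : 'I_n) : weight := col j cartan_mx.

Lemma simple_root_coroot i j : wpair (simple_root j) (coroot i) = cartan_mx i j.
Proof. by rewrite /wpair /coroot -rowE !mxE. Qed.

Definition weyl : weight := const_mx (-1).

Inductive chevalley_gen := CartanGen of cartan | EGen of 'I_n | FGen of 'I_n.

Local Notation term := (lie_term K chevalley_gen).
Local Notation tH h := (LGen (CartanGen h)).
Local Notation tE i := (LGen (EGen i)).
Local Notation tF i := (LGen (FGen i)).

(* There are no Serre relations of real type: A(n) has no positive      *)
(* diagonal entry.                                                      *)
Inductive chevalley_rel : term -> term -> Prop :=
| rel_cartan k h h' :
    chevalley_rel (tH (k *: h + h')) (LAdd (LScale k (tH h)) (tH h'))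
| rel_hh h h' : chevalley_rel (LBr (tH h) (tH h')) LZero
| rel_he h i :
    chevalley_rel (LBr (tH h) (tE i)) (LScale (wpair (simple_root i) h) (tE i))
| rel_hf h i :
    chevalley_rel (LBr (tH h) (tF i)) (LScale (- wpair (simple_root i) h) (tF i))
| rel_ef_eq i : chevalley_rel (LBr (tE i) (tF i)) (tH (coroot i))
| rel_ef_neq i j : i != j -> chevalley_rel (LBr (tE i) (tF j)) LZero
| rel_ee i j : cartan_mx i j = 0 -> chevalley_rel (LBr (tE i) (tE j)) LZero
| rel_ff i j : cartan_mx i j = 0 -> chevalley_rel (LBr (tF i) (tF j)) LZero.

Definition bkm : lieAlgType K := presented_lie chevalley_rel.

Definition bkm_h (h : cartan) : bkm := lie_gen chevalley_rel (CartanGen h).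
Definition bkm_e (i : 'I_n) : bkm := lie_gen chevalley_rel (EGen i).
Definition bkm_f (i : 'I_n) : bkm := lie_gen chevalley_rel (FGen i).

(* Elements of Q^+ = sum_i N alpha_i are given by their coefficients. *)
Definition root_of (b : 'X_{1..n}) : weight := \sum_(i < n) simple_root i *+ b i.

Definition root_space (alpha : weight) : set bkm :=
  fun x => forall h : cartan, lie (bkm_h h) x = wpair alpha h *: x.

Definition positive_root (b : 'X_{1..n}) : Prop :=
  b <> 0%MM /\ exists x : bkm, x <> 0 /\ root_space (root_of b) x.

Definition weight_space (V : lieModType bkm) (mu : weight) : set V :=
  fun v => forall h : cartan, act (bkm_h h) v = wpair mu h *: v.

Definition maximal_vector (V : lieModType bkm) (v : V) : Prop :=
  [/\ v <> 0, exists mu, weight_space mu v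
    & forall i : 'I_n, act (bkm_e i) v = 0].

(* M(lam) = U(g) / (U(g) e_i + U(g) (h - lam(h)))                       *)
Definition verma_ideal (lam : weight) : set (env_module bkm) := fun u =>
  (exists i : 'I_n, u = act (bkm_e i) (env_one bkm)) \/
  (exists h : cartan,
     u = act (bkm_h h) (env_one bkm) - wpair lam h *: env_one bkm).

Definition verma (lam : weight) : lieModType bkm :=
  quot_module (verma_ideal lam).

(* The sum of all proper submodules of M(lam) is its unique maximal     *)
(* proper submodule.                                                    *)
Definition verma_simple (lam : weight) : lieModType bkm :=
  quot_module (fun v : verma lam => exists N, proper_submodule N /\ N v).

Definition highest_weight_module (lam : weight) (V : lieModType bkm) : Prop :=
  (exists v : V, v <> 0) /\
  exists pi : verma lam -> V,
    is_module_hom pi /\ forall v, exists m, pi m = v.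

(* The action of the product over h in H of f_h^2; for independent H    *)
(* the factors commute, so that the order of enumeration is irrelevant. *)
Definition f_squares (V : lieModType bkm) (H : {set 'I_n}) (v : V) : V :=
  foldr (fun h w => act (bkm_f h) (act (bkm_f h) w)) v (enum H).

Definition holes (lam : weight) (V : lieModType bkm) : {set {set 'I_n}} :=
  [set H : {set 'I_n} | [&& H != finset.set0, independent H
    & `[< forall v : V, weight_space lam v -> f_squares H v = 0 >] ] ].

Definition minimal_holes (lam : weight) (V : lieModType bkm) :
    {set {set 'I_n}} :=
  [set H : {set 'I_n} | minset (fun G => G \in holes lam V) H].

Definition higher_verma (lam : weight) (Hs : {set {set 'I_n}}) :
    lieModType bkm :=
  quot_module (fun v : verma lam => exists H : {set 'I_n}, exists m : verma lam,
    [/\ H \in Hs, weight_space lam m & v = f_squares H m]).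

Definition singletons : {set {set 'I_n}} :=
  [set [set i] | i in [set: 'I_n] ]%SET.

End BKM.

Section Characters.
Variables (K : fieldType) (n : nat).

Definition is_basis (W : lmodType K) (S : set W) (d : nat) (b : 'I_d -> W) :=
  [/\ forall i, S (b i),
      forall c : 'I_d -> K, \sum_i c i *: b i = 0 -> forall i, c i = 0
    & forall v, S v -> exists c : 'I_d -> K, v = \sum_i c i *: b i].

(* Dimension of a finite-dimensional subspace S (by convention 0 if S   *)
(* is not finite-dimensional).                                          *)
Definition subspace_dim (W : lmodType K) (S : set W) : nat :=
  xget 0%N (fun d => exists b : 'I_d -> W, is_basis S b).

(* Formal, possibly infinite, integral combinations of the e^mu.        *)
Definition formal_sum := weight K n -> int.

Definition fexp (mu : weight K n) : formal_sum := fun nu => (nu == mu)%:R.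

Definition char (V : lieModType (bkm K n)) : formal_sum :=
  fun mu => (subspace_dim (@weight_space K n V mu))%:Z.

(* Power series in the e^(- alpha_i), as functions of the exponent.     *)
Definition series := 'X_{1..n} -> int.

Definition series_mul (s t : series) : series := fun b =>
  \sum_(a : 'X_{1..n < (mdeg b).+1} | (bmnm a <= b)%MM)
     s (bmnm a) * t (b - bmnm a)%MM.

(* The infinite product of the (1 - e^(-alpha))^(dim g_alpha) over the  *)
(* positive roots alpha: a root of height > mdeg b does not contribute  *)
(* to the coefficient of exponent b.                                    *)
Definition denominator : series := fun b =>
  (\prod_(a : 'X_{1..n < (mdeg b).+1} | `[< positive_root K (bmnm a) >])
      (1 - 'X_[int, bmnm a]) ^+ subspace_dim (root_space (root_of K (bmnm a))))
    @_b.

(* f = g / D as formal sums supported in lam - N alpha_1 - ... - N alpha_n, *)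
(* for a power series D with constant coefficient 1.                    *)
Definition is_quotient (lam : weight K n) (f g : formal_sum) (D : series) :=
  let supported (u : formal_sum) :=
    forall mu, u mu <> 0 -> exists b, mu = lam - root_of K b in
  let coefs (u : formal_sum) : series := fun b => u (lam - root_of K b) in
  [/\ supported f, supported g & series_mul (coefs f) D =1 coefs g].

(* The inner sum runs over sets S of minimal holes with union           *)
(* I = supp (lam - mu), for mu = lam - sum_(i in I) 2 alpha_i.          *)
Definition numerator (lam : weight K n) (V : lieModType (bkm K n)) :
    formal_sum := fun nu =>
  \sum_(I : {set 'I_n} | independent I)
    \sum_(S : {set {set 'I_n}} | (S \subset minimal_holes lam V)
                                 && (finset.cover S == I))
      (-1) ^+ #|S| * fexp (lam - \sum_(i in I) (simple_root K i *+ 2)) nu.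

End Characters.

Arguments denominator K n : clear implicits.

Definition isotropic_eq (n : nat) (X : 'X_{1..n}) : Prop :=
  let x (k : nat) : int := (nth 0%N X k)%:Z in
  \sum_(0 <= k < n) x k ^+ 2 - 2%:Z * \sum_(0 <= k < n) x k
    + \sum_(0 <= k < n.-1) x k * x k.+1 = 0.

Definition isotropic_eq' (n : nat) (X : 'X_{1..n}) : Prop :=
  let x (k : nat) : int := (nth 0%N X k)%:Z in
  (x 0%N - 1) ^+ 2 + \sum_(0 <= k < n.-1) (x k + x k.+1 - 1) ^+ 2
    + (x n.-1 - 1) ^+ 2 - n.+1%:Z = 0.

Definition mnm_supp (n : nat) (X : 'X_{1..n}) : {set 'I_n} :=
  [set i | X i != 0%N]%SET.

(* Main.v *)
Require Import Defs.
From HB Require Import structures.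
From mathcomp Require Import all_boot all_order all_algebra.
From mathcomp Require Import generic_quotient complex mpoly.
From mathcomp Require Import zify ring.
From mathcomp Require Import boolp classical_sets functions reals.

Set Implicit Arguments.
Unset Strict Implicit.
Unset Printing Implicit Defensive.

Import GRing.Theory Num.Theory.
Local Open Scope ring_scope.

(** As e_i and e_j (resp. f_i and f_j) commute for non-adjacent i and j,
    M(rho) has a basis of words in the f_i modulo commutations, detected by
    pairing with a dual module of functions on words. A Casimir operator, built
    by recursion on the height without an invariant form, is central up to the
    usual correction. Applied to each connected component of the support of a
    maximal weight rho - sum X_i alpha_i, it forces X = 2 on an independent set I
    and X = 0 elsewhere, and this weight space is spanned by f_I^2 v, where f_I^2
    is the product of the f_i^2 for i in I. A vector of minimal height in a
    submodule N of M(rho), outside the submodule generated by the f_H^2 v in N,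
    would be maximal modulo the latter, hence equal to some f_I^2 v in N: this is
    a contradiction, so that the holes generate the kernel of M(rho) -> V.

    The weight multiplicities of V then count the words not right divisible by
    f_H^2 for a minimal hole H. Since divisibility by several f_H^2 amounts to
    divisibility by f_I^2 for I their union (and is impossible when I is not
    independent), inclusion-exclusion gives the numerator. The denominator is the
    Poincare-Birkhoff-Witt count of words. There, monomials in negative root
    vectors are independent because these vectors act on functions on words as
    derivations of the shuffle product, and because the Dynkin operator shows
    that x is determined by x v. *)

(** * Linear algebra *)

(** The quadratic equation alone does not force the shape in (a): on an isolated run of ones its
    left side is -1, so that three isolated ones and an isolated 3 solve it too. This is why the
    Casimir operator is taken relative to a set J of nodes. It commutes with f_i for i outside J and
    not adjacent to J, so a maximal vector satisfies the equation on each component of its support,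
    and there the only solution is a single entry 2. The scalar of the recursion comes from the
    classical identity for dual bases: the sum of [x', x''] tensor [y', y''] over the decompositions
    of a weight beta is (beta|beta) - 2(rho|beta) times the component at beta. One can solve for
    this component unless the scalar is 0; for the matrix at hand the scalar vanishes only on sums
    of distinct, pairwise non-adjacent simple roots, where the brackets [x', x''] are already 0.
    Root multiplicities stay unknown throughout: the count of words works up to a height N, with
    bases of root spaces that exist because x -> x v is injective in each degree. *)

(* The tactic ring does not apply to modules. *)
Inductive zmod_expr :=
| ZVar of nat | ZZero | ZAdd of zmod_expr & zmod_expr | ZOpp of zmod_expr.

Section ZmodExpr.
Variable V : zmodType.

Fixpoint zmod_eval (env : seq V) e :=
  match e with
  | ZVar i => nth 0 env i
  | ZZero => 0
  | ZAdd a b => zmod_eval env a + zmod_eval env b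
  | ZOpp a => - zmod_eval env a
  end.

Fixpoint zmod_coef e (i : nat) : int :=
  match e with
  | ZVar j => (j == i)%:Z
  | ZZero => 0
  | ZAdd a b => zmod_coef a i + zmod_coef b i
  | ZOpp a => - zmod_coef a i
  end.

Lemma zmod_evalE env e :
  zmod_eval env e = \sum_(i < size env) env`_i *~ zmod_coef e i.
Proof.
elim: e => [i||a IHa b IHb|a IHa] /=.
- have [ltis|leis] := ltnP i (size env); last first.
    rewrite nth_default // big1 // => j _.
    by rewrite gtn_eqF // (leq_trans (ltn_ord j)).
  rewrite (bigD1 (Ordinal ltis)) //= eqxx big1 ?addr0 // => j.
  by rewrite -val_eqE /= eq_sym => /negPf ->.
- by rewrite big1.
- by rewrite IHa IHb -big_split; apply: eq_bigr => i _; rewrite mulrzDr.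
- by rewrite IHa -sumrN; apply: eq_bigr => i _; rewrite mulrNz.
Qed.

(** Both expressions expand over the atoms with integer coefficients, and only the indices below the
    size of [env] matter; the test is decided by computation. *)
Lemma zmod_evalP (env : seq V) a b :
  all (fun i => zmod_coef a i == zmod_coef b i) (iota 0 (size env)) ->
  zmod_eval env a = zmod_eval env b.
Proof.
move=> /allP ab; rewrite !zmod_evalE; apply: eq_bigr => i _.
by rewrite (eqP (ab i _)) // mem_iota /=.
Qed.
End ZmodExpr.

Ltac zmod_index x env :=
  match env with
  | x :: _ => constr:(0%N)
  | _ :: ?e => let n := zmod_index x e in constr:(n.+1)
  end.
Ltac zmod_atoms t env :=
  match t with
  | 0 => env
  | ?a + ?b => let e := zmod_atoms a env in zmod_atoms b e
  | - ?a => zmod_atoms a env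
  | ?x => match env with
          | _ => let n := zmod_index x env in env
          | _ => constr:(x :: env)
          end
  end.
Ltac zmod_reify t env :=
  match t with
  | 0 => constr:(ZZero)
  | ?a + ?b => let x := zmod_reify a env in let y := zmod_reify b env in
               constr:(ZAdd x y)
  | - ?a => let x := zmod_reify a env in constr:(ZOpp x)
  | ?x => let n := zmod_index x env in constr:(ZVar n)
  end.
Ltac zmod :=
  match goal with |- @eq ?T ?a ?b =>
    let e := zmod_atoms a (@nil T) in let e := zmod_atoms b e in
    let x := zmod_reify a e in let y := zmod_reify b e in
    exact: (@zmod_evalP _ e x y isT)
  end.

Section LinearMaps.
Variables (K : fieldType) (U W : lmodType K) (f : U -> W).
Hypothesis linf : linear f.

Lemma lin0 : f 0 = 0.
Proof. by have := linf (-1) 0 0; rewrite scaler0 addr0 scaleN1r addNr. Qed.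
Lemma linD u v : f (u + v) = f u + f v.
Proof. by have := linf 1 u v; rewrite !scale1r. Qed.
Lemma linZ k u : f (k *: u) = k *: f u.
Proof. by have := linf k u 0; rewrite lin0 !addr0. Qed.
Lemma linN u : f (- u) = - f u.
Proof. by rewrite -scaleN1r linZ scaleN1r. Qed.
Lemma linB u v : f (u - v) = f u - f v.
Proof. by rewrite linD linN. Qed.
Lemma lin_sum I (r : seq I) (P : pred I) F :
  f (\sum_(i <- r | P i) F i) = \sum_(i <- r | P i) f (F i).
Proof. exact: (big_morph f linD lin0). Qed.
End LinearMaps.

Section Subspaces.
Variables (K : fieldType) (W : lmodType K).

Definition subspace (N : set W) :=
  N 0 /\ forall (k : K) v w, N v -> N w -> N (k *: v + w).

Variable N : set W.
Hypothesis subN : subspace N.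

Lemma subspace0 : N 0. Proof. by case: subN. Qed.
Lemma subspaceD v w : N v -> N w -> N (v + w).
Proof. by move=> Nv Nw; rewrite -[v]scale1r; apply: subN.2. Qed.
Lemma subspaceZ k v : N v -> N (k *: v).
Proof. by move=> Nv; rewrite -[_ *: _]addr0; apply: subN.2 => //; apply: subspace0. Qed.
Lemma subspaceN v : N v -> N (- v).
Proof. by rewrite -scaleN1r; apply: subspaceZ. Qed.
Lemma subspaceB v w : N v -> N w -> N (v - w).
Proof. by move=> Nv Nw; apply: subspaceD => //; apply: subspaceN. Qed.
Lemma subspace_sum (I : eqType) (r : seq I) (P : pred I) F :
  (forall i, i \in r -> P i -> N (F i)) -> N (\sum_(i <- r | P i) F i).
Proof.
move=> NF; rewrite big_seq_cond; apply: big_ind.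
- exact: subspace0.
- exact: subspaceD.
by move=> i /andP[]; apply: NF.
Qed.
Lemma subspaceZI k v : k != 0 -> N (k *: v) -> N v.
Proof. by move=> k0 /(subspaceZ k^-1); rewrite scalerA mulVf // scale1r. Qed.
End Subspaces.

Section Dimension.
Variables (K : fieldType) (W : lmodType K) (S : set W).

(** The ambient [W] may be infinite-dimensional, so the comparison is carried out on matrices: the
    two changes of coordinates have product 1, which bounds one size by the other. *)
Lemma basis_le d1 d2 (b1 : 'I_d1 -> W) (b2 : 'I_d2 -> W) :
  is_basis S b1 -> is_basis S b2 -> (d1 <= d2)%N.
Proof.
move=> [S1 free1 gen1] [S2 free2 gen2].
have /choice[C CE] : forall i, exists c : 'I_d2 -> K, b1 i = \sum_j c j *: b2 j.
  by move=> i; apply/gen2/S1.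
have /choice[D DE] : forall i, exists c : 'I_d1 -> K, b2 i = \sum_j c j *: b1 j.
  by move=> i; apply/gen1/S2.
have CD : (\matrix_(i, j) C i j) *m (\matrix_(i, j) D i j) = 1%:M.
  apply/matrixP=> i k; rewrite !mxE; apply/eqP; rewrite -subr_eq0; apply/eqP.
  under eq_bigr => j _ do rewrite !mxE.
  apply: (free1 (fun k => \sum_j C i j * D j k - (i == k)%:R)).
  under eq_bigr => l _ do rewrite scalerBl.
  rewrite sumrB [X in _ - X](bigD1 i) //= eqxx scale1r.
  rewrite [X in _ - (_ + X)]big1 ?addr0 => [|l /negPf il]; last by rewrite eq_sym il scale0r.
  under eq_bigr => l _ do rewrite scaler_suml.
  rewrite exchange_big /=; under eq_bigr => j _.
    under eq_bigr => l _ do rewrite -scalerA.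
    rewrite -scaler_sumr -DE; over.
  by rewrite -CE subrr.
exact: (mulmx1_min CD).
Qed.

Lemma subspace_dimE d (b : 'I_d -> W) : is_basis S b -> subspace_dim S = d.
Proof.
move=> basb; apply: xget_unique; first by exists b.
by move=> d' [b' basb']; apply/eqP; rewrite eqn_leq (basis_le basb basb') (basis_le basb' basb).
Qed.

Lemma basis_dim d (b : 'I_d -> W) :
  is_basis S b -> exists b' : 'I_(subspace_dim S) -> W, is_basis S b'.
Proof. by move=> basb; rewrite (subspace_dimE basb); exists b. Qed.

(** The coordinate map [c] embeds [S] into row vectors, so free families in [S] have bounded size
    and one of maximal size generates. *)
Lemma basis_exists d (c : W -> 'rV[K]_d) : linear c -> subspace S ->
  (forall v, S v -> c v = 0 -> v = 0) ->
  exists b : 'I_(subspace_dim S) -> W, is_basis S b.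
Proof.
move=> linc subS injc.
pose free k (b : 'I_k -> W) :=
  forall a : 'I_k -> K, \sum_i a i *: b i = 0 -> forall i, a i = 0.
pose P k := `[< exists b : 'I_k -> W, (forall i, S (b i)) /\ free k b >].
have P0 : exists k, P k.
  by exists 0%N; apply/asboolP; exists (fun=> 0); split=> [[]|a _ []].
have Ple k : P k -> (k <= d)%N.
  move=> /asboolP[b [Sb freeb]].
  have /eqP <- : row_free (\matrix_i c (b i)); last exact: rank_leq_col.
  apply/inj_row_free => v vb; apply/rowP=> i; rewrite mxE.
  apply: (freeb (fun i => v 0 i)); apply: injc.
    by apply: subspace_sum => // j _ _; apply: subspaceZ.
  rewrite lin_sum // -[RHS]vb mulmx_sum_row; apply: eq_bigr => j _.
  by rewrite linZ // rowK.
case: (ex_maxnP P0 Ple) => k /asboolP[b [Sb freeb]] maxk.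
apply: (@basis_dim k b); split=> // v Sv.
(* A relation that involves the new vector [v] expresses it through [b]; without one, [v] followed
   by [b] would be a longer free family. *)
have [[a [a0 av]]|nex] := pselect (exists a : 'I_k.+1 -> K,
   a ord0 != 0 /\ \sum_i a i *: (if unlift ord0 i is Some j then b j else v) = 0).
  exists (fun j => - (a ord0)^-1 * a (lift ord0 j)).
  move: av; rewrite big_ord_recl unlift_none.
  under eq_bigr => j _ do rewrite liftK.
  move/eqP; rewrite addr_eq0 => /eqP /(congr1 (fun w => (a ord0)^-1 *: w)).
  rewrite scalerA mulVf // scale1r => ->.
  by rewrite scalerN scaler_sumr -sumrN; apply: eq_bigr => j _; rewrite scalerA mulNr scaleNr.
have /maxk : P k.+1; last by rewrite ltnn.
apply/asboolP; exists (fun i => if unlift ord0 i is Some j then b j else v); split.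
  by move=> i; case: unliftP => [j _|_].
move=> a a0 i.
have a00 : a ord0 = 0 by apply/eqP/negPn/negP => n0; apply: nex; exists a.
case: (unliftP ord0 i) => [j ->|->] //.
apply: (freeb (fun j => a (lift ord0 j))); rewrite -[RHS]a0 big_ord_recl a00 scale0r add0r.
by apply: eq_bigr => l _; rewrite liftK.
Qed.

End Dimension.

(** The possible sizes of bases agree on both sides, so the equality also covers the case where
    there is none and both dimensions take the default value 0. *)
Lemma subspace_dim_iso (K : fieldType) (V W : lmodType K) (S : set V) (S' : set W)
    (f : V -> W) (f' : W -> V) : linear f -> cancel f f' -> cancel f' f ->
  (forall v, S v <-> S' (f v)) -> subspace_dim S = subspace_dim S'.
Proof.
move=> linf fK f'K SS'.
have linf' : linear f' by move=> k x y; apply: (can_inj fK); rewrite linf !f'K.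
rewrite /subspace_dim; congr (xget _ _); apply/funext => d; apply/propext; split.
  move=> [b [Sb free gen]]; exists (f \o b); split=> [i|c c0|w Sw].
  - exact/SS'.
  - apply: free; apply: (can_inj fK); rewrite (lin0 linf) (lin_sum linf) -[RHS]c0.
    by apply: eq_bigr => i _; rewrite (linZ linf).
  - have [|c cE] := gen (f' w); first by apply/SS'; rewrite f'K.
    exists c; rewrite -[w]f'K cE (lin_sum linf); apply: eq_bigr => i _.
    by rewrite (linZ linf).
move=> [b [Sb free gen]]; exists (f' \o b); split=> [i|c c0|v /SS' Sv].
- by apply/SS'; rewrite /= f'K.
- apply: free; apply: (can_inj f'K); rewrite (lin0 linf') (lin_sum linf') -[RHS]c0.
  by apply: eq_bigr => i _; rewrite (linZ linf').
- have [c cE] := gen _ Sv; exists c; rewrite -[v]fK cE (lin_sum linf').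
  by apply: eq_bigr => i _; rewrite (linZ linf').
Qed.

(** * Representations of a presented Lie algebra *)

Section Interpretation.
Variables (K : fieldType) (X : Type) (V : lmodType K) (op : X -> V -> V).
Hypothesis op_linear : forall x, linear (op x).

Fixpoint lie_interp (t : lie_term K X) (v : V) : V :=
  match t with
  | LGen x => op x v
  | LZero => 0
  | LAdd s t => lie_interp s v + lie_interp t v
  | LScale k s => k *: lie_interp s v
  | LBr s t => lie_interp s (lie_interp t v) - lie_interp t (lie_interp s v)
  end.

Lemma lie_interp_linear t : linear (lie_interp t).
Proof.
elim: t => [x||s IHs t IHt|k s IHs|s IHs t IHt] a u v /=.
- exact: op_linear.
- by rewrite scaler0 addr0.
- by rewrite IHs IHt scalerDr addrACA.
- by rewrite IHs scalerDr !scalerA mulrC.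
- by rewrite IHs IHt IHs IHt scalerBr opprD addrACA.
Qed.

Variable R : lie_term K X -> lie_term K X -> Prop.
Hypothesis op_rel : forall s t, R s t -> forall v, lie_interp s v = lie_interp t v.

(** Commutators of linear operators satisfy the Lie algebra axioms; only the relations in [R] depend
    on the operators. *)
Lemma lie_interp_cong s t : lie_cong R s t ->
  forall v, lie_interp s v = lie_interp t v.
Proof.
have linI := lie_interp_linear.
elim=> {s t} //=.
- by move=> s t u _ IH _ IH' v; rewrite IH.
- by move=> s s' t t' _ IHs _ IHt v; rewrite IHs IHt.
- by move=> k s s' _ IH v; rewrite IH.
- by move=> s s' t t' _ IHs _ IHt v; rewrite IHs IHt [in X in _ - X]IHs IHt.
- by move=> s t u v; rewrite addrA.
- by move=> s t v; rewrite addrC.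
- by move=> s v; rewrite add0r.
- by move=> s v; rewrite scaleN1r addNr.
- by move=> a b s v; rewrite scalerA.
- by move=> s v; rewrite scale1r.
- by move=> k s t v; rewrite scalerDr.
- by move=> a b s v; rewrite scalerDl.
- by move=> k s t u v; rewrite linI scalerBr opprD addrACA.
- by move=> k s t u v; rewrite linI scalerBr opprD addrACA.
- by move=> s v; rewrite subrr.
- by move=> s t u v; rewrite !(linB (linI _)); zmod.
Qed.

End Interpretation.

Section PresentedModule.
Variables (K : fieldType) (X : Type) (V : lmodType K) (op : X -> V -> V).
Variable R : lie_term K X -> lie_term K X -> Prop.
Hypothesis op_linear : forall x, linear (op x).
Hypothesis op_rel : forall s t, R s t ->
  forall v, lie_interp op s v = lie_interp op t v.

Definition presented_act (x : presented_lie R) : V -> V := lie_interp op (repr x).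

Lemma presented_actE t v : presented_act (lie_class R t) v = lie_interp op t v.
Proof. exact: (lie_interp_cong op_linear op_rel (lie_repr R t)). Qed.

Lemma presented_act_linearl v : linear (presented_act^~ v).
Proof.
move=> k; elim/lie_class_ind=> s; elim/lie_class_ind=> t.
by rewrite [k *: _]pl_scaleE [X in presented_act X]pl_addE !presented_actE.
Qed.
Lemma presented_act_linearr x : linear (presented_act x).
Proof. exact: lie_interp_linear. Qed.
Lemma presented_act_lie x y v : presented_act (lie x y) v =
  presented_act x (presented_act y v) - presented_act y (presented_act x v).
Proof.
elim/lie_class_ind: x => s; elim/lie_class_ind: y => t.
by rewrite [lie _ _]pl_brE !presented_actE.
Qed.
End PresentedModule.

Section LieBracket.
Variables (K : fieldType) (g : lieAlgType K).
Implicit Types x y z : g.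

Lemma lieDl x y z : lie (x + y) z = lie x z + lie y z.
Proof. exact: (linD (lie_linearl z)). Qed.
Lemma lieDr x y z : lie z (x + y) = lie z x + lie z y.
Proof. exact: (linD (lie_linearr z)). Qed.
Lemma lieZl k x z : lie (k *: x) z = k *: lie x z.
Proof. exact: (linZ (lie_linearl z)). Qed.
Lemma lieZr k x z : lie z (k *: x) = k *: lie z x.
Proof. exact: (linZ (lie_linearr z)). Qed.
Lemma lie0l z : lie 0 z = 0 :> g. Proof. exact: (lin0 (lie_linearl z)). Qed.
Lemma lie0r z : lie z 0 = 0 :> g. Proof. exact: (lin0 (lie_linearr z)). Qed.
Lemma lieNl x z : lie (- x) z = - lie x z.
Proof. exact: (linN (lie_linearl z)). Qed.
Lemma lieNr x z : lie z (- x) = - lie z x.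
Proof. exact: (linN (lie_linearr z)). Qed.

Lemma lieC x y : lie x y = - lie y x.
Proof.
have := liexx (x + y); rewrite lieDl !lieDr !liexx add0r addr0 => /eqP.
by rewrite addr_eq0 => /eqP.
Qed.
Lemma lie_derivation x y z : lie x (lie y z) = lie (lie x y) z + lie y (lie x z).
Proof.
apply/eqP; rewrite -subr_eq0 -(lie_jacobi x y z); apply/eqP.
rewrite [lie z (lie x y)]lieC [lie z x]lieC lieNr.
by zmod.
Qed.
End LieBracket.

Section PresentedMorphism.
Variables (K : fieldType) (X : Type) (L : lieAlgType K) (f : X -> L).
Variable R : lie_term K X -> lie_term K X -> Prop.

Fixpoint lie_lift (t : lie_term K X) : L :=
  match t with
  | LGen x => f x
  | LZero => 0
  | LAdd s t => lie_lift s + lie_lift t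
  | LScale k s => k *: lie_lift s
  | LBr s t => lie (lie_lift s) (lie_lift t)
  end.

Hypothesis f_rel : forall s t, R s t -> lie_lift s = lie_lift t.

Lemma lie_lift_cong s t : lie_cong R s t -> lie_lift s = lie_lift t.
Proof.
elim=> {s t} //=.
- by move=> s t u _ -> _ ->.
- by move=> s s' t t' _ -> _ ->.
- by move=> k s s' _ ->.
- by move=> s s' t t' _ -> _ ->.
- by move=> s t u; rewrite addrA.
- by move=> s t; rewrite addrC.
- by move=> s; rewrite add0r.
- by move=> s; rewrite scaleN1r addNr.
- by move=> a b s; rewrite scalerA.
- by move=> s; rewrite scale1r.
- by move=> k s t; rewrite scalerDr.
- by move=> a b s; rewrite scalerDl.
- by move=> k s t u; rewrite lieDl lieZl.
- by move=> k s t u; rewrite lieDr lieZr.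
- by move=> s; rewrite liexx.
- by move=> s t u; rewrite lie_jacobi.
Qed.

Definition presented_lift (x : presented_lie R) : L := lie_lift (repr x).

Lemma presented_liftE t : presented_lift (lie_class R t) = lie_lift t.
Proof. exact: lie_lift_cong (lie_repr R t). Qed.

Lemma presented_lift_linear : linear presented_lift.
Proof.
move=> k; elim/lie_class_ind=> s; elim/lie_class_ind=> t.
by rewrite [k *: _]pl_scaleE [X in presented_lift X]pl_addE !presented_liftE.
Qed.
Lemma presented_lift_lie x y :
  presented_lift (lie x y) = lie (presented_lift x) (presented_lift y).
Proof.
elim/lie_class_ind: x => s; elim/lie_class_ind: y => t.
by rewrite [lie _ _]pl_brE !presented_liftE.
Qed.
End PresentedMorphism.

Lemma presented_ind (K : fieldType) (X : Type)
    (R : lie_term K X -> lie_term K X -> Prop) (P : presented_lie R -> Prop) :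
  (forall x, P (lie_gen R x)) -> P 0 ->
  (forall k x y, P x -> P y -> P (k *: x + y)) ->
  (forall x y, P x -> P y -> P (lie x y)) -> forall x, P x.
Proof.
move=> Pg P0 PD PL; elim/lie_class_ind; elim=> [x||s Ps t Pt|k s Ps|s Ps t Pt].
- exact: Pg.
- exact: P0.
- have -> : lie_class R (LAdd s t) = 1 *: lie_class R s + lie_class R t.
    by rewrite scale1r [RHS]pl_addE.
  exact: PD.
- have -> : lie_class R (LScale k s) = k *: lie_class R s + 0.
    by rewrite addr0 [RHS]pl_scaleE.
  exact: PD.
- have -> : lie_class R (LBr s t) = lie (lie_class R s) (lie_class R t).
    by rewrite [RHS]pl_brE.
  exact: PL.
Qed.

(** * Partially commutative words *)

Section Traces.
Variables (T : eqType) (dep : rel T).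
Hypothesis dep_refl : reflexive dep.

(** Equality in the trace monoid, by the projection criterion: two words are equal up to
    commutations when their projections on each pair of dependent letters coincide. Cancellation is
    immediate in this form, and [tequiv_ind] recovers the description by elementary commutations. *)
Definition tequiv (s t : seq T) : Prop :=
  forall i j, dep i j -> filter (pred2 i j) s = filter (pred2 i j) t.

Lemma tequiv_refl s : tequiv s s. Proof. by []. Qed.
Lemma tequiv_sym s t : tequiv s t -> tequiv t s.
Proof. by move=> st i j /st. Qed.
Lemma tequiv_trans s t u : tequiv s t -> tequiv t u -> tequiv s u.
Proof. by move=> st tu i j ij; rewrite st // tu. Qed.

Lemma tequiv_cat s s' t t' : tequiv s s' -> tequiv t t' -> tequiv (s ++ t) (s' ++ t').
Proof. by move=> ss tt i j ij; rewrite !filter_cat ss // tt. Qed.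

Lemma tequiv_perm s t : tequiv s t -> perm_eq s t.
Proof.
move=> st; apply/allP=> x _ /=; rewrite -!size_filter.
have := st x x (dep_refl x).
have E u : filter (pred2 x x) u = filter (pred1 x) u.
  by apply: eq_filter => y /=; rewrite orbb.
by rewrite !E => /(congr1 size) ->.
Qed.

Lemma tequiv_cat2l s t u : tequiv (s ++ t) (s ++ u) -> tequiv t u.
Proof.
move=> st i j ij; have := st i j ij; rewrite !filter_cat => /eqP.
by rewrite eqseq_cat // eqxx => /eqP.
Qed.

Lemma tequiv_cat2r s t u : tequiv (t ++ s) (u ++ s) -> tequiv t u.
Proof.
move=> st i j ij; have := st i j ij; rewrite !filter_cat => /eqP.
rewrite eqseq_cat; first by rewrite eqxx andbT => /eqP.
have := congr1 size (st i j ij); rewrite !filter_cat !size_cat => /eqP.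
by rewrite eqn_add2r => /eqP.
Qed.

Lemma tequiv_cons x s t : tequiv s t -> tequiv (x :: s) (x :: t).
Proof. exact: (tequiv_cat (tequiv_refl [:: x])). Qed.

Lemma tequiv_swap u x y v : ~~ dep x y -> ~~ dep y x ->
  tequiv (u ++ x :: y :: v) (u ++ y :: x :: v).
Proof.
move=> xy yx; apply: tequiv_cat => // i j ij /=.
have nxy : x == y = false by apply: contraNF xy => /eqP ->; apply: dep_refl.
have [/andP[]|] := boolP (((x == i) || (x == j)) && ((y == i) || (y == j))).
  case/orP=> /eqP xi /orP[]/eqP yi; subst; rewrite ?eqxx in nxy *.
  - by [].
  - by rewrite ij in xy.
  - by rewrite ij in yx.
  - by [].
by case: ((x == i) || (x == j)); case: ((y == i) || (y == j)).
Qed.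

Lemma tequiv_swap_list u x v : all (fun y => ~~ dep x y && ~~ dep y x) u ->
  tequiv (x :: u ++ v) (u ++ x :: v).
Proof.
elim: u => [//|y u IH] /= /andP[/andP[xy yx] /IH {}IH].
by apply: (tequiv_trans (@tequiv_swap [::] x y _ xy yx)); apply: tequiv_cons.
Qed.

Lemma split_first x (t : seq T) : x \in t ->
  exists u v, t = u ++ x :: v /\ x \notin u.
Proof.
elim: t => [//|y t IH]; have [<-|yx] := eqVneq y x; first by exists [::], t.
rewrite inE eq_sym (negPf yx) => /IH[u [v [-> xu]]].
by exists (y :: u), v; rewrite inE eq_sym negb_or yx.
Qed.

Hypothesis dep_sym : ssrbool.symmetric dep.

(** A letter y depending on [x] and preceding the first [x] of [t] would make the projection of [t]
    on x and y begin with y, whereas that of [x :: s] begins with [x]. *)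
Lemma tequiv_consE x s t : tequiv (x :: s) t ->
  exists u v, [/\ t = u ++ x :: v, all (fun y => ~~ dep x y && ~~ dep y x) u
                & tequiv s (u ++ v)].
Proof.
move=> xst; have xt : x \in t by rewrite -(perm_mem (tequiv_perm xst)) mem_head.
have [u [v [tE xu]]] := split_first xt; exists u, v.
have ind : all (fun y => ~~ dep x y && ~~ dep y x) u.
  apply/allP=> y yu; rewrite [dep y x]dep_sym andbb; apply/negP => xy.
  have := xst x y xy; rewrite tE /= eqxx filter_cat /=.
  have : y \in filter (pred2 x y) u by rewrite mem_filter /= eqxx orbT.
  have : x \notin filter (pred2 x y) u by rewrite mem_filter negb_and xu orbT.
  by case: (filter _ u) => [//|z w] /= xzw _ [zx]; rewrite zx mem_head in xzw.
split=> //; apply: (@tequiv_cat2l [:: x]); apply: (tequiv_trans xst); rewrite tE.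
exact/tequiv_sym/tequiv_swap_list.
Qed.

(* Commutations generate the equivalence of words, here in the form of an *)
(* induction principle for functions which may be invariant only up to E. *)
Lemma tequiv_ind (B : Type) (E : B -> B -> Prop) (F : seq T -> B) (P : seq T -> Prop) :
  (forall b, E b b) -> (forall a b c, E a b -> E b c -> E a c) ->
  (forall s t, tequiv s t -> P s -> P t) ->
  (forall u x y v, ~~ dep x y -> P (u ++ x :: y :: v) ->
     E (F (u ++ x :: y :: v)) (F (u ++ y :: x :: v))) ->
  forall s t, tequiv s t -> P s -> E (F s) (F t).
Proof.
move=> Erefl Etrans PE FE s; elim: s F P PE FE => [|x s IH] F P PE FE t st Ps.
  have := tequiv_perm st; rewrite perm_sym => /perm_nilP -> //.
have [u [v [tE ind sE]]] := tequiv_consE st.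
apply: (Etrans _ (F (x :: u ++ v))).
  apply: (IH (F \o cons x) (P \o cons x)) => // [s' t' /(tequiv_cons x) + |w y z w' yz].
    exact: PE.
  exact: (FE (x :: w)).
have: P (x :: u ++ v) by apply: PE Ps; apply: tequiv_cons.
rewrite tE {st IH Ps t tE sE}.
elim: u F P PE FE ind => [//|y u IHu] F P PE FE /= /andP[/andP[xy yx] ind] Pxy.
have Pyx : P (y :: x :: u ++ v) by apply: PE Pxy; apply: (@tequiv_swap [::]).
apply: (Etrans _ (F (y :: x :: u ++ v))); first exact: (FE [::]).
apply: (IHu (F \o cons y) (P \o cons y)) => // [s' t' /(tequiv_cons y) + |w z z' w' zz].
  exact: PE.
exact: (FE (y :: w)).
Qed.

Lemma tequiv_eq (B : Type) (F : seq T -> B) :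
  (forall u x y v, ~~ dep x y -> F (u ++ x :: y :: v) = F (u ++ y :: x :: v)) ->
  forall s t, tequiv s t -> F s = F t.
Proof.
move=> FE s t st; apply: (@tequiv_ind B eq F (fun=> True)) => //.
- by move=> a b c -> ->.
- by move=> u x y v xy _; apply: FE.
Qed.

End Traces.

Section Canonical.
Variables (T : choiceType) (dep : rel T).

(** A normal form by choice: equivalent words define the same predicate, and the default value
    satisfies it, so the result depends only on the class of [s]. *)
Definition canon (s : seq T) : seq T := choose (fun t => `[< tequiv dep s t >]) s.

Lemma canonP s : tequiv dep s (canon s).
Proof. by apply/asboolP; apply: (@chooseP _ (fun t => `[< tequiv dep s t >])); apply/asboolP. Qed.

Lemma canonE s t : tequiv dep s t -> canon s = canon t.
Proof.
move=> st; rewrite /canon.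
have E : (fun u => `[< tequiv dep s u >]) =1 (fun u => `[< tequiv dep t u >]).
  move=> u; apply/asbool_equiv_eq; split; apply: tequiv_trans => //.
  exact: tequiv_sym.
rewrite (eq_choose E); apply: choose_id; apply/asboolP => //.
exact: tequiv_sym.
Qed.

Lemma canonK s : canon (canon s) = canon s.
Proof. by apply/esym/canonE/canonP. Qed.

Lemma canon_cons x s : canon (x :: canon s) = canon (x :: s).
Proof. by apply/canonE/(tequiv_cons x)/tequiv_sym/canonP. Qed.

Lemma canon_inj s t : canon s = canon t -> tequiv dep s t.
Proof.
by move=> st; apply: tequiv_trans (canonP s) _; rewrite st; apply/tequiv_sym/canonP.
Qed.
End Canonical.

(** * Words in the Chevalley generators *)

Lemma addmCA n (a b c : 'X_{1..n}) : (a + (b + c) = b + (a + c))%MM.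
Proof. by rewrite !addmA (addmC a). Qed.

Section Weights.
Variables (K : numFieldType) (n : nat).
Implicit Types (mu nu : weight K n) (h : cartan K n) (b c : 'X_{1..n}) (s t : seq 'I_n) (i j : 'I_n).

Lemma wpair_linearl h : linear_for *%R (fun mu => wpair mu h).
Proof. by move=> k mu nu; rewrite /wpair mulmxDr -scalemxAr !mxE. Qed.
Lemma wpair_linearr mu : linear_for *%R (fun h => wpair mu h).
Proof. by move=> k h h'; rewrite /wpair mulmxDl -scalemxAl !mxE. Qed.
Lemma wpairDl mu nu h : wpair (mu + nu) h = wpair mu h + wpair nu h.
Proof. by have := wpair_linearl h 1 mu nu; rewrite scale1r mul1r. Qed.
Lemma wpairNl mu h : wpair (- mu) h = - wpair mu h.
Proof. by rewrite /wpair mulmxN mxE. Qed.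
Lemma wpairNr mu h : wpair mu (- h) = - wpair mu h.
Proof. by rewrite /wpair mulNmx mxE. Qed.
Lemma wpairBl mu nu h : wpair (mu - nu) h = wpair mu h - wpair nu h.
Proof. by rewrite wpairDl wpairNl. Qed.
Lemma wpair0l h : wpair 0 h = 0 :> K.
Proof. by rewrite /wpair mulmx0 mxE. Qed.

Lemma wpair_inj mu nu : (forall h, wpair mu h = wpair nu h) -> mu = nu.
Proof.
move=> mn; apply/colP=> i; have := mn (coroot K i).
by rewrite /wpair /coroot -!rowE !mxE.
Qed.

Lemma root_ofD b c : root_of K (b + c)%MM = root_of K b + root_of K c.
Proof.
by rewrite /root_of -big_split; apply: eq_bigr => i _; rewrite mnmDE mulrnDr.
Qed.
Lemma root_of0 : root_of K (0%MM : 'X_{1..n}) = 0.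
Proof. by rewrite /root_of big1 // => i _; rewrite mnm0E. Qed.
Lemma root_of1 i : root_of K U_(i)%MM = simple_root K i.
Proof.
rewrite /root_of (bigD1 i) //= mnm1E eqxx big1 ?addr0 // => j.
by rewrite mnm1E eq_sym => /negPf ->.
Qed.

Definition content s : 'X_{1..n} := [multinom count_mem i s | i < n].

Lemma content_nil : content [::] = 0%MM.
Proof. by apply/mnmP=> i; rewrite !mnmE. Qed.
Lemma content_cons i s : content (i :: s) = (U_(i) + content s)%MM.
Proof. by apply/mnmP=> j; rewrite mnmDE mnm1E !mnmE. Qed.
Lemma content_cat s t : content (s ++ t) = (content s + content t)%MM.
Proof. by apply/mnmP=> j; rewrite mnmDE !mnmE count_cat. Qed.
Lemma content_swap s i j t : content (s ++ i :: j :: t) = content (s ++ j :: i :: t).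
Proof. by rewrite !content_cat !content_cons (addmCA U_(i)). Qed.
Lemma mdeg_content s : mdeg (content s) = size s.
Proof.
by elim: s => [|i s IH]; rewrite ?content_nil ?mdeg0 // content_cons mdegD mdeg1 IH.
Qed.
Lemma content_perm s t : perm_eq s t -> content s = content t.
Proof. by move=> /permP st; apply/mnmP=> i; rewrite !mnmE st. Qed.
Lemma perm_content s t : content s = content t -> perm_eq s t.
Proof.
move=> /mnmP st; apply/allP=> i _ /=; apply/eqP.
by have := st i; rewrite !mnmE.
Qed.

(** The complement of the commutations: A_ij = 0 exactly when [dep i j] fails, the diagonal entries
    being nonzero in characteristic 0. *)
Definition dep (i j : 'I_n) := (i == j) || adjacent i j.

Lemma adjacent_sym i j : adjacent i j = adjacent j i :> bool.
Proof. by rewrite /adjacent orbC. Qed.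
Lemma adjacent_irr i : adjacent i i = false.
Proof. by rewrite /adjacent orbb gtn_eqF. Qed.
Lemma dep_refl : reflexive dep. Proof. by move=> i; rewrite /dep eqxx. Qed.
Lemma dep_sym : ssrbool.symmetric dep.
Proof. by move=> i j; rewrite /dep eq_sym adjacent_sym. Qed.

Lemma cartan_sym i j : cartan_mx K n i j = cartan_mx K n j i.
Proof. by rewrite !mxE eq_sym adjacent_sym. Qed.
Lemma cartan_indep i j : ~~ dep i j -> cartan_mx K n i j = 0.
Proof. by rewrite mxE negb_or => /andP[/negPf -> /negPf ->]. Qed.

Lemma dep_cartan i j : cartan_mx K n i j = 0 -> ~~ dep i j.
Proof.
rewrite mxE /dep; case: eqP => _ /=; first by move/eqP; rewrite oppr_eq0 pnatr_eq0.
by case: adjacent => // /eqP; rewrite oppr_eq0 oner_eq0.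
Qed.

Lemma content_tequiv s t : tequiv dep s t -> content s = content t.
Proof. by move/(tequiv_perm dep_refl)/content_perm. Qed.
Lemma content_canon s : content (canon dep s) = content s.
Proof. by apply/esym/content_tequiv/canonP. Qed.
Lemma size_canon s : size (canon dep s) = size s.
Proof. by rewrite -!mdeg_content content_canon. Qed.
Lemma canon_nil : canon dep ([::] : seq 'I_n) = [::].
Proof. by apply/size0nil; rewrite size_canon. Qed.
End Weights.

Section DualModule.
Variables (K : numFieldType) (n : nat) (lam : weight K n) (W : lmodType K).
Implicit Types (s t : seq 'I_n) (i j : 'I_n).
Local Notation dep := (@dep n).
Local Notation canon := (canon dep).

(* W-valued functions on words, as a completed dual of M(lam): only the   *)
(* values at canonical representatives matter to the action.              *)
Definition dual_module of weight K n := seq 'I_n -> W.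
HB.instance Definition _ mu := GRing.Lmodule.copy (dual_module mu) (seq 'I_n -> W).
Local Notation D := (dual_module lam).
Implicit Types phi psi : D.

Lemma dualD phi psi s : (phi + psi) s = phi s + psi s. Proof. by []. Qed.
Lemma dualB phi psi s : (phi - psi) s = phi s - psi s. Proof. by []. Qed.
Lemma dualN phi s : (- phi) s = - phi s. Proof. by []. Qed.
Lemma dualZ k phi s : (k *: phi) s = k *: phi s. Proof. by []. Qed.

Definition word_weight s : weight K n := lam - root_of K (content s).

Lemma word_weight_cons i s :
  word_weight s = word_weight (i :: s) + simple_root K i.
Proof.
by rewrite /word_weight content_cons root_ofD root_of1 opprD; zmod.
Qed.

(** The value of [psi] on the expansion of e_i f_s v. As e_i moves to the right through the word,
    each letter i that it meets is deleted, with the value of the coroot on the weight of the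
    letters to its right as a factor. *)
Fixpoint del (i : 'I_n) (psi : D) s : W :=
  if s is j :: s' then
    del i (fun t => psi (j :: t)) s' +
    (if j == i then wpair (word_weight s') (coroot K i) *: psi s' else 0)
  else 0.

(** All words obtained by deleting one letter [i] from [s] have the same content. Factors depending
    only on the weight can thus be pulled out of [del]. *)
Lemma del_ext i psi psi' s :
  (forall t, content s = (U_(i) + content t)%MM -> psi t = psi' t) ->
  del i psi s = del i psi' s.
Proof.
elim: s psi psi' => [//|j s IH] psi psi' E /=.
congr (_ + _); first by apply: IH => t st; apply: E; rewrite !content_cons st addmCA.
by case: eqP => // ji; rewrite E // content_cons ji.
Qed.

Lemma del_linear i s : linear (fun psi => del i psi s).
Proof.
move=> k psi psi'; elim: s psi psi' => [|j s IH] psi psi' /=.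
  by rewrite scaler0 addr0.
rewrite [X in X + _](IH (fun t => psi (j :: t)) (fun t => psi' (j :: t))).
case: (j == i); last by rewrite !addr0.
rewrite [(k *: psi + psi') s](_ : _ = k *: psi s + psi' s) //.
by rewrite !scalerDr addrACA !scalerA mulrC.
Qed.

(** When one of the commuting letters is deleted, the other one lies to its right in one word and to
    its left in the other; the two scalars differ by the Cartan entry of x and y, which is 0. *)
Lemma del_swap i psi u x y v : ~~ dep x y ->
  (forall u x y v, ~~ dep x y -> psi (u ++ x :: y :: v) = psi (u ++ y :: x :: v)) ->
  del i psi (u ++ x :: y :: v) = del i psi (u ++ y :: x :: v).
Proof.
move=> xy; elim: u psi => [|z u IH] psi psiE /=; last first.
  congr (_ + _); first by apply: IH => u' x' y' v'; apply: (psiE (z :: u')).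
  case: eqP => // _; rewrite psiE //; congr (wpair _ _ *: _).
  by rewrite /word_weight content_swap.
have xy_neq : x != y by apply: contraNneq xy => ->; apply: dep_refl.
have /del_ext -> : forall t, content v = (U_(i) + content t)%MM ->
    psi [:: x, y & t] = psi [:: y, x & t] by move=> t _; apply: (psiE [::]).
have ww z t : ~~ dep z i -> wpair (word_weight (z :: t)) (coroot K i)
    = wpair (word_weight t) (coroot K i).
  move=> zi; rewrite [in RHS](word_weight_cons z) wpairDl simple_root_coroot.
  by rewrite cartan_sym cartan_indep // addr0.
rewrite -!addrA; congr (_ + _); have [yi|yi] := eqVneq y i; have [xi|xi] := eqVneq x i.
- by rewrite xi yi eqxx in xy_neq.
- by rewrite add0r addr0 ww // -yi.
- by rewrite add0r addr0 ww // -xi dep_sym.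
- by [].
Qed.

Lemma del_tequiv i psi s t :
  (forall u x y v, ~~ dep x y -> psi (u ++ x :: y :: v) = psi (u ++ y :: x :: v)) ->
  tequiv dep s t -> del i psi s = del i psi t.
Proof.
move=> psiE; apply: tequiv_eq; [exact: dep_refl | exact: dep_sym|].
by move=> u x y v xy; apply: del_swap.
Qed.

Lemma del_del i j psi s : ~~ dep i j ->
  del i (del j psi) s = del j (del i psi) s.
Proof.
move=> ij; elim: s psi => [//|k s IH] psi /=.
have D a b (f : D) (ab : ~~ dep a b) :
  del a (fun t => del b (fun t' => f (k :: t')) t +
    (if k == b then wpair (word_weight t) (coroot K b) *: f t else 0)) s
  = del a (del b (fun t' => f (k :: t'))) s +
    (if k == b then wpair (word_weight s) (coroot K b) *: del a f s else 0).
  have := del_linear a s 1 (del b (fun t' => f (k :: t')))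
    (fun t => if k == b then wpair (word_weight t) (coroot K b) *: f t else 0).
  rewrite !scale1r => -> ; congr (_ + _).
  case: eqP => [_|_]; last exact: (lin0 (del_linear a s)).
  rewrite -(linZ (del_linear a s)); apply: del_ext => t st.
  congr (_ *: _); have -> : word_weight t = word_weight s + simple_root K a.
    by rewrite (word_weight_cons a) /word_weight content_cons -st.
  by rewrite wpairDl simple_root_coroot cartan_sym cartan_indep ?addr0.
have ji : ~~ dep j i by rewrite dep_sym.
by rewrite D // D // IH addrAC.
Qed.

(** The contragredient action (x phi)(m) = - phi(x m), read on words: hence the sign in every
    clause. *)
Definition dual_op (x : chevalley_gen K n) (phi : D) : D :=
  match x with
  | CartanGen h => fun s => - (wpair (word_weight s) h *: phi (canon s))
  | FGen i => fun s => - phi (canon (i :: s))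
  | EGen i => fun s => - del i (phi \o canon) s
  end.

Lemma dual_op_linear x : linear (dual_op x).
Proof.
case: x => [h|i|i] k phi psi; apply/funext=> s; rewrite ?fctE /=.
- by rewrite scalerDr opprD !scalerN !scalerA mulrC.
- by rewrite [LHS](congr1 -%R (del_linear i s k (phi \o canon) (psi \o canon))) opprD scalerN.
- by rewrite opprD scalerN.
Qed.

Lemma canon_invariant phi u x y v : ~~ dep x y ->
  phi (canon (u ++ x :: y :: v)) = phi (canon (u ++ y :: x :: v)).
Proof.
move=> xy; congr phi; apply: canonE; apply: tequiv_swap => //; first exact: dep_refl.
by rewrite dep_sym.
Qed.

Lemma del_canon i psi s : del i (psi \o canon) (canon s) = del i (psi \o canon) s.
Proof.
by apply/esym/del_tequiv/canonP => u x y v; apply: canon_invariant.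
Qed.

(** The first letter of [i :: s] gives the extra term of [del], which is the coroot in [e_i, f_i].
    Commutation holds by [del_del] for the e_i and by invariance of [canon] for the f_i. *)
Lemma dual_op_rel (a b : lie_term K (chevalley_gen K n)) : chevalley_rel a b ->
  forall phi, lie_interp dual_op a phi = lie_interp dual_op b phi.
Proof.
have ww u : word_weight (canon u) = word_weight u by rewrite /word_weight content_canon.
case=> {a b} [k h h'|h h'|h i|h i|i|i j ij|i j ij|i j ij] phi; apply/funext=> s /=.
- by rewrite dualD dualZ wpair_linearr scalerDl opprD scalerN scalerA.
- by rewrite dualB !ww !canonK !scalerN !opprK !scalerA mulrC subrr.
- rewrite dualB dualZ del_canon.
  have -> : del i ((fun s1 => - (wpair (word_weight s1) h *: phi (canon s1))) \o canon) s
     = - (wpair (word_weight s + simple_root K i) h) *: del i (phi \o canon) s.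
    rewrite -(linZ (del_linear i s)); apply: del_ext => t st.
    have wt : word_weight t = word_weight s + simple_root K i.
      by rewrite (word_weight_cons i) /word_weight content_cons st.
    by rewrite dualZ /= canonK ww scaleNr wt.
  by rewrite wpairDl scaleNr scalerN !opprK scalerDl scalerN opprD addrA subrr add0r.
- rewrite dualB dualZ !canonK !canon_cons ww [in X in X - _](word_weight_cons i) wpairDl.
  by rewrite scalerDl !scalerN !scaleNr !opprK opprD !opprK addrC addKr.
- rewrite dualB del_canon /= eqxx.
  have -> : del i ((fun s1 => - phi (canon (i :: s1))) \o canon) s
     = - del i (fun t => phi (canon (i :: t))) s.
    rewrite -(linN (del_linear i s)); apply: del_ext => t _.
    by rewrite dualN /= canon_cons.
  by rewrite !opprK opprD addrA subrr add0r.
- rewrite dualB del_canon /= eq_sym (negPf ij) addr0.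
  have -> : del i ((fun s1 => - phi (canon (j :: s1))) \o canon) s
     = - del i (fun t => phi (canon (j :: t))) s.
    rewrite -(linN (del_linear i s)); apply: del_ext => t _.
    by rewrite dualN /= canon_cons.
  by rewrite !opprK subrr.
- have E a b : del a ((fun s1 => - del b (phi \o canon) s1) \o canon) s
     = - del a (del b (phi \o canon)) s.
    rewrite -(linN (del_linear a s)); apply: del_ext => t _.
    by rewrite dualN /= del_canon.
  by rewrite dualB !E del_del ?subrr // (dep_cartan ij).
- rewrite dualB !opprK !canon_cons; apply/eqP; rewrite subr_eq0; apply/eqP.
  by apply: (@canon_invariant phi [::]); rewrite dep_sym (dep_cartan ij).
Qed.

HB.instance Definition _ := isLieModule.Build K (bkm K n) (D)
  (presented_act_linearl dual_op_linear dual_op_rel)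
  (presented_act_linearr dual_op_linear (R := @chevalley_rel K n))
  (presented_act_lie dual_op_linear dual_op_rel).

Lemma dual_actE x phi : act (lie_gen (@chevalley_rel K n) x) phi = dual_op x phi.
Proof. exact: (presented_actE dual_op_linear dual_op_rel). Qed.
End DualModule.

(** * Verma modules and their duals *)

Section QuotientMaps.
Variables (K : fieldType) (g : lieAlgType K) (V : lieModType g) (S : set V).

Lemma quot_proj_hom : is_module_hom (quot_proj S : V -> quot_module S).
Proof.
split=> [k v w|x v]; last by rewrite [RHS]quot_actE.
by rewrite [k *: quot_proj _ _]quot_scaleE [RHS]quot_addE.
Qed.

Lemma quot_proj_surj (a : quot_module S) : exists v, quot_proj S v = a.
Proof. by elim/quot_ind: a => v; exists v. Qed.

Lemma quot_proj0 v : quot_proj S v = 0 :> quot_module S <-> span_submodule S v.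
Proof. by rewrite -(lin0 quot_proj_hom.1) quot_projP subr0. Qed.

Lemma mem_span_submodule v : S v -> span_submodule S v.
Proof. by move=> Sv N _; apply. Qed.

Lemma submodule_subspace (N : set V) : is_submodule N -> subspace N.
Proof. by case=> N0 Nlin _. Qed.

Lemma span_subset (N : set V) : is_submodule N -> (forall v, S v -> N v) ->
  forall v, span_submodule S v -> N v.
Proof. by move=> subN SN v; apply. Qed.

Lemma kernel_iso (W : lieModType g) (pi : V -> W) : is_module_hom pi ->
  (forall w, exists v, pi v = w) ->
  (forall v, pi v = 0 <-> span_submodule S v) -> module_iso W (quot_module S).
Proof.
move=> [linpi homp] /choice[s sK] kerp.
have sE v : quot_proj S (s (pi v)) = quot_proj S v.
  by apply/quot_projP/kerp; rewrite (linB linpi) sK subrr.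
exists (fun w => quot_proj S (s w)); split; last first.
  exists (fun a : quot_module S => pi (repr a)) => [w|].
    rewrite -[RHS]sK; apply/eqP; rewrite -subr_eq0 -(linB linpi); apply/eqP/kerp.
    exact: quot_repr.
  elim/quot_ind=> v; rewrite sE; apply/quot_projP; exact: quot_repr.
split=> [k v w|x v].
  rewrite -{1}[v]sK -{1}[w]sK -linpi sE quot_proj_hom.1 //.
by rewrite -{1}[v]sK -homp sE quot_proj_hom.2.
Qed.
End QuotientMaps.

Section VermaDual.
Variables (K : numFieldType) (n : nat) (lam : weight K n) (W : lmodType K).
Local Notation g := (bkm K n).
Local Notation D := (dual_module W lam).

(** Each factor is moved onto [phi] with a sign, as by the antipode, and the result is evaluated at
    the empty word, which stands for the highest weight vector. *)
Fixpoint env_pair (u : env_term K g) (phi : D) : W :=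
  match u with
  | UOne => phi [::]
  | UZero => 0
  | UAdd s t => env_pair s phi + env_pair t phi
  | UScale k s => k *: env_pair s phi
  | UAct x s => - env_pair s (act x phi)
  end.

Lemma env_pair_linear u : linear (env_pair u).
Proof.
elim: u => [||s IHs t IHt|k s IHs|x s IHs] a phi psi //=.
- by rewrite scaler0 addr0.
- by rewrite IHs IHt scalerDr addrACA.
- by rewrite IHs scalerDr !scalerA mulrC.
- by rewrite act_linearr IHs opprD scalerN.
Qed.

Lemma env_pair_cong u u' : env_cong u u' -> forall phi, env_pair u phi = env_pair u' phi.
Proof.
elim=> {u u'} //=.
- by move=> s t u _ IH _ IH' phi; rewrite IH.
- by move=> s s' t t' _ IHs _ IHt phi; rewrite IHs IHt.
- by move=> k s s' _ IH phi; rewrite IH.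
- by move=> x s s' _ IH phi; rewrite IH.
- by move=> s t u phi; rewrite addrA.
- by move=> s t phi; rewrite addrC.
- by move=> s phi; rewrite add0r.
- by move=> s phi; rewrite scaleN1r addNr.
- by move=> a b s phi; rewrite scalerA.
- by move=> s phi; rewrite scale1r.
- by move=> k s t phi; rewrite scalerDr.
- by move=> a b s phi; rewrite scalerDl.
- by move=> k x y s phi; rewrite act_linearl env_pair_linear opprD scalerN.
- by move=> k x s t phi; rewrite opprD scalerN.
- by move=> x y s phi; rewrite act_lie (linB (env_pair_linear _)) scaleN1r !opprK opprB addrC.
Qed.

Lemma env_pair_repr s phi : env_pair (repr (env_class s)) phi = env_pair s phi.
Proof. exact/env_pair_cong/env_repr. Qed.

Lemma env_pair_linearl phi : linear (fun a : env_module g => env_pair (repr a) phi).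
Proof.
move=> k; elim/env_class_ind=> s; elim/env_class_ind=> t.
by rewrite [k *: _]env_scaleE [X in repr X]env_addE !env_pair_repr.
Qed.

Lemma env_pair_act x (a : env_module g) phi :
  env_pair (repr (act x a)) phi = - env_pair (repr a) (act x phi).
Proof. by elim/env_class_ind: a => s; rewrite [act x _]env_actE !env_pair_repr. Qed.

Lemma dual_hE h (phi : D) s :
  act (bkm_h h) phi s = - (wpair (word_weight lam s) h *: phi (canon (@dep n) s)).
Proof. by rewrite dual_actE. Qed.
Lemma dual_eE i (phi : D) s :
  act (bkm_e K i) phi s = - @del K n lam W i (phi \o canon (@dep n)) s.
Proof. by rewrite dual_actE. Qed.
Lemma dual_fE i (phi : D) s :
  act (bkm_f K i) phi s = - phi (canon (@dep n) (i :: s)).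
Proof. by rewrite dual_actE. Qed.

Lemma word_weight_nil : word_weight lam [::] = lam.
Proof. by rewrite /word_weight content_nil root_of0 subr0. Qed.

(** The elements pairing to 0 with every function form a submodule. It contains the generators of
    the ideal because [del] vanishes on the empty word and h acts there by - lam(h). *)
Lemma env_pair_ideal (a : env_module g) : span_submodule (verma_ideal lam) a ->
  forall phi : D, env_pair (repr a) phi = 0.
Proof.
have sub : is_submodule (fun a : env_module g => forall phi : D, env_pair (repr a) phi = 0).
  split=> [phi|k v w v0 w0 phi|x v v0 phi].
  - exact: (lin0 (env_pair_linearl phi)).
  - by rewrite env_pair_linearl v0 w0 scaler0 addr0.
  - by rewrite env_pair_act v0 oppr0.
apply: (span_subset sub) => {}a [[i ->]|[h ->]] phi.
- by rewrite env_pair_act env_pair_repr /= dual_eE oppr0 oppr0.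
- rewrite (linB (env_pair_linearl phi)) (linZ (env_pair_linearl phi)).
  rewrite env_pair_act !env_pair_repr /= dual_hE canon_nil word_weight_nil opprK.
  by rewrite subrr.
Qed.

Definition verma_pair (m : verma lam) (phi : D) : W := env_pair (repr (repr m)) phi.

Lemma verma_pair_proj a phi :
  verma_pair (quot_proj (verma_ideal lam) a) phi = env_pair (repr a) phi.
Proof.
apply/eqP; rewrite -subr_eq0 -(linB (env_pair_linearl phi)); apply/eqP.
by apply: env_pair_ideal; apply: quot_repr.
Qed.

Lemma verma_pair_linearl phi : linear (verma_pair^~ phi).
Proof.
move=> k; elim/quot_ind=> a; elim/quot_ind=> b.
by rewrite -(quot_proj_hom _).1 !verma_pair_proj env_pair_linearl.
Qed.
Lemma verma_pair_linearr m : linear (verma_pair m).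
Proof. exact: env_pair_linear. Qed.
Lemma verma_pair_act x m phi : verma_pair (act x m) phi = - verma_pair m (act x phi).
Proof.
by elim/quot_ind: m => a; rewrite -(quot_proj_hom _).2 !verma_pair_proj env_pair_act.
Qed.
End VermaDual.

Section HighestWeight.
Variables (K : numFieldType) (n : nat).
Local Notation g := (bkm K n).
Implicit Types (i j : 'I_n) (s t : seq 'I_n) (lam mu : weight K n).

Lemma lie_he h i : lie (bkm_h h) (bkm_e K i) = wpair (simple_root K i) h *: bkm_e K i.
Proof.
rewrite [RHS]pl_scaleE [LHS]pl_brE; apply/lie_classP/lc_rel; exact: rel_he.
Qed.
Lemma lie_hf h i : lie (bkm_h h) (bkm_f K i) = - wpair (simple_root K i) h *: bkm_f K i.
Proof.
rewrite [RHS]pl_scaleE [LHS]pl_brE; apply/lie_classP/lc_rel; exact: rel_hf.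
Qed.
Lemma lie_hh (h h' : cartan K n) : lie (bkm_h h) (bkm_h h') = 0.
Proof. by rewrite [LHS]pl_brE; apply/lie_classP/lc_rel; apply: rel_hh. Qed.
Lemma lie_ef i j : lie (bkm_e K i) (bkm_f K j) = if i == j then bkm_h (coroot K i) else 0.
Proof.
rewrite [LHS]pl_brE; case: (eqVneq i j) => [->|ij]; apply/lie_classP/lc_rel.
  exact: rel_ef_eq.
exact: rel_ef_neq.
Qed.
Lemma lie_ee i j : ~~ dep i j -> lie (bkm_e K i) (bkm_e K j) = 0.
Proof.
by move=> ij; rewrite [LHS]pl_brE; apply/lie_classP/lc_rel/rel_ee/cartan_indep.
Qed.
Lemma lie_ff i j : ~~ dep i j -> lie (bkm_f K i) (bkm_f K j) = 0.
Proof.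
by move=> ij; rewrite [LHS]pl_brE; apply/lie_classP/lc_rel/rel_ff/cartan_indep.
Qed.
Lemma bkm_h_linear : linear (@bkm_h K n).
Proof.
move=> k h h'; rewrite [k *: bkm_h h]pl_scaleE [RHS]pl_addE.
by apply/lie_classP/lc_rel; apply: rel_cartan.
Qed.

Lemma act_swap (V : lieModType g) (x y : g) (v : V) :
  act x (act y v) = act y (act x v) + act (lie x y) v.
Proof. by rewrite act_lie addrC subrK. Qed.

Lemma act0l (V : lieModType g) (v : V) : act (0 : g) v = 0.
Proof. exact: (lin0 (act_linearl v)). Qed.
Lemma act0r (V : lieModType g) (x : g) : act x (0 : V) = 0.
Proof. exact: (lin0 (act_linearr x)). Qed.
Lemma actZl (V : lieModType g) k (x : g) (v : V) : act (k *: x) v = k *: act x v.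
Proof. exact: (linZ (act_linearl v)). Qed.
Lemma actZr (V : lieModType g) k (x : g) (v : V) : act x (k *: v) = k *: act x v.
Proof. exact: (linZ (act_linearr x)). Qed.
Lemma actDr (V : lieModType g) (x : g) (v w : V) : act x (v + w) = act x v + act x w.
Proof. exact: (linD (act_linearr x)). Qed.
Lemma submodule_gen (V : lieModType g) (N : set V) : subspace N ->
  (forall h v, N v -> N (act (bkm_h h) v)) ->
  (forall i v, N v -> N (act (bkm_e K i) v)) ->
  (forall i v, N v -> N (act (bkm_f K i) v)) -> is_submodule N.
Proof.
move=> subN Nh Ne Nf; split=> [|k v w|]; [exact: subspace0 | exact: subN.2 |].
apply: presented_ind => [[h|i|i] v|v|k x y Nx Ny v Nv|x y Nx Ny v Nv].
- exact: Nh.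
- exact: Ne.
- exact: Nf.
- by rewrite act0l => _; apply: subspace0.
- by rewrite act_linearl; apply: subN.2; [apply: Nx|apply: Ny].
- by rewrite act_lie; apply: subspaceB => //; [apply/Nx/Ny|apply/Ny/Nx].
Qed.

Definition fword (V : lieModType g) s (v : V) : V :=
  foldr (fun i w => act (bkm_f K i) w) v s.

Lemma fword_cat (V : lieModType g) s t (v : V) :
  fword (s ++ t) v = fword s (fword t v).
Proof. exact: foldr_cat. Qed.

Lemma fword_linear (V : lieModType g) s : linear (@fword V s).
Proof. by elim: s => [|i s IH] k v w //=; rewrite IH act_linearr. Qed.

Lemma fword_tequiv (V : lieModType g) (v : V) s t :
  tequiv (@dep n) s t -> fword s v = fword t v.
Proof.
apply: (@tequiv_eq _ _ (@dep_refl n) (@dep_sym n) _ (fun s => fword s v)) => u i j w ij.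
rewrite !fword_cat /= act_swap lie_ff // act0l addr0 //.
Qed.

Lemma fword_hom (V W : lieModType g) (pi : V -> W) s v :
  is_module_hom pi -> pi (fword s v) = fword s (pi v).
Proof. by case=> _ homp; elim: s => //= i s IH; rewrite homp IH. Qed.

Lemma weight_act (V : lieModType g) mu i (v : V) : weight_space mu v ->
  weight_space (mu - simple_root K i) (act (bkm_f K i) v) /\
  weight_space (mu + simple_root K i) (act (bkm_e K i) v).
Proof.
move=> wv; split=> h; rewrite act_swap wv actZr ?lie_hf ?lie_he actZl.
  by rewrite wpairBl scalerBl scaleNr.
by rewrite wpairDl scalerDl.
Qed.

Lemma fword_weight (V : lieModType g) mu s (v : V) : weight_space mu v ->
  weight_space (mu - root_of K (content s)) (fword s v).
Proof.
move=> wv; elim: s => [|i s IH] /=; first by rewrite content_nil root_of0 subr0.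
have := (weight_act i IH).1; congr (weight_space _ _).
by rewrite content_cons root_ofD root_of1; zmod.
Qed.

Definition word_span (V : lieModType g) (v : V) (P : pred (seq 'I_n)) : set V :=
  fun u => exists l : seq (K * seq 'I_n),
    all (fun p => P p.2) l /\ u = \sum_(p <- l) p.1 *: fword p.2 v.

Lemma word_span_subspace (V : lieModType g) (v : V) P : subspace (word_span v P).
Proof.
split; first by exists [::]; rewrite big_nil.
move=> k _ _ [l [Pl ->]] [l' [Pl' ->]].
exists ([seq (k * p.1, p.2) | p <- l] ++ l'); rewrite all_cat Pl' andbT; split.
  by rewrite all_map.
rewrite big_cat big_map scaler_sumr; congr (_ + _).
by apply: eq_bigr => p _; rewrite scalerA.
Qed.

Lemma word_span0 (V : lieModType g) (v : V) P : word_span v P 0.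
Proof. exact: (subspace0 (word_span_subspace v P)). Qed.

Lemma word_span_mem (V : lieModType g) (v : V) (P : pred (seq 'I_n)) s :
  P s -> word_span v P (fword s v).
Proof. by move=> Ps; exists [:: (1, s)]; rewrite big_seq1 scale1r /= Ps. Qed.

Lemma word_span_ind (V : lieModType g) (v : V) (P : pred (seq 'I_n)) (N : set V) :
  subspace N -> (forall s, P s -> N (fword s v)) -> forall u, word_span v P u -> N u.
Proof.
move=> subN NP u [l [Pl ->]]; apply: subspace_sum => // p pl _.
by apply: subspaceZ => //; apply: NP; move/allP: Pl; apply.
Qed.

Lemma word_span_sub (V : lieModType g) (v : V) (P Q : pred (seq 'I_n)) u :
  (forall s, P s -> Q s) -> word_span v P u -> word_span v Q u.
Proof.
move=> PQ; apply: word_span_ind; first exact: word_span_subspace.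
by move=> s /PQ; apply: word_span_mem.
Qed.

Definition highest_weight_vector (V : lieModType g) lam (v : V) : Prop :=
  weight_space lam v /\ forall i, act (bkm_e K i) v = 0.

Lemma act_e_fword (V : lieModType g) lam (v : V) i s : highest_weight_vector lam v ->
  word_span v (fun t => content s == (U_(i) + content t)%MM) (act (bkm_e K i) (fword s v)).
Proof.
move=> [wv ev]; elim: s => [|j s IH] /=.
  by rewrite ev; apply: word_span0.
rewrite act_swap lie_ef; apply: subspaceD; first exact: word_span_subspace.
  have: word_span v (fun t => content s == (U_(i) + content t)%MM)
    (act (bkm_e K i) (fword s v)) by [].
  apply: (@word_span_ind _ _ _ (fun u => word_span v _ (act (bkm_f K j) u))).
    split; first by rewrite act0r; apply: word_span0.
    by move=> k u w; rewrite act_linearr; apply: (word_span_subspace _ _).2.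
  move=> t /eqP st; apply: (@word_span_mem _ _ _ (j :: t)).
  by rewrite !content_cons st addmCA.
case: eqP => [->|_]; last by rewrite act0l; apply: word_span0.
rewrite (fword_weight s wv); apply: subspaceZ; first exact: word_span_subspace.
by apply: word_span_mem; rewrite content_cons.
Qed.

Lemma word_span_submodule (V : lieModType g) lam (v : V) : highest_weight_vector lam v ->
  is_submodule (word_span v predT).
Proof.
move=> hv; apply: submodule_gen; first exact: word_span_subspace.
- move=> h; apply: (@word_span_ind _ _ _ (fun u => word_span v _ (act _ u))).
    split; first by rewrite act0r; apply: word_span0.
    by move=> k u w; rewrite act_linearr; apply: (word_span_subspace _ _).2.
  move=> s _; rewrite (fword_weight s hv.1); apply: subspaceZ; first exact: word_span_subspace.
  exact: word_span_mem.
- move=> i; apply: (@word_span_ind _ _ _ (fun u => word_span v _ (act _ u))).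
    split; first by rewrite act0r; apply: word_span0.
    by move=> k u w; rewrite act_linearr; apply: (word_span_subspace _ _).2.
  by move=> s _; apply: word_span_sub (act_e_fword i s hv).
- move=> i; apply: (@word_span_ind _ _ _ (fun u => word_span v _ (act _ u))).
    split; first by rewrite act0r; apply: word_span0.
    by move=> k u w; rewrite act_linearr; apply: (word_span_subspace _ _).2.
  by move=> s _; apply: (@word_span_mem _ _ _ (i :: s)).
Qed.

Definition verma_vector lam : verma lam := quot_proj (verma_ideal lam) (env_one g).

Lemma verma_vector_hw lam : highest_weight_vector lam (verma_vector lam).
Proof.
have [linq homq] := quot_proj_hom (verma_ideal lam).
split=> [h|i]; rewrite /verma_vector -homq.
  apply/eqP; rewrite -subr_eq0 -(linZ linq) -(linB linq); apply/eqP/quot_proj0.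
  by apply: mem_span_submodule; right; exists h.
by apply/quot_proj0; apply: mem_span_submodule; left; exists i.
Qed.

Lemma verma_span lam (m : verma lam) : word_span (verma_vector lam) predT m.
Proof.
have [N0 Nlin Nact] := word_span_submodule (verma_vector_hw lam).
have [linq homq] := quot_proj_hom (verma_ideal lam).
elim/quot_ind: m; elim/env_class_ind; elim=> [||s IHs t IHt|k s IHs|x s IHs].
- exact: (@word_span_mem _ _ _ [::]).
- have -> : quot_proj (verma_ideal lam) (env_class UZero) = 0 by exact: (lin0 linq).
  exact: N0.
- by rewrite -env_addE (linD linq); apply: subspaceD; first exact: word_span_subspace.
- by rewrite -env_scaleE (linZ linq); apply: subspaceZ; first exact: word_span_subspace.
- by rewrite -env_actE homq; apply: Nact.
Qed.

(** Applied to delta functions this separates inequivalent words: it is the independence half of the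
    basis of M(lam), [verma_span] being the spanning half. *)
Lemma verma_pair_fword (W : lmodType K) lam s (phi : dual_module W lam) :
  verma_pair (fword s (verma_vector lam)) phi = phi (canon (@dep n) s).
Proof.
elim: s phi => [|i s IH] phi /=.
  by rewrite verma_pair_proj env_pair_repr canon_nil.
by rewrite verma_pair_act IH dual_fE opprK canon_cons.
Qed.
End HighestWeight.

(** * Weight decompositions *)

Lemma sum_ord_eq (V : nmodType) n k (F : nat -> V) :
  \sum_(j < n | k == j :> nat) F j = if (k < n)%N then F k else 0.
Proof.
case: ltnP => [kn|nk].
  by rewrite (big_pred1 (Ordinal kn)) // => j; rewrite -val_eqE eq_sym.
by rewrite big1 // => j /eqP kj; have := ltn_ord j; rewrite -kj ltnNge nk.
Qed.

Section WeightSpaces.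
Variables (K : numFieldType) (n : nat).
Implicit Types (i j : 'I_n) (s t : seq 'I_n) (lam mu nu : weight K n).

Lemma cartan_row (f : nat -> K) i :
  \sum_(j < n) cartan_mx K n i j * f j =
  - (f i *+ 2 + (if (i.+1 < n)%N then f i.+1 else 0) + (if (0 < i)%N then f i.-1 else 0)).
Proof.
have E j : cartan_mx K n i j * f j = (if i == j :> nat then - (f j *+ 2) else 0)
   + (if i.+1 == j then - f j else 0) + (if (0 < i)%N && (i.-1 == j) then - f j else 0).
  rewrite mxE /adjacent -val_eqE /= [j.+1 == _](_ : _ = (0 < i)%N && (i.-1 == j)); last by lia.
  case: (eqVneq (i : nat) j) => [ij|_]; case: (eqVneq i.+1 (j : nat)) => [ij'|_];
    case: (boolP ((0 < i)%N && (i.-1 == j))) => [c|_] /=; try (exfalso; lia);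
    by rewrite ?mulN1r ?mul0r ?mulNr ?mulr_natl ?addr0 ?add0r.
under eq_bigr => j _ do rewrite E.
rewrite !big_split /= -!big_mkcond /= !sumrN.
rewrite (sum_ord_eq n i (fun k => f k *+ 2)) ltn_ord (sum_ord_eq n i.+1 f).
case: (ltnP 0 i) => i0 /=; last by rewrite big_pred0 ?oppr0 // !opprD oppr0.
rewrite (sum_ord_eq n i.-1 f) (leq_ltn_trans (leq_pred i) (ltn_ord i)) !opprD //.
Qed.

(** Nondegeneracy of A(n): the rows give x_(k+1) = - 2 x_k - x_(k-1), with solution x_k = (-1)^k
    (k+1) x_0, and x_n = 0 forces x_0 = 0 in characteristic 0. *)
Lemma cartan_kernel (x : nat -> K) : (forall k, (n <= k)%N -> x k = 0) ->
  (forall i, \sum_(j < n) cartan_mx K n i j * x j = 0) -> forall k, x k = 0.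
Proof.
move=> x_ge xrow.
have row k : (k < n)%N -> x k.+1 = - (x k *+ 2) - (if (0 < k)%N then x k.-1 else 0).
  move=> kn; have := xrow (Ordinal kn); rewrite cartan_row /=.
  have -> : (if (k.+1 < n)%N then x k.+1 else 0) = x k.+1.
    by case: ltnP => // /x_ge ->.
  move=> /eqP; rewrite oppr_eq0 addrAC addrC addr_eq0 => /eqP ->.
  by rewrite opprD.
have xE k : (k <= n)%N -> x k = (-1) ^+ k * k.+1%:R * x 0%N.
  elim/ltn_ind: k => -[_ _|k IH kn]; first by rewrite expr0 !mul1r.
  rewrite row // IH ?(ltnW kn) //; case: k IH kn => [|k] IH kn /=.
    by rewrite subr0 expr0 expr1 !mul1r mulN1r mulNr mulr_natl.
  rewrite (IH k); [|lia|lia].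
  by rewrite !exprS; ring.
have x0 : x 0%N = 0.
  have := x_ge n (leqnn n); rewrite xE // => /eqP; rewrite !mulf_eq0 signr_eq0.
  by rewrite pnatr_eq0 /= => /eqP.
by move=> k; case: (leqP k n) => [kn|/ltnW /x_ge //]; rewrite xE // x0 mulr0.
Qed.

Lemma root_ofE (b : 'X_{1..n}) i :
  root_of K b i 0 = \sum_(j < n) cartan_mx K n i j * (b j)%:R.
Proof.
rewrite /root_of summxE; apply: eq_bigr => j _.
by rewrite mulmxnE mxE mulr_natr.
Qed.

Lemma root_of_inj : injective (@root_of K n).
Proof.
move=> b c bc.
pose x k : K := if insub k is Some j then (b j)%:R - (c j)%:R else 0.
have xE (j : 'I_n) : x j = (b j)%:R - (c j)%:R by rewrite /x valK.
have x0 : forall k, x k = 0.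
  apply: cartan_kernel => [k nk|i]; first by rewrite /x insubF // ltnNge nk.
  under eq_bigr => j _ do rewrite xE mulrBr.
  by rewrite sumrB -!root_ofE bc subrr.
apply/mnmP=> j; have := x0 j; rewrite xE => /eqP; rewrite subr_eq0 eqr_nat.
by move/eqP.
Qed.

(** If some weight p0.1 of the list differs from mu, choose h separating the two: a(h) - p0.1(h)
    kills the summands of weight p0.1 and multiplies the mu part by a nonzero scalar, so the list
    shrinks. The operators [a] are arbitrary in order to cover both modules and the adjoint
    action. *)
Lemma weight_split (V : lmodType K) (a : cartan K n -> V -> V) (N : set V) l mu :
  (forall h, linear (a h)) -> subspace N -> (forall h v, N v -> N (a h v)) ->
  (forall p : weight K n * V, p \in l -> forall h, a h p.2 = wpair p.1 h *: p.2) ->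
  N (\sum_(p <- l) p.2) -> N (\sum_(p <- l | p.1 == mu) p.2).
Proof.
move=> lina subN stabN; have [m] := ubnP (size l); elim: m l => // m IH l lm wl Nl.
have [allmu|] := boolP (all (fun p => p.1 == mu) l).
  rewrite big_seq_cond (eq_bigl (fun p => p \in l)) -?big_seq // => p.
  by case: (boolP (p \in l)) => //= /(allP allmu) ->.
case/allPn => p0 p0l /eqP nmu.
have [h hneq] : exists h, wpair mu h != wpair p0.1 h.
  apply: contrapT => nex; apply/nmu/esym/wpair_inj => h.
  by apply/eqP/negPn/negP => hneq; apply: nex; exists h.
pose f (p : weight K n * V) := (p.1, (wpair p.1 h - wpair p0.1 h) *: p.2).
pose l' := [seq f p | p <- l & p.1 != p0.1].
have sumE (P : pred (weight K n)) : \sum_(p <- l' | P p.1) p.2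
   = \sum_(p <- l | P p.1) (wpair p.1 h - wpair p0.1 h) *: p.2.
  rewrite big_map big_filter_cond big_mkcond [RHS]big_mkcond; apply: eq_bigr => p _ /=.
  by case: (eqVneq p.1 p0.1) => [->|_] //=; rewrite subrr scale0r if_same.
have /IH {}IH : (size l' < m)%N.
  rewrite ltnS in lm; apply: leq_trans lm; rewrite size_map size_filter -[X in (_ < X)%N](count_predC (fun p => p.1 != p0.1)).
  rewrite -[X in (X < _)%N]addn0 ltn_add2l -has_count; apply/hasP; exists p0 => //=.
  by rewrite negbK.
have Nl' : N (\sum_(p <- l') p.2).
  rewrite (sumE predT); under eq_bigr => p _ do rewrite scalerBl.
  rewrite sumrB -scaler_sumr; apply: subspaceB => //; last exact: subspaceZ.
  by rewrite big_seq; under eq_bigr => p /wl <- do []; rewrite -big_seq -lin_sum //; apply: stabN.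
have wl' p : p \in l' -> forall h, a h p.2 = wpair p.1 h *: p.2.
  case/mapP => q + -> h' /=; rewrite mem_filter => /andP[_ ql].
  by rewrite linZ // wl // !scalerA mulrC.
have := IH wl' Nl'; rewrite (sumE (pred1 mu)).
have -> : \sum_(p <- l | pred1 mu p.1) (wpair p.1 h - wpair p0.1 h) *: p.2 =
  (wpair mu h - wpair p0.1 h) *: \sum_(p <- l | p.1 == mu) p.2.
  by rewrite scaler_sumr; apply: eq_bigr => p /eqP ->.
by apply: subspaceZI; rewrite ?subr_eq0.
Qed.

Section HighestWeightModule.
Variables (V : lieModType (bkm K n)) (lam : weight K n) (v : V).
Hypothesis hv : highest_weight_vector lam v.

Lemma word_span_weight_split (N : set V) P u mu : is_submodule N ->
  word_span v P u -> N u ->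
  exists2 w, word_span v (fun s => P s && (lam - root_of K (content s) == mu)) w /\ N w
    & word_span v (fun s => P s && (lam - root_of K (content s) != mu)) (u - w).
Proof.
move=> subN [l [/allP Pl uE]] Nu.
pose wt s := lam - root_of K (content s).
have sub := submodule_subspace subN; have [_ _ actN] := subN.
exists (\sum_(p <- l | wt p.2 == mu) p.1 *: fword p.2 v); last first.
  rewrite uE (bigID (fun p => wt p.2 == mu)) /= addrC addrK.
  apply: subspace_sum; first exact: word_span_subspace.
  move=> p pl wp; apply: subspaceZ; first exact: word_span_subspace.
  by apply: word_span_mem; rewrite Pl.
split.
  apply: subspace_sum; first exact: word_span_subspace.
  move=> p pl wp; apply: subspaceZ; first exact: word_span_subspace.
  by apply: word_span_mem; rewrite Pl.
have := @weight_split V (fun h w => act (bkm_h h) w) N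
  [seq (wt p.2, p.1 *: fword p.2 v) | p <- l] mu.
rewrite !big_map; apply => //.
- by move=> h; apply: act_linearr.
- by move=> h w; apply: actN.
- move=> _ /mapP[p _ ->] h /=.
  by rewrite actZr (fword_weight p.2 hv.1) !scalerA mulrC.
by rewrite -uE.
Qed.

Lemma word_span_weight P (u : V) mu : weight_space mu u -> word_span v P u ->
  word_span v (fun s => P s && (lam - root_of K (content s) == mu)) u.
Proof.
move=> wu [l [/allP Pl uE]].
pose wt s := lam - root_of K (content s).
have sub0 : subspace (fun w : V => w = 0).
  by split=> // k w w' -> ->; rewrite scaler0 addr0.
(* With - u in front of the expansion of u the total is 0, hence so is the part of weight mu: u is
   the part of weight mu of its expansion. *)
have := @weight_split V (fun h w => act (bkm_h h) w) (fun w => w = 0)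
  ((mu, - u) :: [seq (wt p.2, p.1 *: fword p.2 v) | p <- l]) mu.
rewrite !big_cons !big_map /= eqxx -uE addNr => H.
have /eqP : - u + \sum_(p <- l | wt p.2 == mu) p.1 *: fword p.2 v = 0.
  apply: H => //.
  - by move=> h; apply: act_linearr.
  - by move=> h w ->; rewrite act0r.
  - move=> q; rewrite inE => /orP[/eqP -> h /=|/mapP[p _ ->] h /=].
      by rewrite (linN (act_linearr _)) wu scalerN.
    by rewrite actZr (fword_weight p.2 hv.1) !scalerA mulrC.
rewrite addrC subr_eq0 => /eqP <-.
apply: subspace_sum; first exact: word_span_subspace.
move=> p pl wp; apply: subspaceZ; first exact: word_span_subspace.
by apply: word_span_mem; rewrite Pl.
Qed.

Hypothesis span_v : forall u, word_span v predT u.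

Lemma weight_content (u : V) X : weight_space (lam - root_of K X) u ->
  word_span v (fun s => content s == X) u.
Proof.
move=> wu; apply: word_span_sub (word_span_weight wu (span_v u)) => s /= /eqP.
by move/addrI/oppr_inj/root_of_inj ->.
Qed.

Lemma weight_exists (u : V) mu : weight_space mu u -> u != 0 ->
  exists X, mu = lam - root_of K X.
Proof.
move=> wu /eqP u0; apply: contrapT => nex; apply: u0.
have := word_span_weight wu (span_v u); apply: (@word_span_ind _ _ V _ _ (fun w : V => w = 0)).
  by split=> // k w w' -> ->; rewrite scaler0 addr0.
by move=> s /= /eqP E; case: nex; exists (content s).
Qed.

Lemma weight_top (u : V) : weight_space lam u -> exists k, u = k *: v.
Proof.
move=> wu; have wu' : weight_space (lam - root_of K (0%MM : 'X_{1..n})) u.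
  by rewrite root_of0 subr0.
have := weight_content wu'; apply: (@word_span_ind _ _ V _ _ (fun w : V => exists k, w = k *: v)).
  split; first by exists 0; rewrite scale0r.
  by move=> k _ _ [a ->] [b ->]; exists (k * a + b); rewrite scalerDl scalerA.
move=> s /eqP /(congr1 (@mdeg n)); rewrite mdeg_content mdeg0 => /size0nil ->.
by exists 1; rewrite scale1r.
Qed.
End HighestWeightModule.

Lemma highest_weight_moduleP (V : lieModType (bkm K n)) lam (pi : verma lam -> V) :
  is_module_hom pi -> (forall u, exists m, pi m = u) ->
  highest_weight_vector lam (pi (verma_vector lam)) /\ forall u, word_span (pi (verma_vector lam)) predT u.
Proof.
move=> [linpi homp] surj; have [wv ev] := verma_vector_hw lam; split.
  by split=> [h|i]; rewrite -homp ?ev ?lin0 // wv linZ.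
move=> u; have [m <-] := surj u; have [l [_ ->]] := verma_span m.
rewrite lin_sum //; apply: subspace_sum; first exact: word_span_subspace.
move=> p _ _; rewrite linZ // fword_hom //; apply: subspaceZ; first exact: word_span_subspace.
exact: word_span_mem.
Qed.
End WeightSpaces.

(** * A recursive Casimir operator *)

Section QuadraticForm.
Variables (K : numFieldType) (n : nat).
Implicit Types (i j : 'I_n) (b c : 'X_{1..n}).

Definition nbr b i : nat := \sum_(j < n | adjacent i j) b j.
(** For the form with Gram matrix A(n), this is half of 2(rho|b) - (b|b), and [qform b = mdeg b] is
    the quadratic equation of (a). Written with natural numbers, it is visibly monotone in b. *)
Definition qform b : nat :=
  \sum_(i < n) b i * (b i).-1 + \sum_(i < n) \sum_(j < n | i.+1 == j) b i * b j.

Lemma nbrE b i : nbr b i = (\sum_(j < n | i.+1 == j) b j + \sum_(j < n | j.+1 == i) b j)%N.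
Proof.
rewrite /nbr /adjacent (bigID (fun j : 'I_n => i.+1 == j)) /=; congr (_ + _)%N.
  by apply: eq_bigl => j; lia.
by apply: eq_bigl => j; lia.
Qed.

Lemma qform_cons i b : qform (U_(i) + b)%MM = (qform b + 2 * b i + nbr b i)%N.
Proof.
have diag : (\sum_(j < n) (U_(i) + b)%MM j * ((U_(i) + b)%MM j).-1 =
    \sum_(j < n) b j * (b j).-1 + 2 * b i)%N.
  rewrite (bigD1 i) //= [in RHS](bigD1 i) //= mnmDE mnm1E eqxx add1n /=.
  have -> : (\sum_(j < n | j != i) (U_(i) + b)%MM j * ((U_(i) + b)%MM j).-1 =
     \sum_(j < n | j != i) b j * (b j).-1)%N.
    by apply: eq_bigr => j ji; rewrite mnmDE mnm1E eq_sym (negPf ji).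
  by move: (bigop _ _ _) (b i) => S [|m] /=; nia.
have cross : (\sum_(j < n) \sum_(k < n | j.+1 == k) (U_(i) + b)%MM j * (U_(i) + b)%MM k =
    \sum_(j < n) \sum_(k < n | j.+1 == k) b j * b k + nbr b i)%N.
  have E j (k : 'I_n) : j.+1 == k -> ((U_(i) + b)%MM j * (U_(i) + b)%MM k =
      b j * b k + ((if i == j then b k else 0) + (if i == k then b j else 0)))%N.
    move=> jk; rewrite !mnmDE !mnm1E.
    case: (eqVneq i j) => [ij|_]; case: (eqVneq i k) => [ik|_]; rewrite /=; try lia.
    by move: jk; rewrite -ij ik; lia.
  under eq_bigr => j _.
    rewrite (eq_bigr _ (fun k jk => E j k jk)) big_split /= [X in (_ + X)%N]big_split /=.
    over.
  rewrite big_split /= [X in (_ + X)%N]big_split /= nbrE; congr (_ + (_ + _))%N.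
    rewrite (bigD1 i) //= eqxx [X in (_ + X)%N]big1 ?addn0 // => j.
    by rewrite eq_sym => /negPf ->; rewrite big1.
  rewrite [RHS]big_mkcond; apply: eq_bigr => j _.
  rewrite big_mkcond (bigD1 i) //= eqxx [X in (_ + X)%N]big1 ?addn0 // => k.
  by rewrite eq_sym => /negPf ->; rewrite if_same.
by rewrite /qform diag cross; lia.
Qed.

Lemma qform0 : qform 0%MM = 0%N.
Proof. by rewrite /qform !big1 // => i _; rewrite ?big1 // => *; rewrite mnm0E. Qed.

Lemma qform1 i : qform U_(i)%MM = 0%N.
Proof.
rewrite -[U_(i)%MM]addm0 qform_cons qform0 mnm0E /nbr big1 // => j _.
by rewrite mnm0E.
Qed.

Lemma qform_le b c : (forall i, b i <= c i)%N -> (qform b <= qform c)%N.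
Proof.
move=> bc; apply: leq_add; apply: leq_sum => i _.
  by apply: leq_mul => //; move: (bc i); lia.
by apply: leq_sum => j _; apply: leq_mul.
Qed.

Lemma qform_eq0_dep i j : qform (U_(i) + U_(j))%MM = 0%N -> ~~ dep i j.
Proof.
rewrite qform_cons qform1 mnm1E add0n => /eqP; rewrite addn_eq0 => /andP[].
rewrite muln_eq0 /= eqb0 => ji; rewrite /nbr => nb0.
rewrite /dep negb_or eq_sym ji /=; apply: contraTN nb0 => ij.
by rewrite (bigD1 j) //= mnm1E eqxx.
Qed.

Lemma wpair_root_of b i :
  wpair (root_of K b) (coroot K i) = - (2 * b i + nbr b i)%:R.
Proof.
have Aii : cartan_mx K n i i = - 2%:R by rewrite mxE eqxx.
rewrite /wpair /coroot -rowE mxE root_ofE (bigD1 i) //= Aii [in RHS]natrD [in RHS]natrM [RHS]opprD mulNr.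
congr (_ + _); rewrite /nbr [in RHS]big_mkcond [in RHS](bigD1 i) //= adjacent_irr add0n natr_sum -sumrN.
apply: eq_bigr => j /negPf ji; rewrite mxE eq_sym ji.
by case: adjacent; rewrite ?mulN1r ?mul0r ?oppr0.
Qed.
End QuadraticForm.

Section Casimir.
Variables (K : numFieldType) (n : nat) (J : pred 'I_n).
Local Notation g := (bkm K n).
Local Notation triple := ('X_{1..n} * g * g)%type.
Implicit Types (i j : 'I_n) (b c : 'X_{1..n}) (p q : triple) (k l : nat).

(** Inverse of (b|b) - 2(rho|b). Where [qform b] is 0 the inverse is 0 by convention, which agrees
    with the vanishing of the brackets in [casimir_lie_zero]. *)
Definition casimir_scale b : K := (- (2 * qform b)%:R)^-1.

Definition casimir_comb p q : triple :=
  ((p.1.1 + q.1.1)%MM, casimir_scale (p.1.1 + q.1.1)%MM *: lie p.1.2 q.1.2, lie p.2 q.2).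

(** The recursion passes from the height k to l and k - l; [fuel] makes it structural, and any fuel
    at least k gives the same list. *)
Fixpoint casimir_rec (fuel k : nat) : seq triple :=
  if fuel is fuel'.+1 then
    if k == 1%N then [seq (U_(i)%MM, bkm_f K i, bkm_e K i) | i <- enum J]
    else flatten [seq [seq casimir_comb p q | p <- casimir_rec fuel' l,
                                              q <- casimir_rec fuel' (k - l)]
                 | l <- index_iota 1 k]
  else [::].

(* The component of height k of a Casimir tensor, as a list of triples      *)
(* (b, x, y) with x and y of weights - root_of b and root_of b. It replaces *)
(* dual bases for an invariant form, whose nondegeneracy is never needed.   *)
Definition casimir_tensor k := casimir_rec k k.
Local Notation T := casimir_tensor.

Lemma casimir_rec_fuel f f' k : (k <= f)%N -> (k <= f')%N ->
  casimir_rec f k = casimir_rec f' k.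
Proof.
case: k => [|k]; first by case: f; case: f'.
elim: f f' k => [|f IH] [|f'] k //= kf kf'.
case: eqP => // k1; congr flatten; apply/eq_in_map => l; rewrite mem_index_iota => lk.
case: l lk => [|l] lk; first by lia.
have -> : (k.+1 - l.+1 = (k - l.+1).+1)%N by lia.
rewrite (IH f' l) ?(IH f' (k - l.+1)%N) //; lia.
Qed.

Lemma casimir1 : T 1 = [seq (U_(i)%MM, bkm_f K i, bkm_e K i) | i <- enum J].
Proof. by []. Qed.

Lemma casimirE k : (1 < k)%N -> T k =
  flatten [seq [seq casimir_comb p q | p <- T l, q <- T (k - l)] | l <- index_iota 1 k].
Proof.
case: k => [|[|k]] // _.
have -> : T k.+2 = flatten [seq [seq casimir_comb p q | p <- casimir_rec k.+1 l,
    q <- casimir_rec k.+1 (k.+2 - l)] | l <- index_iota 1 k.+2] by [].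
congr flatten; apply/eq_in_map => l; rewrite mem_index_iota => /andP[l0 lk].
have lk' : (k.+2 - l <= k.+1)%N by lia.
rewrite /casimir_tensor (@casimir_rec_fuel _ l l) //.
by rewrite (@casimir_rec_fuel _ (k.+2 - l) (k.+2 - l)).
Qed.

Lemma casimir_ind (P : nat -> triple -> Prop) :
  (forall i, J i -> P 1%N (U_(i)%MM, bkm_f K i, bkm_e K i)) ->
  (forall k l p q, (0 < k)%N -> (0 < l)%N -> p \in T k -> q \in T l ->
     P k p -> P l q -> P (k + l)%N (casimir_comb p q)) ->
  forall k p, (0 < k)%N -> p \in T k -> P k p.
Proof.
move=> P1 PS; elim/ltn_ind => -[|[|k]] IH p // _.
  by rewrite casimir1 => /mapP[i + ->]; rewrite mem_enum; apply: P1.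
rewrite casimirE // => /flatten_mapP[l]; rewrite mem_index_iota => /andP[l0 lk].
case/allpairsP => -[p1 p2] /= [p1T p2T ->].
rewrite -[k.+2](subnKC (ltnW lk)); apply: PS => //; first by rewrite subn_gt0.
  exact: IH.
by apply: IH => //; lia.
Qed.

Lemma casimir_weight k p : (0 < k)%N -> p \in T k ->
  forall h, lie (bkm_h h) p.2 = wpair (root_of K p.1.1) h *: p.2.
Proof.
move: k p; apply: casimir_ind => [i _ h|k l p q _ _ _ _ IHp IHq h] /=.
  by rewrite root_of1 lie_he.
by rewrite lie_derivation IHp IHq lieZl lieZr -scalerDl root_ofD wpairDl.
Qed.

Lemma casimir_zero k p : (1 < k)%N -> p \in T k -> qform p.1.1 = 0%N -> p.1.2 = 0.
Proof.
move=> k1; rewrite casimirE // => /flatten_mapP[l _ /allpairsP[-[p1 p2] /= [_ _ ->]]] /= q0.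
by rewrite /casimir_scale q0 muln0 oppr0 invr0 scale0r.
Qed.

(** By monotonicity [qform] vanishes on both weights. A component of height above 1 is then 0 by the
    convention on inverses, and two simple roots with this property are distinct and non-adjacent,
    so their f commute. *)
Lemma casimir_lie_zero k l p q : (0 < k)%N -> (0 < l)%N -> p \in T k -> q \in T l ->
  qform (p.1.1 + q.1.1)%MM = 0%N -> lie p.1.2 q.1.2 = 0.
Proof.
move=> k0 l0 pT qT pq0.
have qle b c : (qform b <= qform (b + c)%MM)%N.
  by apply: qform_le => i; rewrite mnmDE leq_addr.
have p0 : qform p.1.1 = 0%N by apply/eqP; rewrite -leqn0 -pq0.
have q0 : qform q.1.1 = 0%N by apply/eqP; rewrite -leqn0 -pq0 addmC.
case: (ltnP 1 k) => [k1|k1]; first by rewrite (casimir_zero k1 pT) // lie0l.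
case: (ltnP 1 l) => [l1|l1]; first by rewrite (casimir_zero l1 qT) // lie0r.
have kE : k = 1%N by lia.
have lE : l = 1%N by lia.
move: pT qT pq0; rewrite kE lE casimir1 => /mapP[i _ ->] /mapP[j _ ->] /=.
by move/qform_eq0_dep; apply: lie_ff.
Qed.

Lemma casimir_lie_f_zero k p i : (0 < k)%N -> p \in T k ->
  qform (U_(i) + p.1.1)%MM = 0%N -> lie (bkm_f K i) p.1.2 = 0.
Proof.
move=> k0 pT pq0.
have p0 : qform p.1.1 = 0%N.
  by apply/eqP; rewrite -leqn0 -pq0; apply: qform_le => j; rewrite mnmDE leq_addl.
case: (ltnP 1 k) => [k1|k1]; first by rewrite (casimir_zero k1 pT) // lie0r.
have kE : k = 1%N by lia.
move: pT pq0; rewrite kE casimir1 => /mapP[j _ ->] /= /qform_eq0_dep; exact: lie_ff.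
Qed.

Section Bilinear.
Variable W : lmodType K.

(** Evaluation on bilinear maps takes the place of tensor products. The weight is a separate
    argument so that factors such as [casimir_scale] can be absorbed into the map. *)
Definition bilinear_family (B : 'X_{1..n} -> g -> g -> W) :=
  forall b, (forall y, linear (fun x => B b x y)) /\ (forall x, linear (B b x)).

Definition casimir_sum k (F : triple -> W) := \sum_(p <- T k) F p.

Definition casimir_sum2 k (F : triple -> triple -> W) :=
  \sum_(1 <= l < k) casimir_sum l (fun p => casimir_sum (k - l) (F p)).

Lemma casimir_sumE k F : (1 < k)%N ->
  casimir_sum k F = casimir_sum2 k (fun p q => F (casimir_comb p q)).
Proof.
move=> k1; rewrite /casimir_sum2 /casimir_sum casimirE // big_flatten big_map.
by apply: eq_bigr => l _; rewrite big_allpairs_dep.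
Qed.

Lemma casimir_sum2C k F : casimir_sum2 k F = casimir_sum2 k (fun p q => F q p).
Proof.
rewrite /casimir_sum2 big_nat_rev big_nat [RHS]big_nat; apply: eq_bigr => l /andP[l1 lk].
have E1 : (1 + k - l.+1 = k - l)%N by lia.
have E2 : (k - (k - l) = l)%N by lia.
by rewrite E1 E2 /casimir_sum exchange_big.
Qed.

(** The recursion read backwards. Where its scalar cannot be inverted the brackets vanish, and in
    height 1 both sides are 0. *)
Lemma casimir_sum2_scale k G : (0 < k)%N -> bilinear_family G ->
  casimir_sum2 k (fun p q => G (p.1.1 + q.1.1)%MM (lie p.1.2 q.1.2) (lie p.2 q.2)) =
  casimir_sum k (fun p => - (2 * qform p.1.1)%:R *: G p.1.1 p.1.2 p.2).
Proof.
move=> k0 Gbil; case: (ltnP 1 k) => [k1|k1]; last first.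
  have -> : k = 1%N by lia.
  rewrite /casimir_sum2 big_geq // /casimir_sum casimir1 big_map big1 // => i _ /=.
  by rewrite qform1 muln0 oppr0 scale0r.
rewrite casimir_sumE // /casimir_sum2 big_nat [RHS]big_nat; apply: eq_bigr => l /andP[l1 lk].
rewrite /casimir_sum big_seq [RHS]big_seq; apply: eq_bigr => p pT.
rewrite big_seq [RHS]big_seq; apply: eq_bigr => q qT /=.
rewrite (linZ ((Gbil _).1 _)) scalerA.
have [q0|q0] := eqVneq (qform (p.1.1 + q.1.1)%MM) 0%N.
  rewrite (casimir_lie_zero _ _ pT qT q0) ?subn_gt0 //.
  by rewrite (lin0 ((Gbil _).1 _)) scaler0.
by rewrite mulfV ?scale1r // oppr_eq0 pnatr_eq0 muln_eq0.
Qed.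

(** Invariance of the tensor under ad f_i, height by height: ad f_i on the second factors in height
    k cancels ad f_i on the first factors in height k - 1. The derivation rule reduces it to smaller
    heights, up to the coroot arising from [f_i, e_i]. *)
Lemma casimir_f k i B : (1 < k)%N -> J i -> bilinear_family B ->
  casimir_sum k (fun p => B p.1.1 p.1.2 (lie (bkm_f K i) p.2)) =
  - casimir_sum k.-1 (fun p => B (U_(i) + p.1.1)%MM (lie (bkm_f K i) p.1.2) p.2).
Proof.
elim/ltn_ind: k B => k IH B k1 Ji Bbil.
pose s := casimir_scale; pose f := bkm_f K i.
(* By symmetry, both terms of the derivation ad f contribute the same sum. *)
pose F p q := B (p.1.1 + q.1.1)%MM (s (p.1.1 + q.1.1)%MM *: lie p.1.2 q.1.2)
  (lie (lie f p.2) q.2).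
pose G b x y := B (U_(i) + b)%MM (s (U_(i) + b)%MM *: lie f x) y.
have Gbil : bilinear_family G.
  move=> b; split=> [y a x x'|x a y y']; last by rewrite /G (Bbil _).2.
  by rewrite /G lie_linearr scalerDr scalerA mulrC -scalerA (Bbil _).1.
have two : casimir_sum k (fun p => B p.1.1 p.1.2 (lie f p.2)) = casimir_sum2 k F *+ 2.
  rewrite mulr2n [X in _ + X]casimir_sum2C casimir_sumE // /casimir_sum2 -big_split.
  apply: eq_bigr => l _; rewrite /casimir_sum -big_split; apply: eq_bigr => p _.
  rewrite -big_split; apply: eq_bigr => q _ /=.
  rewrite lie_derivation (linD ((Bbil _).2 _)); congr (_ + _).
  rewrite /F addmC [lie q.1.2 _]lieC [lie (lie f q.2) _]lieC scalerN.
  by rewrite (linN ((Bbil _).1 _)) (linN ((Bbil _).2 _)) opprK.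
(* The summand with p of height one produces the coroot of i, whose bracket with q gives the weight
   of q as a factor; the other summands are covered by induction. *)
have FE : casimir_sum2 k F =
  - casimir_sum k.-1 (fun p => wpair (root_of K p.1.1) (coroot K i) *: G p.1.1 p.1.2 p.2)
  - casimir_sum2 k.-1 (fun p q => B (U_(i) + p.1.1 + q.1.1)%MM
      (s (U_(i) + p.1.1 + q.1.1)%MM *: lie (lie f p.1.2) q.1.2) (lie p.2 q.2)).
  have Hbil (q : triple) : bilinear_family (fun b x y =>
      B (b + q.1.1)%MM (s (b + q.1.1)%MM *: lie x q.1.2) (lie y q.2)).
    move=> b; split=> [y a x x'|x a y y'].
      by rewrite lie_linearl scalerDr scalerA mulrC -scalerA (Bbil _).1.
    by rewrite lie_linearl (Bbil _).2.
  rewrite /casimir_sum2 big_ltn //; congr (_ + _).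
    rewrite /casimir_sum exchange_big /= subn1 -sumrN big_seq [RHS]big_seq.
    apply: eq_bigr => q qT; rewrite casimir1 big_map big_enum /= (bigD1 i) //=.
    rewrite big1 ?addr0 => [|j /andP[_ /negPf ji]]; last first.
      by rewrite /F /= [lie f _]lieC lie_ef ji oppr0 lie0l (lin0 ((Bbil _).2 _)).
    rewrite /F /= [lie f _]lieC lie_ef eqxx lieNl (linN ((Bbil _).2 _)).
    by rewrite (casimir_weight _ qT) ?(linZ ((Bbil _).2 _)) // -subn1 subn_gt0.
  rewrite -sumrN (_ : k = k.-1.+1); last by lia.
  rewrite big_add1 /= big_nat [RHS]big_nat; apply: eq_bigr => l /andP[l1 lk].
  rewrite /casimir_sum exchange_big /= [in RHS]exchange_big /= -sumrN.
  rewrite subSS; apply: eq_bigr => q _.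
  have := IH l.+1 _ _ _ Ji (Hbil q); rewrite /casimir_sum /= => -> //; last by lia.
(* The two terms of ad f_i on a bracket of first factors contribute equally, so twice the sum is ad
   f_i of the whole bracket, where the recursion can be undone in height k - 1. *)
have sym : casimir_sum2 k.-1 (fun p q => B (U_(i) + p.1.1 + q.1.1)%MM
      (s (U_(i) + p.1.1 + q.1.1)%MM *: lie (lie f p.1.2) q.1.2) (lie p.2 q.2)) *+ 2
   = casimir_sum k.-1 (fun p => - (2 * qform p.1.1)%:R *: G p.1.1 p.1.2 p.2).
  rewrite -casimir_sum2_scale //; last by lia.
  rewrite mulr2n [X in _ + X]casimir_sum2C /casimir_sum2 -big_split.
  apply: eq_bigr => l _; rewrite /casimir_sum -big_split; apply: eq_bigr => p _.
  rewrite -big_split; apply: eq_bigr => q _ /=.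
  rewrite /G lie_derivation scalerDr (linD ((Bbil _).1 _)) !addmA; congr (_ + _).
  rewrite -!addmA (addmC q.1.1) [lie (lie f q.1.2) _]lieC [lie q.2 _]lieC scalerN.
  by rewrite (linN ((Bbil _).1 _)) (linN ((Bbil _).2 _)) opprK.
rewrite two FE mulrnDl !mulNrn sym -opprD; congr (- _).
rewrite /casimir_sum -sumrMnl -big_split big_seq [RHS]big_seq.
apply: eq_bigr => p pT /=; rewrite wpair_root_of scalerMnl -scalerDl.
(* This identity is what determines [casimir_scale]: the weight contribution is exactly the
   increment of [qform] from b to b + alpha_i. *)
have -> : - (2 * p.1.1 i + nbr p.1.1 i)%:R *+ 2 - (2 * qform p.1.1)%:R =
    - (2 * qform (U_(i) + p.1.1)%MM)%:R :> K.
  by rewrite qform_cons mulNrn -opprD -mulrnA -natrD; congr (- _%:R); lia.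
rewrite -/f /G -(linZ ((Bbil _).1 _)) scalerA.
have [q0|q0] := eqVneq (qform (U_(i) + p.1.1)%MM) 0%N.
  have k0 : (0 < k.-1)%N by lia.
  by rewrite (casimir_lie_f_zero k0 pT q0) scaler0.
by rewrite mulfV ?scale1r // oppr_eq0 pnatr_eq0 muln_eq0.
Qed.
End Bilinear.
End Casimir.

Section CasimirOperator.
Variables (K : numFieldType) (n : nat) (J : pred 'I_n).
Local Notation g := (bkm K n).
Local Notation T := (casimir_tensor K J).
Variables (V : lieModType g) (lam : weight K n) (v : V).
Hypothesis hv : highest_weight_vector lam v.
Implicit Types (i j : 'I_n) (u : V) (s t : seq 'I_n).

(** A truncation at height N: on the span of words of length at most N the omitted terms would act
    by 0. *)
Definition casimir N u : V :=
  \sum_(1 <= k < N.+1) \sum_(p <- T k) act p.1.2 (act p.2 u).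

Lemma casimir_linear N : linear (casimir N).
Proof.
move=> a u w; rewrite /casimir scaler_sumr -big_split; apply: eq_bigr => k _.
rewrite scaler_sumr -big_split; apply: eq_bigr => p _.
by rewrite !act_linearr.
Qed.

Lemma casimir_kill k p u : (0 < k)%N -> p \in T k ->
  (forall i, act (bkm_e K i) u = 0) -> act p.2 u = 0.
Proof.
move: k p; apply: casimir_ind => [i _ eu|k l p q _ _ _ _ IHp IHq eu] /=; first exact: eu.
by rewrite act_lie IHp // IHq // !act0r subrr.
Qed.

(** The cases are separate because the truncated difference m - k would place short words in the
    span of the empty word instead of sending them to 0. *)
Definition lowers k (x : g) := forall m u,
  word_span v (fun s => size s == m) u ->
  if (k <= m)%N then word_span v (fun s => size s == (m - k)%N) (act x u)
  else act x u = 0.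

Lemma lowers_comp k l x y m u : lowers k x -> lowers l y ->
  word_span v (fun s => size s == m) u ->
  if (k + l <= m)%N then word_span v (fun s => size s == (m - (k + l))%N) (act x (act y u))
  else act x (act y u) = 0.
Proof.
move=> xk yl /yl; case: (leqP l m) => lm => [/xk|->]; last first.
  by rewrite act0r leqNgt (leq_trans lm) // leq_addl.
by rewrite leq_subRL // addnC [(k + l)%N]addnC subnDA.
Qed.

Lemma casimir_low k p : (0 < k)%N -> p \in T k -> lowers k p.2.
Proof.
move: k p; apply: casimir_ind => [i _ m u|k l p q _ _ _ _ IHp IHq m u] /=.
  have [m0|m0] := posnP m.
    have sub0 : subspace (fun u => act (bkm_e K i) u = 0).
      by split=> [|k w w' w0 w0']; rewrite ?act0r // act_linearr w0 w0' scaler0 addr0.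
    rewrite m0 /=; apply: (word_span_ind sub0) => s /eqP /size0nil ->.
    exact: hv.2.
  apply: (@word_span_ind _ _ V _ _ (fun u => word_span v _ (act (bkm_e K i) u))).
    split=> [|k w w' w0 w0']; first by rewrite act0r; apply: word_span0.
    by rewrite act_linearr; apply: (word_span_subspace _ _).2.
  move=> s /eqP sm; apply: word_span_sub (act_e_fword i s hv) => t /eqP.
  by move/(congr1 (@mdeg n)); rewrite mdegD mdeg1 !mdeg_content sm => ->; rewrite add1n subn1.
move=> um; rewrite act_lie.
have := lowers_comp IHp IHq um; have := lowers_comp IHq IHp um.
rewrite addnC; case: ifP => _ ; first by move=> A B; apply: subspaceB A => //; apply: word_span_subspace.
by move=> -> ->; rewrite subrr.
Qed.

(** Consecutive heights cancel by [casimir_f], so the sum telescopes: what remains is the coroot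
    term of height one and a boundary term in height N. *)
Lemma casimir_act_f N i u : (0 < N)%N -> J i ->
  casimir N (act (bkm_f K i) u) = act (bkm_f K i) (casimir N u)
   + act (bkm_f K i) (act (bkm_h (coroot K i)) u)
   - \sum_(p <- T N) act (lie (bkm_f K i) p.1.2) (act p.2 u).
Proof.
move=> N0 Ji; set f := bkm_f K i.
pose B (b : 'X_{1..n}) (x y : g) := act x (act y u).
have Bbil : bilinear_family B.
  by move=> b; split=> [y|x] a z z'; rewrite /B act_linearl // act_linearr.
have step k : \sum_(p <- T k) act p.1.2 (act p.2 (act f u)) =
    act f (\sum_(p <- T k) act p.1.2 (act p.2 u))
    - \sum_(p <- T k) act (lie f p.1.2) (act p.2 u)
    - casimir_sum J k (fun p => B p.1.1 p.1.2 (lie f p.2)).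
  rewrite (lin_sum (act_linearr f)) /casimir_sum -!sumrB; apply: eq_bigr => p _.
  by rewrite /B !act_lie actBr; zmod.
elim: N N0 => // -[_ _|N IH _].
  rewrite /casimir !big_nat1 step.
  have -> : casimir_sum J 1 (fun p => B p.1.1 p.1.2 (lie f p.2)) =
      - act f (act (bkm_h (coroot K i)) u).
    rewrite /casimir_sum casimir1 big_map big_enum /= (bigD1 i) //= big1 ?addr0.
      by rewrite /B lieC lie_ef eqxx (linN (act_linearl _)) (linN (act_linearr _)).
    move=> j /andP[_ /negPf ji].
    by rewrite /B lieC lie_ef ji oppr0 act0l act0r.
  by rewrite opprK addrAC.
have casS w : casimir N.+2 w = casimir N.+1 w + \sum_(p <- T N.+2) act p.1.2 (act p.2 w).
  by rewrite /casimir (big_nat_recr N.+2).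
rewrite !casS IH // step (casimir_f _ Ji Bbil) // actDr.
set S := casimir_sum _ _ _.
have -> : S = \sum_(p <- T N.+1) act (lie f p.1.2) (act p.2 u) by [].
by zmod.
Qed.

Lemma casimir_commute N i u : (forall j, J j -> i != j /\ ~~ dep i j) ->
  casimir N (act (bkm_f K i) u) = act (bkm_f K i) (casimir N u).
Proof.
move=> iJ; rewrite /casimir (lin_sum (act_linearr _)) big_nat [RHS]big_nat.
apply: eq_bigr => k /andP[k0 _].
rewrite (lin_sum (act_linearr _)) big_seq [RHS]big_seq; apply: eq_bigr => p pT.
have [fx fy] : lie (bkm_f K i) p.1.2 = 0 /\ lie (bkm_f K i) p.2 = 0.
  move: k p k0 pT; apply: casimir_ind => [j /iJ[ij dij]|k l p q _ _ _ _ [px py] [qx qy]] /=.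
    by rewrite lie_ff // lieC lie_ef eq_sym (negPf ij) oppr0.
  split; first by rewrite lieZr lie_derivation px qx lie0l lie0r addr0 scaler0.
  by rewrite lie_derivation py qy lie0l lie0r addr0.
rewrite [in RHS]act_swap fx act0l addr0 [act (bkm_f K i) (act p.2 u)]act_swap fy.
by rewrite act0l addr0.
Qed.

End CasimirOperator.

(** * Casimir eigenvalues and maximal vectors *)

Section MaximalVectors.
Variables (K : numFieldType) (n : nat) (V : lieModType (bkm K n)) (v : V).
Hypothesis hv : highest_weight_vector (weyl K n) v.
Implicit Types (i j : 'I_n) (u : V) (s t : seq 'I_n).

(** A letter i of J put in front adds the value of its coroot on the weight of the remaining word,
    -1 + 2 b_i + nbr b i, which is the increment of [qform] minus that of the length. Letters
    outside J commute with the operator. *)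
Lemma casimir_eigenvalue (J : pred 'I_n) N s : (size s < N)%N ->
  (forall i j, i \in s -> ~~ J i -> J j -> ~~ dep i j) ->
  casimir J N (fword s v) =
  ((qform (content (filter J s)))%:R - (size (filter J s))%:R) *: fword s v.
Proof.
elim: s => [|i s IH] sN sJ /=.
  rewrite content_nil qform0 subrr scale0r /casimir big_nat big1 // => k /andP[k0 _].
  rewrite big_seq big1 // => p pT; rewrite (casimir_kill k0 pT) ?act0r //.
  exact: hv.2.
have si k : k \in s -> k \in i :: s by move=> ks; rewrite inE ks orbT.
have {}IH := IH (ltnW sN) (fun a b sa => sJ a b (si a sa)).
have [Ji|nJi] := boolP (J i); last first.
  rewrite casimir_commute ?IH ?actZr // => j Jj; have := sJ i j (mem_head _ _) nJi Jj.
  by move=> dij; split=> //; apply: contraNneq dij => ->; apply: dep_refl.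
rewrite casimir_act_f //; last by apply: leq_trans sN.
(* The boundary term vanishes: an element of height N kills words of length below N. *)
rewrite [X in _ - X]big_seq [X in _ - X]big1 ?subr0 => [|p pT]; last first.
  have N0 : (0 < N)%N by apply: leq_trans sN.
  have := casimir_low hv N0 pT (word_span_mem v (eqxx (size s))).
  by rewrite leqNgt (ltnW sN) /= => ->; rewrite act0r.
rewrite IH (fword_weight s hv.1) !actZr -scalerDl; congr (_ *: _).
rewrite wpairBl wpair_root_of /= content_cons qform_cons !natrD -natr1.
have -> : wpair (weyl K n) (coroot K i) = -1.
  by rewrite /wpair /coroot -rowE !mxE.
have -> : content (filter J s) i = content s i.
  by rewrite !mnmE count_filter; apply: eq_count => j /=; case: eqP => // ->.
have -> : nbr (content (filter J s)) i = nbr (content s) i.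
  rewrite /nbr; apply: eq_bigr => j ij; rewrite !mnmE count_filter.
  apply: eq_in_count => k ks /=; case: eqP => //= kj.
  apply: contraT => nJk.
  have := sJ k i (si k ks) nJk Ji.
  by rewrite kj dep_sym /dep ij orbT.
by ring.
Qed.

Hypothesis span_v : forall u, word_span v predT u.

(** The second factors of the tensor kill a maximal vector, so the eigenvalue attached to its weight
    is 0. *)
Lemma maximal_qform (J : pred 'I_n) X u :
  u != 0 -> weight_space (weyl K n - root_of K X) u ->
  (forall i, act (bkm_e K i) u = 0) ->
  (forall i j, X i != 0%N -> ~~ J i -> J j -> ~~ dep i j) ->
  let Y := [multinom if J i then X i else 0%N | i < n] in qform Y = mdeg Y.
Proof.
move=> u0 wu eu XJ Y; have uX := weight_content hv span_v wu.
have YE s : content s = X -> content (filter J s) = Y.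
  move=> sX; apply/mnmP=> i; rewrite /Y !mnmE -sX mnmE count_filter; case: ifP => Ji.
    by apply: eq_count => j /=; case: eqP => // ->.
  by rewrite -[RHS](@count_pred0 _ s); apply: eq_count => j /=; case: eqP => // ->.
pose N := (mdeg X).+1.
have casE : casimir J N u = ((qform Y)%:R - (mdeg Y)%:R) *: u.
  apply: (@word_span_ind _ _ V _ _ (fun u => casimir J N u = _ *: u)) uX.
    split=> [|k w w' w0 w0']; first by rewrite (lin0 (casimir_linear _ _)) scaler0.
    by rewrite casimir_linear w0 w0' scalerDr !scalerA mulrC.
  move=> s /eqP sX; rewrite casimir_eigenvalue ?(YE s sX) -?mdeg_content ?(YE s sX) //.
    by rewrite /N -sX.
  move=> i j si; apply: XJ; rewrite -sX mnmE -lt0n -has_count has_pred1 //.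
have : casimir J N u = 0.
  rewrite /casimir big_nat big1 // => k /andP[k0 _]; rewrite big_seq big1 // => p pT.
  by rewrite (casimir_kill k0 pT) ?act0r.
rewrite casE => /eqP; rewrite scaler_eq0 (negPf u0) orbF subr_eq0 eqr_nat.
by move/eqP.
Qed.
End MaximalVectors.

(** * Weights of maximal vectors *)

Section Arithmetic.
Implicit Types (x : nat -> nat) (a m k : nat).
Local Open Scope nat_scope.

Fixpoint run_form x a m : nat :=
  x a * (x a).-1 + if m is m'.+1 then x a * x a.+1 + run_form x a.+1 m' else 0.
Fixpoint run_sum x a m : nat := x a + if m is m'.+1 then run_sum x a.+1 m' else 0.

(** On a run of positive entries the form is at least the sum minus 1, and equality of form and sum
    leaves only a single entry 2. The first entry is recorded in the deficient case because the
    induction, which extends the run to the left, needs it. *)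
Lemma run_trichotomy x a m : (forall k, a <= k <= a + m -> 0 < x k) ->
  [\/ x a = 1 /\ run_form x a m + 1 = run_sum x a m,
      [/\ m = 0, x a = 2 & run_form x a m = run_sum x a m]
    | run_sum x a m < run_form x a m].
Proof.
elim: m a => [|m IH] a xpos; have xa : 0 < x a by apply: xpos; lia.
  rewrite /=; case: (x a) xa => [|[|[|y]]] // _.
  - by constructor 1.
  - by constructor 2.
  - by constructor 3; nia.
have xb : 0 < x a.+1 by apply: xpos; lia.
have /IH : forall k, a.+1 <= k <= a.+1 + m -> 0 < x k by move=> k ak; apply: xpos; lia.
rewrite /=; move: (run_form _ _ _) (run_sum _ _ _) (x a) (x a.+1) xa xb => F S y z y0 z0.
case=> [[-> <-]|[m0 -> ->]|SF].
- by case: y y0 => [|[|y]] // _; [constructor 1|constructor 3]; nia.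
- by constructor 3; nia.
- by constructor 3; nia.
Qed.

Lemma run_formE x a m : x (a + m).+1 = 0 ->
  \sum_(a <= k < (a + m).+1) (x k * (x k).-1 + x k * x k.+1) = run_form x a m.
Proof.
elim: m a => [|m IH] a x0; first by move: x0; rewrite addn0 big_nat1 => ->; rewrite muln0 /= !addn0.
by rewrite big_ltn ?ltnS ?leq_addr //= -addSnnS IH ?addSnnS // addnA.
Qed.

Lemma run_sumE x a m : \sum_(a <= k < (a + m).+1) x k = run_sum x a m.
Proof.
elim: m a => [|m IH] a; first by rewrite addn0 big_nat1 /= addn0.
by rewrite big_ltn ?ltnS ?leq_addr //= -addSnnS IH.
Qed.
End Arithmetic.

Section MaximalShape.
Variable n : nat.
Implicit Types (i j : 'I_n) (X : 'X_{1..n}).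
Local Open Scope nat_scope.

Lemma sum_interval (F : nat -> nat) a m : a + m < n ->
  (forall k, ~~ (a <= k <= a + m) -> F k = 0) ->
  \sum_(i < n) F i = \sum_(a <= k < (a + m).+1) F k.
Proof.
move=> amn F0; rewrite -(big_mkord xpredT F) (@big_cat_nat _ _ _ a) //=; last by lia.
rewrite [X in (X + _)%N]big_nat [X in (X + _)%N]big1 ?add0n => [|k kP]; last by apply: F0; lia.
rewrite (@big_cat_nat _ _ _ (a + m).+1) //=; last by lia.
by rewrite [X in (_ + X)%N]big_nat [X in (_ + X)%N]big1 ?addn0 // => k kP; apply: F0; lia.
Qed.

(** For J the maximal run of positive entries around a node of the support, the hypothesis says that
    form and sum agree on that run, which must then be a single entry 2. *)
Lemma isotropic_shape X :
  (forall J : pred 'I_n, (forall i j, X i != 0 -> ~~ J i -> J j -> ~~ dep i j) ->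
     let Y := [multinom if J i then X i else 0 | i < n] in qform Y = mdeg Y) ->
  independent (mnm_supp X) /\ forall i, X i = (if i \in mnm_supp X then 2 else 0).
Proof.
move=> qX; pose x k := if insub k is Some i then X i else 0.
have xE i : x i = X i by rewrite /x valK.
have x_ge k : n <= k -> x k = 0 by move=> nk; rewrite /x insubF // ltnNge nk.
have key i : X i != 0 -> [/\ X i = 2, x i.+1 = 0 & forall k, k.+1 = i -> x k = 0].
  move=> Xi.
  (* Right end of the run: [x] is extended by 0 from n on, so there is a first zero, at [i + m.+1]
     after the case analysis. *)
  have exr : exists m, x (i + m) == 0 by exists n; rewrite x_ge ?leq_addl.
  case: (ex_minnP exr) => -[|m] /eqP xm0 minm; first by rewrite addn0 xE in xm0; rewrite xm0 in Xi.
  have xr k : i <= k <= i + m -> 0 < x k.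
    move=> ik; rewrite lt0n; apply/negP => xk0.
    have := minm (k - i); rewrite subnKC ?xk0; last by lia.
    by move=> /(_ isT); lia.
  (* Left end of the run: the least [a] such that all entries from [a] to [i] are positive. *)
  pose Pl a := (a <= i) && [forall k : 'I_i.+1, (a <= k) ==> (0 < x k)].
  have exl : exists a, Pl a.
    exists i; rewrite /Pl leqnn /=; apply/forallP => k; apply/implyP => ik.
    by have -> : k = i :> nat; [have := ltn_ord k; lia | apply: xr; lia].
  case: (ex_minnP exl) => a /andP[ai /forallP xl] mina.
  have xla k : a <= k <= i -> 0 < x k.
    move=> aki; have ki : k < i.+1 by lia.
    by have /implyP := xl (Ordinal ki); apply; rewrite /=; lia.
  have xa k : k.+1 = a -> x k = 0.
    move=> ka; apply/eqP; rewrite -leqn0 leqNgt; apply/negP => xk.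
    have : Pl k.
      rewrite /Pl; apply/andP; split; first by lia.
      apply/forallP => l; apply/implyP => kl; have [->//|] := eqVneq (l : nat) k.
      by move=> lk; apply: xla; have := ltn_ord l; lia.
    by move/mina; lia.
  have imn : i + m < n.
    by rewrite ltnNge; apply/negP => /x_ge xim; have := xr (i + m); rewrite xim; lia.
  pose J : pred 'I_n := fun j => a <= j <= i + m.
  have XJ j k : X j != 0 -> ~~ J j -> J k -> ~~ dep j k.
    rewrite -xE => xj; rewrite /J => nJj Jk; apply/negP; rewrite /dep /adjacent.
    case/orP=> [/eqP jk|]; first by rewrite jk Jk in nJj.
    case/orP=> /eqP jk.
      by have := xa j; move: xj; case: eqP => // xj0 _ H; apply: xj0; apply: H; lia.
    have jE : j = (i + m.+1) :> nat by lia.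
    by rewrite jE xm0 in xj.
  pose y k := if a <= k <= i + m then x k else 0.
  have mE : i + m = a + (i + m - a) by lia.
  have := qX J XJ; set Y := [multinom _ | _ < _] => qY.
  have yE j : Y j = y j by rewrite /Y mnmE /y -xE.
  have y_out k : ~~ (a <= k <= a + (i + m - a)) -> y k = 0.
    by rewrite -mE /y => /negPf ->.
  have yn : y n = 0 by rewrite y_out //; lia.
  have : run_form y a (i + m - a) = run_sum y a (i + m - a).
    rewrite -run_formE; last by rewrite y_out //; lia.
    have amn : a + (i + m - a) < n by rewrite -mE.
    rewrite -run_sumE -(@sum_interval (fun k => y k * (y k).-1 + y k * y k.+1)) // => [|k kP].
      rewrite -(@sum_interval y) //.
      rewrite big_split /=; transitivity (qform Y); last first.
        by rewrite qY mdegE; apply: eq_bigr => j _.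
      rewrite /qform; congr (_ + _); apply: eq_bigr => j _; first by rewrite yE.
      rewrite [RHS](eq_bigr (fun k : 'I_n => y j * y k)) => [|k _]; last by rewrite !yE.
      have := @sum_ord_eq nat n j.+1 (fun k => y j * y k) => /= ->.
      (* The last node has no right neighbour, in agreement with [y n] being 0. *)
      case: ltnP => // nj; have -> : j.+1 = n by have := ltn_ord j; lia.
      by rewrite yn muln0.
    by rewrite y_out.
  case: (@run_trichotomy y a (i + m - a)) => [k|[_ <-]|[m0 ya _ _]|]; last by lia.
  - by rewrite -mE => akm; rewrite /y akm; case: (leqP k i) => ki; [apply: xla|apply: xr]; lia.
  - by lia.
  have [ia m0'] : a = i /\ m = 0 by lia.
  split; first by rewrite -xE -ya -ia /y leqnn /=; case: ifP => //; lia.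
    by rewrite -xm0 m0' addn1.
  by rewrite -ia.
split.
  apply/forall_inP => i; rewrite inE => Xi; apply/forall_inP => j; rewrite inE => Xj.
  apply/negP => /orP[/eqP ij|/eqP ji].
    by have [_ + _] := key i Xi; rewrite ij xE => /eqP; rewrite (negPf Xj).
  by have [_ + _] := key j Xj; rewrite ji xE => /eqP; rewrite (negPf Xi).
by move=> i; rewrite inE; case: eqP => //= /eqP /key[].
Qed.
End MaximalShape.

(** * Submodules of the Verma module *)

Section Squares.
Variable n : nat.
Implicit Types (i j : 'I_n) (s t l : seq 'I_n) (H I : {set 'I_n}).

Definition doubled l : seq 'I_n := flatten [seq [:: h; h] | h <- l].
Definition square_word H : seq 'I_n := doubled (enum H).
Definition indep_word s := forall i j, i \in s -> j \in s -> ~~ adjacent i j.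

Lemma count_doubled l i : count_mem i (doubled l) = (count_mem i l * 2)%N.
Proof. by elim: l => //= j l ->; case: eqP => _; lia. Qed.

Lemma mem_doubled l i : (i \in doubled l) = (i \in l).
Proof.
by rewrite -!has_pred1 !has_count count_doubled muln_gt0 andbT.
Qed.

Lemma content_square H i : content (square_word H) i = (if i \in H then 2 else 0)%N.
Proof.
rewrite mnmE count_doubled count_uniq_mem ?enum_uniq // mem_enum.
by case: ifP.
Qed.

Lemma mem_square H i : (i \in square_word H) = (i \in H).
Proof. by rewrite mem_doubled mem_enum. Qed.

Lemma independentP H : reflect (forall i j, i \in H -> j \in H -> ~~ adjacent i j)
  (independent H).
Proof.
apply: (iffP forall_inP) => [Hi i j iH jH|Hi i iH].
  by move/forall_inP: (Hi i iH); apply.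
by apply/forall_inP => j jH; apply: Hi.
Qed.

Lemma indep_square H : independent H -> indep_word (square_word H).
Proof. by move=> /independentP Hi i j; rewrite !mem_square; apply: Hi. Qed.

(** A dependent pair meets an independent word in at most one letter, so its projections record only
    multiplicities. *)
Lemma perm_tequiv s t : indep_word s -> perm_eq s t -> tequiv (@dep n) s t.
Proof.
move=> si st i j ij.
have red a u : filter (pred1 a) u = nseq (count_mem a u) a.
  elim: u => //= b u ->; case: eqP => [->|_] //.
have one a b u : b \notin u -> filter (pred2 a b) u = filter (pred1 a) u.
  move=> bu; apply: eq_in_filter => c cu /=; case: (c == a) => //=.
  by apply/negbTE; apply: contraNneq bu => <-.
have eq1 a : filter (pred1 a) s = filter (pred1 a) t.
  by rewrite !red (permP st).
have pC a b u : filter (pred2 a b) u = filter (pred2 b a) u.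
  by apply: eq_filter => c /=; rewrite orbC.
have [js|js] := boolP (j \in s); last first.
  by rewrite !one // -?(perm_mem st).
have [is_|is_] := boolP (i \in s); last first.
  by rewrite ![filter (pred2 i j) _]pC !one // -?(perm_mem st).
case/orP: ij => [/eqP ->|]; last by rewrite (negPf (si i j is_ js)).
have dd u : filter (pred2 j j) u = filter (pred1 j) u.
  by apply: eq_filter => c /=; rewrite orbb.
by rewrite !dd.
Qed.

Lemma square_word_split H I : H \subset I ->
  perm_eq (square_word I) (square_word (I :\: H) ++ square_word H).
Proof.
move=> HI; apply: perm_content; apply/mnmP => i.
rewrite content_cat mnmDE !content_square finset.in_setD.
by case: (boolP (i \in H)) => [/(fintype.subsetP HI) ->|_]; case: (i \in I).
Qed.
End Squares.

Section MaximalSquares.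
Variables (K : numFieldType) (n : nat).
Local Notation g := (bkm K n).
Implicit Types (i j : 'I_n) (s t : seq 'I_n) (H I : {set 'I_n}).

Lemma f_squaresE (V : lieModType g) H (v : V) : f_squares H v = fword (square_word H) v.
Proof. by rewrite /f_squares /square_word; elim: (enum H) => //= h l ->. Qed.

Lemma act_e_commute (V : lieModType g) i s (v : V) : i \notin s ->
  act (bkm_e K i) (fword s v) = fword s (act (bkm_e K i) v).
Proof.
elim: s => //= j s IH; rewrite inE negb_or => /andP[ij is_].
by rewrite act_swap lie_ef (negPf ij) act0l addr0 IH.
Qed.

Lemma root_of_square H :
  root_of K (content (square_word H)) = \sum_(i in H) (simple_root K i *+ 2).
Proof.
rewrite /root_of [RHS]big_mkcond; apply: eq_bigr => i _.
by rewrite content_square; case: ifP.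
Qed.

Variables (V : lieModType g) (v : V).
Hypothesis hv : highest_weight_vector (weyl K n) v.

(** The square of f_i can be moved next to v, and e_i f_i^2 v = (2 rho(h_i) - A_ii) f_i v = 0, since
    rho(h_i) = -1 and A_ii = -2. *)
Lemma square_hw I : independent I ->
  highest_weight_vector (weyl K n - root_of K (content (square_word I)))
    (fword (square_word I) v).
Proof.
move=> Ii; split=> [|i]; first exact/fword_weight/hv.1.
have [iI|iI] := boolP (i \in I); last first.
  by rewrite act_e_commute ?mem_square // hv.2 (lin0 (fword_linear _)).
have iI' : [set i] \subset I by rewrite finset.sub1set.
have := perm_tequiv (indep_square Ii) (square_word_split iI').
move/fword_tequiv => ->; rewrite fword_cat act_e_commute; last first.
  by rewrite mem_square finset.in_setD finset.in_set1 eqxx.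
rewrite /square_word enum_set1 /= [act (bkm_e K i) _]act_swap lie_ef eqxx.
rewrite [act (bkm_e K i) _]act_swap lie_ef eqxx hv.2 act0r add0r.
rewrite (weight_act i hv.1).1 hv.1 actZr -scalerDl.
rewrite wpairBl simple_root_coroot mxE eqxx.
have -> : wpair (weyl K n) (coroot K i) = -1 by rewrite /wpair /coroot -rowE !mxE.
have -> : -1 + (-1 - - 2%:R) = 0 :> K by ring.
by rewrite scale0r (lin0 (fword_linear _)).
Qed.

Hypothesis span_v : forall u, word_span v predT u.

(** All words of this content are permutations of [square_word I], hence equivalent to it. *)
Lemma square_weight_space I (u : V) : independent I ->
  weight_space (weyl K n - root_of K (content (square_word I))) u ->
  exists k, u = k *: fword (square_word I) v.
Proof.
move=> Ii wu; have := weight_content hv span_v wu.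
apply: (@word_span_ind _ _ V _ _ (fun u => exists k, u = k *: _)).
  split; first by exists 0; rewrite scale0r.
  by move=> k _ _ [a ->] [b ->]; exists (k * a + b); rewrite scalerDl scalerA.
move=> s /eqP /perm_content st; exists 1; rewrite scale1r.
apply/fword_tequiv/tequiv_sym/perm_tequiv; first exact: indep_square.
by rewrite perm_sym.
Qed.

Lemma maximal_square X (u : V) : u != 0 ->
  weight_space (weyl K n - root_of K X) u -> (forall i, act (bkm_e K i) u = 0) ->
  exists I, [/\ independent I, I = mnm_supp X, X = content (square_word I) &
    exists2 k, k != 0 & u = k *: fword (square_word I) v].
Proof.
move=> u0 wu eu.
have [Ii XE] := isotropic_shape (fun J => maximal_qform hv span_v u0 wu eu (J := J)).
have XE' : X = content (square_word (mnm_supp X)).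
  by apply/mnmP => i; rewrite XE content_square.
exists (mnm_supp X); split=> //; rewrite XE' in wu.
have [k uk] := square_weight_space Ii wu; exists k => //.
by apply: contraNneq u0 => k0; rewrite uk k0 scale0r.
Qed.
End MaximalSquares.

Section Submodules.
Variables (K : numFieldType) (n : nat).
Local Notation g := (bkm K n).
Local Notation rho := (weyl K n).
Local Notation M := (verma rho).
Local Notation v := (verma_vector rho).
Implicit Types (i j : 'I_n) (s t : seq 'I_n) (H I : {set 'I_n}) (Hs : {set {set 'I_n}}).

(** The generating set inside [higher_verma], restated so that [higher_verma lam Hs] is
    [quot_module (square_gen lam Hs)] by conversion. *)
Definition square_gen (lam : weight K n) Hs : set (verma lam) := fun m =>
  exists H : {set 'I_n}, exists w : verma lam,
    [/\ H \in Hs, weight_space lam w & m = f_squares H w].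

Arguments square_gen lam Hs _ : clear implicits.

Lemma square_gen_weight (lam : weight K n) Hs (m : verma lam) : square_gen lam Hs m <->
  exists H k, H \in Hs /\ m = k *: fword (square_word H) (verma_vector lam).
Proof.
have hv := verma_vector_hw lam; split.
  move=> [H [w [HHs ww ->]]]; exists H.
  have [k ->] := weight_top hv (@verma_span _ _ _) ww; exists k; split=> //.
  by rewrite f_squaresE (linZ (fword_linear _)).
move=> [H [k [HHs ->]]]; exists H, (k *: verma_vector lam); split=> //.
  by move=> h; rewrite actZr hv.1 !scalerA mulrC.
by rewrite f_squaresE (linZ (fword_linear _)).
Qed.

Lemma square_in_span (lam : weight K n) Hs H : H \in Hs ->
  span_submodule (square_gen lam Hs) (fword (square_word H) (verma_vector lam)).
Proof.
move=> HHs; apply: mem_span_submodule; apply/square_gen_weight.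
by exists H, 1; rewrite scale1r.
Qed.

(* A vector of minimal height in N outside the submodule generated by the *)
(* squares is maximal modulo the latter, hence is itself a square.        *)
Lemma submodule_squares (N : set M) Hs : is_submodule N -> ~ N v ->
  (forall I, independent I -> I != finset.set0 -> N (fword (square_word I) v) -> I \in Hs) ->
  forall u, N u -> span_submodule (square_gen rho Hs) u.
Proof.
move=> subN Nv NHs.
have hv := verma_vector_hw rho.
set S := square_gen rho Hs; set pi : M -> quot_module S := quot_proj S.
have [hpi spi] := highest_weight_moduleP (quot_proj_hom S) (@quot_proj_surj _ _ _ S).
have [_ _ actN] := subN; have subsN := submodule_subspace subN.
have subS := submodule_subspace (span_is_submodule S).
have homo m X u : mdeg X = m -> N u -> weight_space (rho - root_of K X) u ->
    span_submodule S u.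
  elim/ltn_ind: m X u => m IH X u Xm Nu wu.
  apply/quot_proj0; apply: contrapT => /eqP piu0.
  have piu_w : weight_space (rho - root_of K X) (pi u).
    by move=> h; rewrite /pi -(quot_proj_hom S).2 wu (linZ (quot_proj_hom S).1).
  have piu_e i : act (bkm_e K i) (pi u) = 0.
    rewrite /pi -(quot_proj_hom S).2; apply/quot_proj0.
    (* If i does not occur in the words of content X, then e_i u = 0; otherwise e_i u is a vector of
       N of smaller height and the induction hypothesis applies. *)
    have [Xi|Xi] := eqVneq (X i) 0%N.
      suff -> : act (bkm_e K i) u = 0 by exact: (subspace0 subS).
      have := weight_content hv (@verma_span _ _ _) wu.
      apply: (@word_span_ind _ _ M _ _ (fun u => act (bkm_e K i) u = 0)).
        by split=> [|k w w' w0 w0']; rewrite ?act0r // act_linearr w0 w0' scaler0 addr0.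
      move=> s /eqP sX; rewrite act_e_commute ?hv.2 ?(lin0 (fword_linear _)) //.
      by rewrite -has_pred1 has_count -[count _ _](mnmE (fun j => count_mem j s) i) -/(content s) sX Xi.
    have XE : X = (U_(i) + (X - U_(i)))%MM.
      by apply/mnmP=> j; rewrite mnmDE mnmBE mnm1E; case: eqP => [<-|_]; lia.
    apply: (IH (mdeg (X - U_(i))%MM) _ (X - U_(i))%MM) => //; last 2 first.
    - exact: actN.
    - have := (weight_act i wu).2; rewrite {1}XE root_ofD root_of1.
      by congr (weight_space _ _); zmod.
    by rewrite -Xm [in X in (_ < X)%N]XE mdegD mdeg1.
  have [I [Ii _ XE [k k0 uE]]] := maximal_square hpi spi piu0 piu_w piu_e.
  (* The vector u is maximal only modulo the squares, but its weight space in M(rho) is already a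
     line: u itself is a multiple of the square vector, not merely its image. *)
  have wu' : weight_space (rho - root_of K (content (square_word I))) u by rewrite -XE.
  have [a ua] := square_weight_space hv (@verma_span _ _ _) Ii wu'.
  have a0 : a != 0.
    apply: contraNneq piu0 => a0; rewrite ua a0 scale0r /pi.
    by rewrite (lin0 (quot_proj_hom S).1).
  have NI : N (fword (square_word I) v) by apply: (subspaceZI subsN a0); rewrite -ua.
  have I0 : I != finset.set0.
    by apply/eqP => I0; apply: Nv; move: NI; rewrite I0 /square_word enum_set0.
  apply: (negP piu0); apply/eqP/quot_proj0.
  rewrite ua; apply: (subspaceZ subS); apply: square_in_span; exact: NHs.
(* A general element of N is handled through its weight components, which lie in N; one of them is
   split off at a time. *)
move=> u Nu; have [l [_ uE]] := verma_span u; rewrite {}uE in Nu *.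
pose wt s := rho - root_of K (content s).
have [m] := ubnP (size l); elim: m l Nu => // m IH [|p l] Nu lm.
  by rewrite big_nil; exact: (subspace0 subS).
pose mu := wt p.2; rewrite (bigID (fun q => wt q.2 == mu)) /=.
have Nmu : N (\sum_(q <- p :: l | wt q.2 == mu) q.1 *: fword q.2 v).
  have := @weight_split K n M (fun h w => act (bkm_h h) w) N
    [seq (wt q.2, q.1 *: fword q.2 v) | q <- p :: l] mu.
  rewrite !big_map; apply => //.
  - by move=> h; apply: act_linearr.
  - by move=> h w; apply: actN.
  - move=> _ /mapP[q _ ->] h /=.
    by rewrite actZr (fword_weight q.2 hv.1) !scalerA mulrC.
apply: (subspaceD subS).
  apply: (homo (mdeg (content p.2)) (content p.2)) => // h.
  rewrite (lin_sum (act_linearr _)) scaler_sumr; apply: eq_bigr => q /eqP wq.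
  by rewrite actZr (fword_weight q.2 hv.1) -/(wt q.2) wq !scalerA mulrC.
rewrite -big_filter; apply: IH.
  have := subspaceB subsN Nu Nmu; rewrite big_filter.
  by rewrite [X in N (X - _)](bigID (fun q => wt q.2 == mu)) /= addrAC subrr add0r.
rewrite ltnS in lm; apply: leq_trans lm; rewrite /= eqxx /= ltnS size_filter.
exact: count_size.
Qed.
End Submodules.
Arguments square_gen {K n} lam Hs _.

Section VermaWords.
Variables (K : numFieldType) (n : nat) (lam : weight K n).
Implicit Types (s t : seq 'I_n) (i : 'I_n).
Local Notation v := (verma_vector lam).

(** For canonical [t] this is the coordinate of m on f_t v. *)
Definition word_coef t (m : verma lam) : K :=
  @verma_pair K n lam (GRing.regular K) m (fun s => (s == t)%:R).

Lemma word_coef_linear t : linear_for *%R (word_coef t).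
Proof. exact: (@verma_pair_linearl K n lam (GRing.regular K)). Qed.

Lemma word_coef_fword t s : word_coef t (fword s v) = (canon (@dep n) s == t)%:R.
Proof. by rewrite /word_coef verma_pair_fword. Qed.

Lemma word_coef_sum t (l : seq (K * seq 'I_n)) :
  word_coef t (\sum_(p <- l) p.1 *: fword p.2 v) =
  \sum_(p <- l) p.1 * (canon (@dep n) p.2 == t)%:R.
Proof.
have linw := @verma_pair_linearl K n lam (GRing.regular K) (fun s => (s == t)%:R).
rewrite /word_coef (lin_sum linw); apply: eq_bigr => p _.
by rewrite (linZ linw) -/(word_coef t _) word_coef_fword.
Qed.

Lemma fword_neq0 s : fword s v != 0.
Proof.
apply/eqP => s0; have := word_coef_fword (canon (@dep n) s) s.
rewrite s0 eqxx => /eqP; rewrite eq_sym.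
have -> : word_coef (canon (@dep n) s) 0 = 0.
  exact: (lin0 (@verma_pair_linearl K n lam (GRing.regular K) _)).
by rewrite oner_eq0.
Qed.

Lemma top_not_lower : ~ word_span v (fun s => s != [::]) v.
Proof.
move=> [l [/allP Pl vE]]; have := word_coef_fword [::] [::]; rewrite canon_nil eqxx /= vE.
rewrite word_coef_sum big_seq big1 => [/eqP|p pl].
  by rewrite eq_sym oner_eq0.
rewrite -size_eq0 size_canon size_eq0 (negPf (Pl p pl)) mulr0 //.
Qed.

(** The component of weight lam of an element of N lies in N and is a multiple of v; it is 0 because
    v generates the whole module. *)
Lemma proper_submodule_lower (N : set (verma lam)) : proper_submodule N ->
  forall u, N u -> word_span v (fun s => s != [::]) u.
Proof.
move=> [subN [w Nw]] u Nu; have hv := verma_vector_hw lam.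
have subsN := submodule_subspace subN.
have Nv : ~ N v.
  move=> Nv; apply: Nw; have := verma_span w; apply: (word_span_ind subsN).
  by move=> s _; elim: s => //= i s IH; case: subN => _ _; apply.
have [u' [u'0 Nu']] := word_span_weight_split hv lam subN (verma_span u) Nu.
have : exists k, u' = k *: v.
  move: u'0; apply: (@word_span_ind _ _ (verma lam) _ _ (fun w => exists k, w = k *: v)).
    split; first by exists 0; rewrite scale0r.
    by move=> k _ _ [a ->] [b ->]; exists (k * a + b); rewrite scalerDl scalerA.
  move=> s /=; rewrite -subr_eq0 addrAC subrr add0r oppr_eq0 -(root_of0 K n).
  move=> /eqP /root_of_inj /(congr1 (@mdeg n)); rewrite mdeg_content mdeg0 => /size0nil ->.
  by exists 1; rewrite scale1r.
move=> [k u'E]; have k0 : k = 0.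
  by apply/eqP/negPn/negP => k0; apply/Nv/(subspaceZI subsN k0); rewrite -u'E.
rewrite u'E k0 scale0r subr0; apply: word_span_sub => s /=; apply: contraNneq => ->.
by rewrite content_nil root_of0 subr0.
Qed.
End VermaWords.

(** * Holes and the kernel of a highest weight quotient *)

Section Kernel.
Variables (K : numFieldType) (n : nat).
Local Notation g := (bkm K n).
Local Notation rho := (weyl K n).
Local Notation v := (verma_vector rho).
Implicit Types (i j : 'I_n) (s t : seq 'I_n) (H I : {set 'I_n}) (Hs : {set {set 'I_n}}).

(** For H' contained in an independent H, the word of H ends with that of H' up to commutations, so
    its vector is generated by the smaller square. *)
Lemma square_span_sub Hs Hs' :
  (forall H, H \in Hs -> independent H /\ exists2 H', H' \in Hs' & H' \subset H) ->
  forall u, span_submodule (square_gen rho Hs) u -> span_submodule (square_gen rho Hs') u.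
Proof.
move=> HsP; apply: span_subset; first exact: span_is_submodule.
move=> _ /square_gen_weight[H [k [HHs ->]]].
have [Hi [H' H'Hs H'H]] := HsP H HHs.
have subm := span_is_submodule (square_gen rho Hs').
apply: (subspaceZ (submodule_subspace subm)).
rewrite (fword_tequiv _ (perm_tequiv (indep_square Hi) (square_word_split H'H))) fword_cat.
have := @square_in_span K n rho _ _ H'Hs; elim: (square_word (H :\: H')) => //= i s IH /IH.
by case: subm => _ _; apply.
Qed.

Variables (V : lieModType g) (pi : verma rho -> V).
Hypotheses (hpi : is_module_hom pi) (spi : forall u, exists m, pi m = u).

Lemma hom_vector_neq0 : (exists u : V, u <> 0) -> pi v <> 0.
Proof.
move=> [u u0] v0; apply: u0; have := (highest_weight_moduleP hpi spi).2 u.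
apply: (@word_span_ind _ _ V _ _ (fun u => u = 0)).
  by split=> // k w w' -> ->; rewrite scaler0 addr0.
by move=> s _; rewrite v0 (lin0 (fword_linear s)).
Qed.

Lemma holesP H : H \in holes rho V <->
  [/\ H != finset.set0, independent H & pi (fword (square_word H) v) = 0].
Proof.
have [hv span_v] := highest_weight_moduleP hpi spi.
rewrite inE; split=> [/and3P[H0 Hi /asboolP HV]|[H0 Hi HV]].
  by split=> //; rewrite fword_hom // -f_squaresE; apply/HV/hv.1.
apply/and3P; split=> //; apply/asboolP => w ww.
have [k ->] := weight_top hv span_v ww.
by rewrite f_squaresE (linZ (fword_linear _)) -fword_hom // HV scaler0.
Qed.

Lemma kernel_holes : pi v <> 0 ->
  forall m, pi m = 0 <-> span_submodule (square_gen rho (holes rho V)) m.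
Proof.
move=> piv0 m.
have subK : is_submodule (fun m => pi m = 0).
  have [linpi homp] := hpi; split=> [|k u w u0 w0|x u u0]; first by rewrite lin0.
    by rewrite linpi u0 w0 scaler0 addr0.
  by rewrite homp u0 act0r.
split.
  move: m; apply: submodule_squares => // I Ii I0 pI; apply/holesP; split=> //.
move: m; apply: span_subset => // _ /square_gen_weight[H [k [/holesP[_ _ H0] ->]]].
by rewrite (linZ hpi.1) H0 scaler0.
Qed.

Lemma span_minimal_holes m :
  span_submodule (square_gen rho (holes rho V)) m <->
  span_submodule (square_gen rho (minimal_holes rho V)) m.
Proof.
split; apply: square_span_sub => H.
  move=> HV; have [_ Hi _] := (holesP H).1 HV; split=> //.
  have [H' minH' H'H] := minset_exists HV; exists H' => //.
  by rewrite inE.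
rewrite inE => /minsetp HV; have [_ Hi _] := (holesP H).1 HV; split=> //.
by exists H.
Qed.
End Kernel.

Section SimpleQuotient.
Variables (K : numFieldType) (n : nat).
Local Notation g := (bkm K n).
Local Notation rho := (weyl K n).
Local Notation v := (verma_vector rho).

Definition proper_sum (lam : weight K n) : set (verma lam) :=
  fun v => exists N, proper_submodule N /\ N v.

(** Each proper submodule avoids the top weight, and this property passes to sums; so the sum of all
    proper submodules is proper. *)
Lemma proper_sum_lower (lam : weight K n) u : span_submodule (@proper_sum lam) u ->
  word_span (verma_vector lam) (fun s => s != [::]) u.
Proof.
pose Q := fun u => exists l : seq (verma lam), (forall w, w \in l -> proper_sum w) /\
  u = \sum_(w <- l) w.
have subQ : is_submodule Q.
  split=> [|k _ _ [l [Pl ->]] [l' [Pl' ->]]|x _ [l [Pl ->]]].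
  - by exists [::]; rewrite big_nil.
  - exists ([seq k *: w | w <- l] ++ l'); rewrite big_cat big_map scaler_sumr; split=> // w.
    rewrite mem_cat => /orP[/mapP[w' /Pl[N [pN Nw]] ->]|/Pl' //]; exists N; split=> //.
    exact: (subspaceZ (submodule_subspace pN.1)).
  - exists [seq act x w | w <- l]; rewrite big_map (lin_sum (act_linearr x)); split=> // w.
    case/mapP => w' /Pl[N [pN Nw]] ->; exists N; split=> //.
    by case: (pN.1) => _ _; apply.
move/(_ Q subQ) => QP; have [l [Pl ->]] : Q u.
  apply: QP => w pw; exists [:: w]; rewrite big_seq1; split=> // w'.
  by rewrite inE => /eqP ->.
apply: subspace_sum; first exact: word_span_subspace.
by move=> w /Pl[N [pN Nw]] _; apply: (proper_submodule_lower pN).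
Qed.

Lemma simple_vector_neq0 : quot_proj (@proper_sum rho) v <> 0 :> verma_simple rho.
Proof. by move/quot_proj0/proper_sum_lower; apply: top_not_lower. Qed.

(** Being a highest weight vector below the top, f_i^2 v generates a proper submodule, so each
    singleton is a hole of the simple module; conversely a hole, being nonempty, contains a
    singleton. *)
Lemma singleton_holes m :
  span_submodule (square_gen rho (holes rho (verma_simple rho))) m <->
  span_submodule (square_gen rho (singletons n)) m.
Proof.
have hq := quot_proj_hom (@proper_sum rho).
have sq := @quot_proj_surj _ _ _ (@proper_sum rho).
split; apply: square_span_sub => H.
  move=> /(holesP hq sq)[/finset.set0Pn[i iH] Hi _]; split=> //.
  by exists [set i]%SET; rewrite ?finset.sub1set //; apply/imsetP; exists i.
case/imsetP => i _ ->; have Hi : independent [set i]%SET.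
  apply/independentP => a b; rewrite !finset.in_set1 => /eqP -> /eqP ->.
  by rewrite adjacent_irr.
split=> //; exists [set i]%SET => //; apply/(holesP hq sq); split=> //.
  by apply/finset.set0Pn; exists i; rewrite finset.in_set1.
apply/quot_proj0; apply: mem_span_submodule; rewrite /proper_sum.
have hv := verma_vector_hw rho; have hs := square_hw hv Hi.
exists (word_span (fword (square_word [set i]%SET) v) predT); split; last first.
  exact: (@word_span_mem _ _ _ _ _ [::]).
split; first exact: (word_span_submodule hs).
exists v => vi; apply: (@top_not_lower _ _ rho); move: vi.
apply: word_span_ind; first exact: word_span_subspace.
move=> s _; rewrite -fword_cat; apply: word_span_mem.
by rewrite /square_word enum_set1 /=; case: s.
Qed.
End SimpleQuotient.

Section MaximalWeights.
Variables (K : numFieldType) (n : nat).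
Local Notation rho := (weyl K n).
Local Notation v := (verma_vector rho).
Variables (V : lieModType (bkm K n)) (pi : verma rho -> V).
Hypotheses (hpi : is_module_hom pi) (spi : forall u, exists m, pi m = u).

Lemma maximal_form X : (exists u : V, weight_space (rho - root_of K X) u /\ maximal_vector u) ->
  independent (mnm_supp X) /\ exists I : {set 'I_n}, independent I /\
    forall i, X i = (if i \in I then 2 else 0)%N.
Proof.
have [hv span_v] := highest_weight_moduleP hpi spi.
move=> [u [wu [/eqP u0 _ eu]]].
have [I [Ii IE XE _]] := maximal_square hv span_v u0 wu eu.
rewrite -IE; split=> //; exists I; split=> // i.
by rewrite XE content_square.
Qed.

Lemma form_maximal (X : 'X_{1..n}) (I : {set 'I_n}) : independent I ->
  (forall i, X i = (if i \in I then 2 else 0)%N) ->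
  (exists u : V, weight_space (rho - root_of K X) u /\ u <> 0) ->
  exists u : V, weight_space (rho - root_of K X) u /\ maximal_vector u.
Proof.
have [hv span_v] := highest_weight_moduleP hpi spi.
move=> Ii XI [u [wu u0]]; have XE : X = content (square_word I).
  by apply/mnmP => i; rewrite XI content_square.
rewrite XE in wu *; have [k uE] := square_weight_space hv span_v Ii wu.
exists u; split=> //; split=> //; first by exists (rho - root_of K (content (square_word I))).
by move=> i; rewrite uE actZr (square_hw hv Ii).2 scaler0.
Qed.
End MaximalWeights.

(** The second left side is twice the first; [E] proves this by induction, with n = m + 1. *)
Lemma isotropicE n (X : 'X_{1..n}) : (1 <= n)%N -> isotropic_eq X <-> isotropic_eq' X.
Proof.
have E (x : nat -> int) m : (x 0%N - 1) ^+ 2 + \sum_(0 <= k < m) (x k + x k.+1 - 1) ^+ 2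
    + (x m - 1) ^+ 2 - m.+2%:Z =
  (\sum_(0 <= k < m.+1) x k ^+ 2 - 2%:Z * \sum_(0 <= k < m.+1) x k
    + \sum_(0 <= k < m) x k * x k.+1) * 2%:Z.
  elim: m => [|m IH]; first by rewrite !big_nat1 !big_geq //; ring.
  have rec (F : nat -> int) k : \sum_(0 <= i < k.+1) F i = \sum_(0 <= i < k) F i + F k.
    by rewrite big_nat_recr.
  rewrite (rec (fun k => x k ^+ 2)) (rec x m.+1) (rec (fun k => x k * x k.+1)).
  rewrite (rec (fun k => (x k + x k.+1 - 1) ^+ 2)).
  move: IH; rewrite (intS m.+2).
  move: (\sum_(0 <= i < m) _) (\sum_(0 <= i < m.+1) _ ^+ 2) (\sum_(0 <= i < m.+1) x i)
    (\sum_(0 <= i < m) _) (x m) (x m.+1) (x 0%N) (m.+2%:Z) => A B C D y z w k IH.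
  by rewrite !expr2 in IH *; lia.
case: n X => // n X _; rewrite /isotropic_eq /isotropic_eq' /=.
rewrite (E (fun k => (nth 0%N X k)%:Z)).
by split=> [->|/eqP]; rewrite ?mul0r // mulf_eq0 orbF => /eqP.
Qed.

(** * Characters of quotients by squares *)

Lemma list_basis (K : fieldType) (W : lmodType K) (S : set W) (T : eqType) (r : seq T)
    (f : T -> W) : uniq r -> (forall t, t \in r -> S (f t)) ->
  (forall c : T -> K, \sum_(t <- r) c t *: f t = 0 -> forall t, t \in r -> c t = 0) ->
  (forall w, S w -> exists c : T -> K, w = \sum_(t <- r) c t *: f t) ->
  is_basis S (fun i : 'I_(size r) => f (tnth (in_tuple r) i)).
Proof.
move=> Ur Sr free gen; split=> [i|c c0 i|w /gen[c ->]].
- by apply: Sr; apply: mem_tnth.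
- pose c' t := \sum_(j | tnth (in_tuple r) j == t) c j.
  have c'E j : c' (tnth (in_tuple r) j) = c j.
    rewrite /c' (big_pred1 j) // => k; apply/eqP/eqP => [|-> //].
    by move/tuple_uniqP: (Ur : uniq (in_tuple r)); apply.
  rewrite -c'E; apply: free; last exact: mem_tnth.
  rewrite (big_tnth _ _ r); rewrite -[RHS]c0; apply: eq_bigr => j _.
  by rewrite c'E.
- by exists (fun i => c (tnth (in_tuple r) i)); rewrite (big_tnth _ _ r).
Qed.

Lemma list_dim (K : fieldType) (W : lmodType K) (S : set W) (T : eqType) (r : seq T)
    (f : T -> W) : uniq r -> (forall t, t \in r -> S (f t)) ->
  (forall c : T -> K, \sum_(t <- r) c t *: f t = 0 -> forall t, t \in r -> c t = 0) ->
  (forall w, S w -> exists c : T -> K, w = \sum_(t <- r) c t *: f t) ->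
  subspace_dim S = size r.
Proof. by move=> Ur Sr free gen; apply: subspace_dimE; apply: (list_basis Ur Sr free gen). Qed.

Lemma char_iso (K : fieldType) n (V W : lieModType (bkm K n)) :
  module_iso V W -> char V =1 char W.
Proof.
move=> [phi [[linphi homphi] [psi phiK psiK]]] mu; rewrite /char; congr (Posz _).
apply: (subspace_dim_iso linphi phiK psiK) => v; split=> wv h.
  by rewrite -homphi wv (linZ linphi).
by apply: (can_inj phiK); rewrite homphi wv (linZ linphi).
Qed.

Lemma count_int (T : Type) (P : pred T) (r : seq T) :
  (count P r)%:Z = \sum_(x <- r) (P x)%:R.
Proof. by elim: r => [|x r IH]; rewrite ?big_nil ?big_cons //= PoszD IH -natz. Qed.

(** Expansion of the product of the factors -1 + 1 over E and 0 + 1 outside E. *)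
Lemma sum_signs (T : finType) (E : {set T}) :
  \sum_(S : {set T} | S \subset E) (-1) ^+ #|S| = (E == finset.set0)%:R :> int.
Proof.
have := @bigA_distr int 0 1 _ _ T (fun i => if i \in E then -1 else 0) (fun=> 1) => /= EE.
transitivity (\prod_(i : T) ((if i \in E then -1 else 0) + 1) : int); last first.
  have [->|/finset.set0Pn[i iE]] := eqVneq E finset.set0.
    by rewrite big1 // => i _; rewrite finset.in_set0.
  by rewrite (bigD1 i) //= iE addNr mul0r.
rewrite EE big_mkcond; apply: eq_bigr => S _; case: ifP => SE.
  rewrite -big_mkcond /= (eq_bigr (fun=> -1)) ?prodr_const // => i iS.
  by rewrite (fintype.subsetP SE).
have /subsetPn[i iS iE] : ~~ (S \subset E) by rewrite SE.
by rewrite (bigD1 i) //= iS (negPf iE) mul0r.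
Qed.

(** * Right divisibility by squares in the trace monoid *)

Section RightDivision.
Variable n : nat.
Implicit Types (i j : 'I_n) (s t w : seq 'I_n) (H I : {set 'I_n}) (X : 'X_{1..n}).
Local Notation tequiv := (@tequiv _ (@dep n)).
Local Notation canon := (@canon _ (@dep n)).

Definition rdiv w s : bool := `[< exists t, tequiv s (t ++ w) >].

Lemma rdivP w s : reflect (exists t, tequiv s (t ++ w)) (rdiv w s).
Proof. exact: asboolP. Qed.

Lemma rdiv_tequiv w s s' : tequiv s s' -> rdiv w s = rdiv w s'.
Proof.
move=> ss'; apply/rdivP/rdivP => -[t st]; exists t; last exact: tequiv_trans st.
exact: tequiv_trans (tequiv_sym ss') st.
Qed.

Lemma rdiv_tequivl w w' s : tequiv w w' -> rdiv w s = rdiv w' s.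
Proof.
move=> ww'; apply/rdivP/rdivP => -[t st]; exists t; apply: tequiv_trans st _.
  exact: tequiv_cat.
by apply: tequiv_cat => //; apply: tequiv_sym.
Qed.

Lemma rdiv_catr u w s : rdiv (u ++ w) s -> rdiv w s.
Proof. by move/rdivP => [t st]; apply/rdivP; exists (t ++ u); rewrite -catA. Qed.

Lemma tequiv_rev s t : tequiv s t -> tequiv (rev s) (rev t).
Proof. by move=> st i j ij; rewrite !filter_rev st. Qed.

(** Levi's lemma of trace monoids, for single letters. *)
Lemma tequiv_levi i j s t : i != j -> tequiv (j :: s) (i :: t) ->
  exists z, tequiv t (j :: z) /\ tequiv s (i :: z).
Proof.
move=> ij /(tequiv_consE (@dep_refl n) (@dep_sym n))[[|a u] [b [[E1 E2] ind sE]]].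
  by rewrite E1 eqxx in ij.
rewrite -E1 in sE ind; exists (u ++ b); split=> //.
rewrite E2; apply/tequiv_sym/tequiv_swap_list; first exact: dep_refl.
by case/andP: ind.
Qed.

(** After reversal, four applications of Levi's lemma carry the two j across the two i. *)
Lemma rdiv_double_cat i j s : i != j -> rdiv [:: j; j] (s ++ [:: i; i]) -> rdiv [:: j; j] s.
Proof.
move=> ij /rdivP[t /tequiv_rev]; rewrite !rev_cat /= => /tequiv_sym.
case/(tequiv_levi ij) => z1 [iY jR].
have [z2 [Y z1E]] := tequiv_levi ij (tequiv_sym iY).
have jR' := tequiv_trans jR (tequiv_cons i z1E).
have [z3 [iz2 _]] := tequiv_levi ij jR'.
have [z4 [z2E _]] := tequiv_levi ij (tequiv_sym iz2).
apply/rdivP; exists (rev z4); have := tequiv_trans Y (tequiv_cons j z2E).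
by move/tequiv_rev; rewrite revK -[j :: j :: z4]/([:: j; j] ++ z4) rev_cat.
Qed.

(** Squares are divided out one at a time; by [rdiv_double_cat] the remaining ones still divide the
    quotient. *)
Lemma rdiv_doubled l s : uniq l -> (forall i j, i \in l -> j \in l -> ~~ adjacent i j) ->
  (forall i, i \in l -> rdiv [:: i; i] s) -> rdiv (doubled l) s.
Proof.
elim: l s => [|i l IH] s /=; first by move=> *; apply/rdivP; exists s; rewrite cats0.
move=> /andP[il Ul] indl sl; have /rdivP[t st] := sl i (mem_head _ _).
have /rdivP[u tu] : rdiv (doubled l) t.
  apply: IH => // [a b al bl|j jl]; first by apply: indl; rewrite inE ?al ?bl orbT.
  apply: (@rdiv_double_cat i); first by apply: contraNneq il => ->.
  by rewrite -(rdiv_tequiv _ st); apply: sl; rewrite inE jl orbT.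
apply/rdivP; exists u; apply: tequiv_trans st _.
have e := tequiv_cat tu (tequiv_refl (dep := @dep n) [:: i; i]).
apply: tequiv_trans e _; rewrite -catA.
apply: tequiv_cat => //; apply: perm_tequiv; last by rewrite perm_catC.
have m a : a \in doubled l ++ [:: i; i] -> a \in i :: l.
  by rewrite mem_cat mem_doubled !inE orbb orbC.
by move=> a b /m al /m bl; apply: indl.
Qed.

Lemma rdiv_square_mem H s i : independent H -> rdiv (square_word H) s -> i \in H ->
  rdiv [:: i; i] s.
Proof.
move=> Hi Hs iH; apply: (@rdiv_catr (square_word (H :\ i))).
rewrite -(rdiv_tequivl _ (perm_tequiv (indep_square Hi) _)) //.
have := @square_word_split _ [set i]%SET H; rewrite finset.sub1set => /(_ iH).
by rewrite {3}/square_word enum_set1.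
Qed.

(** For adjacent nodes, the projection of s on i and j would end with both letters at once. *)
Lemma rdiv_double_indep i j s : rdiv [:: i; i] s -> rdiv [:: j; j] s -> ~~ adjacent i j.
Proof.
move=> /rdivP[t st] /rdivP[u su]; apply/negP => ij.
have dij : dep i j by rewrite /dep ij orbT.
have := st i j dij; rewrite (su i j dij) !filter_cat /= !eqxx orbT.
move/(congr1 (last i)); rewrite !last_cat /= => ji.
by rewrite ji adjacent_irr in ij.
Qed.

Lemma rdiv_cover (S : {set {set 'I_n}}) s : (forall H, H \in S -> independent H) ->
  (forall H, H \in S -> rdiv (square_word H) s) <->
  independent (finset.cover S) /\ rdiv (square_word (finset.cover S)) s.
Proof.
move=> SI; split=> [Ss|[ci cs] H HS].
  have di i : i \in finset.cover S -> rdiv [:: i; i] s.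
    case/bigcupP => H HS iH; exact: rdiv_square_mem (SI H HS) (Ss H HS) iH.
  have ci : independent (finset.cover S).
    by apply/independentP => i j /di is_ /di js; apply: rdiv_double_indep is_ js.
  split=> //; apply: rdiv_doubled; first exact: enum_uniq.
    by move=> i j; rewrite !mem_enum; apply/independentP.
  by move=> i; rewrite mem_enum; apply: di.
have HcS : H \subset finset.cover S by apply: finset.bigcup_sup.
apply: (@rdiv_catr (square_word (finset.cover S :\: H))).
by rewrite -(rdiv_tequivl _ (perm_tequiv (indep_square ci) (square_word_split HcS))).
Qed.

Definition normal_words X : seq (seq 'I_n) :=
  [seq s <- [seq val u | u <- enum {: (mdeg X).-tuple 'I_n}] |
     (content s == X) && (canon s == s)].

Lemma mem_normal_words X s :
  (s \in normal_words X) = (content s == X) && (canon s == s).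
Proof.
rewrite mem_filter; case: eqP => //= sX; case: eqP => //= _.
have sz : size s == mdeg X by rewrite -sX mdeg_content.
by apply/mapP; exists (Tuple sz); rewrite ?mem_enum.
Qed.

Lemma normal_words_uniq X : uniq (normal_words X).
Proof. by rewrite filter_uniq // map_inj_uniq ?enum_uniq //; apply: val_inj. Qed.

Definition nwords X := size (normal_words X).

(** The map t -> canon (t ++ w) is a bijection from normal words of the complementary content,
    injective by right cancellation. *)
Lemma normal_words_rdiv X w :
  size [seq s <- normal_words X | rdiv w s] =
  if (content w <= X)%MM then nwords (X - content w)%MM else 0%N.
Proof.
case: ifP => wX; last first.
  apply/eqP; rewrite size_eq0 -[_ == _]negbK -has_filter; apply/hasPn => s.
  rewrite mem_normal_words => /andP[/eqP sX _]; apply/negP => /rdivP[t st].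
  move: wX; rewrite -sX (content_tequiv st) content_cat => /negP; apply.
  exact: lem_addl.
rewrite /nwords -[RHS](size_map (fun t => canon (t ++ w))).
apply: perm_size; apply: uniq_perm.
- by rewrite filter_uniq // normal_words_uniq.
- rewrite map_inj_in_uniq ?normal_words_uniq // => s t.
  rewrite !mem_normal_words => /andP[_ /eqP <-] /andP[_ /eqP <-].
  by move/canon_inj/tequiv_cat2r/canonE; rewrite !canonK.
move=> s; rewrite mem_filter mem_normal_words; apply/and3P/mapP.
  move=> [/rdivP[t st] /eqP sX /eqP sc]; exists (canon t).
    rewrite mem_normal_words canonK eqxx content_canon andbT; apply/eqP.
    by rewrite -sX (content_tequiv st) content_cat addmK.
  rewrite -sc; apply: canonE; apply: tequiv_trans st _; apply: tequiv_cat => //.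
  exact: canonP.
move=> [t]; rewrite mem_normal_words => /andP[/eqP tX _] ->; split.
- by rewrite -(rdiv_tequiv _ (canonP (dep := @dep n) _)); apply/rdivP; exists t.
- by rewrite content_canon content_cat tX submK.
- by rewrite canonK.
Qed.

(** For each word the signs over the subsets of [E s], its set of dividing squares, detect whether
    [E s] is empty; exchanging the sums leaves, for each S, the words divisible by the square of the
    union of S. *)
Lemma inclusion_exclusion (Hs : {set {set 'I_n}}) X :
  (forall H, H \in Hs -> independent H) ->
  (size [seq s <- normal_words X | ~~ [exists H in Hs, rdiv (square_word H) s]])%:Z =
  \sum_(S : {set {set 'I_n}} | (S \subset Hs) && independent (finset.cover S))
    (-1) ^+ #|S| * (let w := square_word (finset.cover S) in
      if (content w <= X)%MM then nwords (X - content w)%MM else 0%N)%:Z.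
Proof.
move=> HsI; pose E s := [set H in Hs | rdiv (square_word H) s]%SET.
transitivity (\sum_(s <- normal_words X) \sum_(S : {set {set 'I_n}} | S \subset E s)
   (-1) ^+ #|S| : int).
  under eq_bigr => s _ do rewrite sum_signs.
  rewrite size_filter count_int; apply: eq_bigr => s _.
  congr (nat_of_bool _)%:R; apply/idP/eqP => [/exists_inP nE|E0].
    apply/finset.setP => H; rewrite inE finset.in_set0; apply/negP => /andP[HHs Hd].
    by apply: nE; exists H.
  apply/exists_inP => -[H HHs Hd].
  by have := finset.in_set0 H; rewrite -E0 inE HHs Hd.
have SE (S : {set {set 'I_n}}) s : S \subset E s -> S \subset Hs /\ forall H, H \in S -> rdiv (square_word H) s.
  move=> /fintype.subsetP SEs.
  split=> [|H /SEs]; last by rewrite inE => /andP[].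
  by apply/fintype.subsetP => H /SEs; rewrite inE => /andP[].
rewrite (exchange_big_dep (fun S : {set {set 'I_n}} => (S \subset Hs) && independent (finset.cover S))) /=.
  apply: eq_bigr => S /andP[SHs ci]; have SI H (HS : H \in S) := HsI H (fintype.subsetP SHs H HS).
  rewrite -normal_words_rdiv size_filter count_int mulr_sumr big_mkcond.
  apply: eq_bigr => s _; have [SEs|nSE] := boolP (S \subset E s).
    have /(rdiv_cover s SI)[_ ->] := (SE _ _ SEs).2; by rewrite mulr1.
  case: (boolP (rdiv _ s)) => [Sd|]; last by rewrite mulr0.
  case/negP: nSE; apply/fintype.subsetP => H HS; rewrite inE (fintype.subsetP SHs) //=.
  exact: ((rdiv_cover s SI).2 (conj ci Sd)).
move=> s S _ /SE[SHs Sd]; rewrite SHs /=.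
have SI H (HS : H \in S) := HsI H (fintype.subsetP SHs H HS).
by have /(rdiv_cover s SI)[] := Sd.
Qed.
End RightDivision.

Section QuotientCharacter.
Variables (K : numFieldType) (n : nat).
Local Notation g := (bkm K n).
Local Notation rho := (weyl K n).
Local Notation v := (verma_vector rho).
Implicit Types (s t : seq 'I_n) (X : 'X_{1..n}).
Variable Hs : {set {set 'I_n}}.
Hypothesis HsI : forall H, H \in Hs -> independent H.
Local Notation tequiv := (@tequiv _ (@dep n)).
Local Notation canon := (@canon _ (@dep n)).
Local Notation killed s := [exists H in Hs, rdiv (square_word H) s].

Lemma killed_tequiv s t : tequiv s t -> killed s = killed t.
Proof. by move=> st; apply: eq_existsb => H; rewrite (rdiv_tequiv _ st). Qed.

(** As f_H^2 v is a highest weight vector, the submodule that it generates is spanned by the f_t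
    f_H^2 v. The submodule thus has a description by words alone, and the remaining normal words
    give a basis of the quotient. *)
Lemma span_square_gen u : span_submodule (square_gen rho Hs) u <->
  word_span v (fun s => killed s) u.
Proof.
have hv := verma_vector_hw rho; split; last first.
  have subm := span_is_submodule (square_gen rho Hs).
  apply: (word_span_ind (submodule_subspace subm)).
  move=> s /exists_inP[H HHs /rdivP[t st]].
  rewrite (fword_tequiv _ st) fword_cat.
  have := @square_in_span K n rho _ _ HHs; elim: t {s st} => //= i s IH /IH.
  by case: subm => _ _; apply.
have sub := word_span_subspace v (fun s => killed s).
move: u; apply: span_subset => [|_ /square_gen_weight[H [k [HHs ->]]]]; last first.
  apply: (subspaceZ sub); apply: word_span_mem; apply/exists_inP; exists H => //.
  by apply/rdivP; exists [::].
split=> [||x u ku]; [exact: word_span0 | exact: sub.2 |].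
move: u ku; apply: (@word_span_ind _ _ (verma rho) _ _ (fun u => word_span v _ (act x u))).
  split=> [|k w w' w0 w0']; first by rewrite act0r; apply: word_span0.
  by rewrite act_linearr; apply: sub.2.
move=> s /exists_inP[H HHs /rdivP[t st]].
have hs := square_hw hv (HsI HHs).
have [_ _ actH] := word_span_submodule hs.
rewrite (fword_tequiv _ st) fword_cat.
have := actH x _ (word_span_mem (fword (square_word H) v) (P := predT) (s := t) isT).
apply: (word_span_ind sub) => r _; rewrite -fword_cat; apply: word_span_mem.
by apply/exists_inP; exists H => //; apply/rdivP; exists r.
Qed.

Lemma char_higher_verma X : char (higher_verma rho Hs) (rho - root_of K X) =
  (size [seq s <- normal_words X | ~~ killed s])%:Z.
Proof.
have [linq homq] := quot_proj_hom (square_gen rho Hs).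
have [hv span_v] := highest_weight_moduleP (quot_proj_hom (square_gen rho Hs))
  (@quot_proj_surj _ _ _ (square_gen rho Hs)).
rewrite /char; congr (Posz _).
pose f s : higher_verma rho Hs := quot_proj (square_gen rho Hs) (fword s v).
have fE s : f s = fword s (quot_proj (square_gen rho Hs) v).
  exact: fword_hom (quot_proj_hom _).
have Ub : uniq [seq s <- normal_words X | ~~ killed s].
  exact/filter_uniq/normal_words_uniq.
apply: (@list_dim _ _ _ _ _ f) => //.
- move=> s; rewrite mem_filter mem_normal_words => /and3P[_ /eqP sX _].
  by rewrite fE -sX; apply: fword_weight hv.1.
- move=> c c0 s sB; have : \sum_(t <- [seq s <- normal_words X | ~~ killed s]) c t *: f t =
    quot_proj (square_gen rho Hs) (\sum_(t <- [seq s <- normal_words X | ~~ killed s]) c t *: fword t v).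
    by rewrite (lin_sum linq); apply: eq_bigr => t _; rewrite (linZ linq).
  rewrite c0 => /esym/quot_proj0/span_square_gen[l [/allP kl]].
  move/(congr1 (word_coef s)); rewrite word_coef_sum.
  have := @word_coef_sum K n rho s [seq (c t, t) | t <- [seq s <- normal_words X | ~~ killed s]].
  rewrite !big_map /= => ->.
  rewrite (bigD1_seq s) ?Ub //=.
  move: (sB); rewrite mem_filter mem_normal_words => /and3P[ks _ /eqP sc].
  rewrite sc eqxx mulr1 [X in _ + X]big_seq_cond [X in _ + X]big1 ?addr0; last first.
    move=> t /andP[]; rewrite mem_filter mem_normal_words => /and3P[_ _ /eqP ->] /negPf ->.
    by rewrite mulr0.
  move=> ->; rewrite big_seq big1 // => p /kl kp.
  case: eqP => [ps|]; last by rewrite mulr0.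
  have := killed_tequiv (canonP (dep := @dep n) p.2); rewrite kp ps => /esym.
  by rewrite (negPf ks).
- move=> w ww; have := weight_content hv span_v ww.
  apply: (@word_span_ind _ _ (higher_verma rho Hs) _ _ (fun w => exists c : seq 'I_n -> K, w = \sum_(t <- _) c t *: f t)).
    split; first by exists (fun=> 0); rewrite big1 // => t _; rewrite scale0r.
    move=> k _ _ [a ->] [b ->]; exists (fun t => k * a t + b t).
    rewrite scaler_sumr -big_split; apply: eq_bigr => t _.
    by rewrite scalerDl scalerA.
  move=> s /eqP sX; rewrite -fE; have [ks|ks] := boolP (killed s).
    exists (fun=> 0); rewrite [RHS]big1 => [|t _]; last by rewrite scale0r.
    by apply/quot_proj0/span_square_gen; apply: word_span_mem.
  exists (fun t => (t == canon s)%:R).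
  have sB : canon s \in [seq s <- normal_words X | ~~ killed s].
    rewrite mem_filter mem_normal_words content_canon sX canonK !eqxx !andbT.
    by rewrite -(killed_tequiv (canonP (dep := @dep n) s)).
  rewrite (bigD1_seq (canon s)) ?Ub //= eqxx scale1r.
  rewrite big1 ?addr0 => [|t /negPf ->]; last by rewrite scale0r.
  by rewrite /f (fword_tequiv _ (canonP (dep := @dep n) s)).
Qed.

Lemma char_higher_verma0 mu : (forall X, mu <> rho - root_of K X) ->
  char (higher_verma rho Hs) mu = 0.
Proof.
move=> muX; have [hv span_v] := highest_weight_moduleP (quot_proj_hom (square_gen rho Hs))
  (@quot_proj_surj _ _ _ (square_gen rho Hs)).
rewrite /char; congr (Posz _); apply: (@list_dim _ _ _ nat [::] (fun=> 0)) => // w ww.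
exists (fun=> 0); rewrite big_nil; apply/eqP/negPn/negP => w0.
by have [X /muX] := weight_exists hv span_v ww w0.
Qed.
End QuotientCharacter.

(** * Root spaces *)

Section GeneratedSubalgebra.
Variables (K : numFieldType) (n : nat).
Local Notation g := (bkm K n).
Implicit Types (i j : 'I_n) (a b : 'X_{1..n}) (u w z : g) (h : cartan K n).

(** The part of degree a of the subalgebra generated by the x_i, which are the f_i or the e_i.
    Degrees are exponents, so the grading is independent of any weight computation. *)
Inductive hgen (x : 'I_n -> g) : 'X_{1..n} -> g -> Prop :=
| hgen_gen i : hgen x U_(i)%MM (x i)
| hgen_zero a : hgen x a 0
| hgen_lin k a u w : hgen x a u -> hgen x a w -> hgen x a (k *: u + w)
| hgen_lie a b u w : hgen x a u -> hgen x b w -> hgen x (a + b)%MM (lie u w).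

Lemma hgen_subspace x a : subspace (hgen x a).
Proof. by split=> [|k u w]; [apply: hgen_zero | apply: hgen_lin]. Qed.

Definition gsum x u := exists l : seq ('X_{1..n} * g),
  (forall p, p \in l -> hgen x p.1 p.2) /\ u = \sum_(p <- l) p.2.

Lemma gsum_subspace x : subspace (gsum x).
Proof.
split; first by exists [::]; rewrite big_nil.
move=> k _ _ [l [Pl ->]] [l' [Pl' ->]].
exists ([seq (p.1, k *: p.2) | p <- l] ++ l'); split; last first.
  by rewrite big_cat big_map scaler_sumr.
move=> p; rewrite mem_cat => /orP[/mapP[q ql ->] /=|/Pl' //].
by apply: (subspaceZ (hgen_subspace _ _)); apply: Pl.
Qed.

Lemma gsum_hgen x a u : hgen x a u -> gsum x u.
Proof.
by move=> xu; exists [:: (a, u)]; rewrite big_seq1; split=> // p; rewrite inE => /eqP ->.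
Qed.

Lemma gsum_ind x (N : set g) : subspace N -> (forall a u, hgen x a u -> N u) ->
  forall u, gsum x u -> N u.
Proof.
by move=> subN NP _ [l [Pl ->]]; apply: subspace_sum => // p pl _; apply/NP/Pl.
Qed.

Lemma lie_left_subspace (N : set g) w : subspace N -> subspace (fun u => N (lie u w)).
Proof.
move=> subN; split=> [|k u z Nu Nz]; first by rewrite lie0l; exact: (subspace0 subN).
by rewrite lie_linearl; apply: subN.2.
Qed.
Lemma lie_right_subspace (N : set g) w : subspace N -> subspace (fun u => N (lie w u)).
Proof.
move=> subN; split=> [|k u z Nu Nz]; first by rewrite lie0r; exact: (subspace0 subN).
by rewrite lie_linearr; apply: subN.2.
Qed.

Lemma gsum_lie x u w : gsum x u -> gsum x w -> gsum x (lie u w).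
Proof.
move=> xu; move: w; apply: (@gsum_ind x (fun w => gsum x (lie u w))).
  exact/lie_right_subspace/gsum_subspace.
move=> b w xw; move: u xu; apply: (@gsum_ind x (fun u => gsum x (lie u w))).
  exact/lie_left_subspace/gsum_subspace.
by move=> a u xu; apply: gsum_hgen (hgen_lie xu xw).
Qed.

Section Opposite.
Variables (x y : 'I_n -> g) (sgn : K).
Hypothesis hx : forall h i, lie (bkm_h h) (x i) = (sgn * wpair (simple_root K i) h) *: x i.
Hypothesis yx : forall i j, exists h, lie (y i) (x j) = bkm_h h.

Lemma hgen_weight a u : hgen x a u ->
  forall h, lie (bkm_h h) u = (sgn * wpair (root_of K a) h) *: u.
Proof.
elim=> {a u} [i|a|k a u w _ IHu _ IHw|a b u w _ IHu _ IHw] h.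
- by rewrite root_of1 hx.
- by rewrite lie0r scaler0.
- by rewrite lie_linearr IHu IHw scalerDr !scalerA mulrC.
- by rewrite lie_derivation IHu IHw lieZl lieZr -scalerDl root_ofD wpairDl mulrDr.
Qed.

Lemma gsum_weight h u : gsum x u -> gsum x (lie (bkm_h h) u).
Proof.
move: u; apply: (@gsum_ind x (fun u => gsum x (lie _ u))).
  exact/lie_right_subspace/gsum_subspace.
move=> a u xu; rewrite (hgen_weight xu); apply: (subspaceZ (gsum_subspace _)).
exact: gsum_hgen xu.
Qed.

Definition gsumh u := exists w h, gsum x w /\ u = w + bkm_h h.

Lemma gsumh_subspace : subspace gsumh.
Proof.
split.
  exists 0, 0; split; first exact: (subspace0 (gsum_subspace _)).
  by rewrite (lin0 (@bkm_h_linear K n)) addr0.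
move=> k _ _ [u [h [xu ->]]] [w [h' [xw ->]]].
exists (k *: u + w), (k *: h + h'); split; first exact: (gsum_subspace x).2.
by rewrite bkm_h_linear scalerDr addrACA.
Qed.

Lemma gsum_gsumh u : gsum x u -> gsumh u.
Proof. by move=> xu; exists u, 0; rewrite (lin0 (@bkm_h_linear K n)) addr0. Qed.

Lemma gsumh_lie u w : gsumh u -> gsum x w -> gsum x (lie u w).
Proof.
move=> [z [h [xz ->]]] xw; rewrite lieDl.
by apply: (subspaceD (gsum_subspace _)); [apply: gsum_lie|apply: gsum_weight].
Qed.

(** Only a generator can be sent into the Cartan part: by the derivation rule, a bracket goes to
    brackets of an element of [gsumh] with one of [gsum], which stay in [gsum]. *)
Lemma gsum_opposite i u : gsum x u -> gsumh (lie (y i) u).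
Proof.
move: u; apply: (@gsum_ind x (fun u => gsumh (lie _ u))).
  exact/lie_right_subspace/gsumh_subspace.
move=> a u; elim=> {a u} [j|a|k a u w _ IHu _ IHw|a b u w xu IHu xw IHw].
- have [h ->] := yx i j; exists 0, h; rewrite add0r; split=> //.
  exact: (subspace0 (gsum_subspace _)).
- by rewrite lie0r; apply: (subspace0 gsumh_subspace).
- by rewrite lie_linearr; apply: gsumh_subspace.2.
- rewrite lie_derivation; apply: gsum_gsumh; apply: (subspaceD (gsum_subspace _)).
    exact: gsumh_lie IHu (gsum_hgen xw).
  rewrite lieC; apply: (subspaceN (gsum_subspace _)).
  exact: gsumh_lie IHw (gsum_hgen xu).
Qed.
End Opposite.

Lemma hf h i : lie (bkm_h h) (bkm_f K i) = (-1 * wpair (simple_root K i) h) *: bkm_f K i.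
Proof. by rewrite lie_hf mulN1r. Qed.
Lemma he h i : lie (bkm_h h) (bkm_e K i) = (1 * wpair (simple_root K i) h) *: bkm_e K i.
Proof. by rewrite lie_he mul1r. Qed.
Lemma ef i j : exists h, lie (bkm_e K i) (bkm_f K j) = bkm_h h.
Proof.
rewrite lie_ef; case: eqP => _; first by exists (coroot K i).
by exists 0; rewrite (lin0 (@bkm_h_linear K n)).
Qed.
Lemma fe i j : exists h, lie (bkm_f K i) (bkm_e K j) = bkm_h h.
Proof.
have [h hE] := ef j i; exists (- h); rewrite lieC hE.
by rewrite (linN (@bkm_h_linear K n)).
Qed.

Definition triangular z := exists u h w,
  [/\ gsum (@bkm_f K n) u, gsum (@bkm_e K n) w & z = u + bkm_h h + w].

Lemma triangular_subspace : subspace triangular.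
Proof.
have [subf sube] := (gsum_subspace (@bkm_f K n), gsum_subspace (@bkm_e K n)).
split.
  exists 0, 0, 0; split; [exact: (subspace0 subf) | exact: (subspace0 sube) |].
  by rewrite (lin0 (@bkm_h_linear K n)) !addr0.
move=> k _ _ [u [h [w [fu ew ->]]]] [u' [h' [w' [fu' ew' ->]]]].
exists (k *: u + u'), (k *: h + h'), (k *: w + w'); split.
- exact: subf.2.
- exact: sube.2.
by rewrite bkm_h_linear !scalerDr; rewrite addrACA [X in X + _]addrACA.
Qed.

Lemma triangular_f u : gsumh (@bkm_f K n) u -> triangular u.
Proof.
move=> [w [h [fw ->]]]; exists w, h, 0; rewrite addr0; split=> //.
exact: (subspace0 (gsum_subspace _)).
Qed.
Lemma triangular_e u : gsumh (@bkm_e K n) u -> triangular u.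
Proof.
move=> [w [h [ew ->]]]; exists 0, h, w; rewrite add0r addrC; split=> //.
exact: (subspace0 (gsum_subspace _)).
Qed.

(** Stability is checked for ad of the generators only: operators preserving a subspace are closed
    under commutators. *)
Lemma triangular_lie z u : triangular u -> triangular (lie z u).
Proof.
have subt := triangular_subspace; move: z u; apply: presented_ind.
- move=> x _ [u [h [w [fu ew ->]]]]; rewrite !lieDr.
  have tf w' (fw : gsum (@bkm_f K n) w') : triangular w' by apply/triangular_f/gsum_gsumh.
  have te w' (ew' : gsum (@bkm_e K n) w') : triangular w' by apply/triangular_e/gsum_gsumh.
  case: x => [h'|i|i]; apply: (subspaceD subt); try apply: (subspaceD subt).
  + exact/tf/(gsum_weight hf).
  + by rewrite [lie _ _]lie_hh; apply: (subspace0 subt).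
  + exact/te/(gsum_weight he).
  + exact/triangular_f/(gsum_opposite hf ef).
  + rewrite lieC [lie _ _]he -scaleNr; apply/te/(subspaceZ (gsum_subspace _)).
    exact/gsum_hgen/hgen_gen.
  + apply/te/gsum_lie => //; exact/gsum_hgen/hgen_gen.
  + apply/tf/gsum_lie => //; exact/gsum_hgen/hgen_gen.
  + rewrite lieC [lie _ _]hf -scaleNr; apply/tf/(subspaceZ (gsum_subspace _)).
    exact/gsum_hgen/hgen_gen.
  + exact/triangular_e/(gsum_opposite he fe).
- by move=> u _; rewrite lie0l; apply: (subspace0 subt).
- move=> k x y IHx IHy u tu; rewrite lie_linearl.
  by apply: subt.2; [apply: IHx|apply: IHy].
- move=> x y IHx IHy u tu.
  have -> : lie (lie x y) u = lie x (lie y u) - lie y (lie x u).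
    by rewrite [lie x (lie y u)]lie_derivation addrK.
  by apply: (subspaceB subt); [apply/IHx/IHy|apply/IHy/IHx].
Qed.

Lemma triangularP z : triangular z.
Proof.
move: z; apply: presented_ind => [[h|i|i]||k x y tx ty|x y _ ty].
- exists 0, h, 0; rewrite add0r addr0.
  by split=> //; apply: (subspace0 (gsum_subspace _)).
- exact/triangular_e/gsum_gsumh/gsum_hgen/hgen_gen.
- exact/triangular_f/gsum_gsumh/gsum_hgen/hgen_gen.
- exact: (subspace0 triangular_subspace).
- exact: triangular_subspace.2.
- exact: triangular_lie.
Qed.

(** In a triangular expression of u the summands have weights - b, 0 and b with b in Q+; by
    injectivity of [root_of], only summands of degree a in the lower part have weight - a. As
    before, - u heads the list to make the total 0. *)
Lemma negative_root_space a u : a != 0%MM ->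
  root_space (- root_of K a) u <-> hgen (@bkm_f K n) a u.
Proof.
move=> a0; split=> [ru|fu h]; last by rewrite (hgen_weight hf fu) mulN1r wpairNl.
have [u1 [h [u2 [[l1 [P1 E1]] [l2 [P2 E2]] uE]]]] := triangularP u.
have sub0 : subspace (fun w : g => w = 0).
  by split=> // k w w' -> ->; rewrite scaler0 addr0.
pose l := (- root_of K a, - u) :: (0, bkm_h h) ::
  [seq (- root_of K p.1, p.2) | p <- l1] ++ [seq (root_of K p.1, p.2) | p <- l2].
have := @weight_split K n g (fun h w => lie (bkm_h h) w) (fun w => w = 0) l (- root_of K a).
rewrite /l !big_cons !big_cat !big_map /= eqxx -E1 -E2.
have r0 b : (- root_of K a == root_of K b) = false.
  apply/negbTE; apply: contra a0 => /eqP ab.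
  have : root_of K (a + b)%MM = root_of K (0%MM : 'X_{1..n}).
    by rewrite root_of0 root_ofD -ab subrr.
  by move/root_of_inj/eqP; rewrite mnmD_eq0 => /andP[].
have := r0 0%MM; rewrite root_of0 eq_sym => ->.
have -> : \sum_(p <- l2 | root_of K p.1 == - root_of K a) p.2 = 0.
  by rewrite big1 // => p; rewrite eq_sym r0.
rewrite addr0.
move=> H; have /eqP : - u + \sum_(p <- l1 | - root_of K p.1 == - root_of K a) p.2 = 0.
  apply: H => //.
  - by move=> h'; apply: lie_linearr.
  - by move=> h' w ->; rewrite lie0r.
  - move=> p; rewrite !inE mem_cat => /or3P[/eqP ->|/eqP ->|/orP[]] /=.
    + by move=> h'; rewrite lieNr ru scalerN.
    + by move=> h'; rewrite lie_hh wpair0l scale0r.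
    + by case/mapP=> q ql -> h' /=; rewrite (hgen_weight hf (P1 q ql)) mulN1r wpairNl.
    + by case/mapP=> q ql -> h' /=; rewrite (hgen_weight he (P2 q ql)) mul1r.
  by rewrite uE; zmod.
rewrite addrC subr_eq0 => /eqP <-; apply: (subspace_sum (hgen_subspace _ _)).
by move=> p pl /eqP/oppr_inj/root_of_inj <-; apply: P1.
Qed.

(** The Chevalley involution on generators. It identifies a positive root space with its opposite,
    so that the dimensions in the denominator can be computed in the lower half, which acts on
    words. *)
Definition chevalley_swap (x : chevalley_gen K n) : g :=
  match x with
  | CartanGen h => bkm_h (- h)
  | EGen i => bkm_f K i
  | FGen i => bkm_e K i
  end.

Lemma chevalley_swap_rel (s t : lie_term K (chevalley_gen K n)) : chevalley_rel s t ->
  lie_lift chevalley_swap s = lie_lift chevalley_swap t.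
Proof.
have hN (h' : cartan K n) : bkm_h (- h') = - bkm_h h'.
  exact: (linN (@bkm_h_linear K n)).
case=> {s t} [k h h'|h h'|h i|h i|i|i j ij|i j /dep_cartan ij|i j /dep_cartan ij] /=.
- by rewrite opprD -scalerN bkm_h_linear.
- by rewrite lie_hh.
- by rewrite lie_hf wpairNr opprK.
- by rewrite lie_he wpairNr.
- by rewrite lieC lie_ef eqxx hN.
- by rewrite lieC lie_ef eq_sym (negPf ij) oppr0.
- by rewrite lie_ff.
- by rewrite lie_ee.
Qed.

Definition chevalley_involution : g -> g :=
  @presented_lift _ _ _ chevalley_swap (@chevalley_rel K n).
Local Notation omega := chevalley_involution.

Lemma involution_linear : linear omega.
Proof. exact: (presented_lift_linear chevalley_swap_rel). Qed.
Lemma involution_lie u w : omega (lie u w) = lie (omega u) (omega w).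
Proof. exact: (presented_lift_lie chevalley_swap_rel). Qed.
Lemma involution_h h : omega (bkm_h h) = - bkm_h h.
Proof.
rewrite -(linN (@bkm_h_linear K n)).
exact: (presented_liftE chevalley_swap_rel (LGen (CartanGen h))).
Qed.
Lemma involution_e i : omega (bkm_e K i) = bkm_f K i.
Proof. exact: (presented_liftE chevalley_swap_rel (LGen (EGen K i))). Qed.
Lemma involution_f i : omega (bkm_f K i) = bkm_e K i.
Proof. exact: (presented_liftE chevalley_swap_rel (LGen (FGen K i))). Qed.

Lemma involutionK : involutive omega.
Proof.
have lin := involution_linear.
apply: presented_ind => [[h|i|i]||k x y xK yK|x y xK yK].
- by rewrite [omega (lie_gen _ _)]involution_h (linN lin) involution_h opprK.
- by rewrite [omega (lie_gen _ _)]involution_e involution_f.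
- by rewrite [omega (lie_gen _ _)]involution_f involution_e.
- by rewrite !(lin0 lin).
- by rewrite !lin xK yK.
- by rewrite !involution_lie xK yK.
Qed.

Lemma root_space_involution (alpha : weight K n) u :
  root_space alpha u <-> root_space (- alpha) (omega u).
Proof.
have step (beta : weight K n) w : root_space beta w -> root_space (- beta) (omega w).
  move=> rw h; have := congr1 omega (rw h); rewrite involution_lie involution_h.
  rewrite (linZ involution_linear) lieNl wpairNl scaleNr => <-.
  by rewrite opprK.
split; first exact: step.
by move/step; rewrite opprK involutionK.
Qed.

Lemma root_space_dim_opp (alpha : weight K n) :
  subspace_dim (root_space alpha) = subspace_dim (root_space (- alpha)).
Proof.
apply: (subspace_dim_iso involution_linear involutionK involutionK).
exact: root_space_involution.
Qed.
End GeneratedSubalgebra.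

(** * The Dynkin operator and the injectivity of x -> x v on the lower half *)

Section Dynkin.
Variables (K : numFieldType) (n : nat) (lam : weight K n).
Local Notation g := (bkm K n).
Local Notation v := (verma_vector lam).
Local Notation f := (@bkm_f K n).
Implicit Types (i j : 'I_n) (s t : seq 'I_n) (a b : 'X_{1..n}) (u w x y : g).

(** Right-normed brackets. The value 0 at the empty word does not fit the rule for prefixing a
    letter, whence the restriction to nonempty words and, below, to [lower_part]. *)
Fixpoint bracket_word s : g :=
  if s is i :: s' then (if s' is [::] then f i else lie (f i) (bracket_word s')) else 0.

Lemma bracket_word_cons i s : s != [::] ->
  bracket_word (i :: s) = lie (f i) (bracket_word s).
Proof. by case: s. Qed.

(** Commuting letters can be exchanged by the derivation rule, and two of them in last position give
    0 in either order. *)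
Lemma bracket_word_canon s : bracket_word (canon (@dep n) s) = bracket_word s.
Proof.
apply/esym; apply: (tequiv_eq (@dep_refl n) (@dep_sym n) _ (canonP s)).
move=> p i j t ij; elim: p => [|k p IH]; last first.
  by rewrite !cat_cons !bracket_word_cons ?IH //; case: (p).
case: t => [|k t] /=; first by rewrite !lie_ff // dep_sym.
by rewrite [LHS]lie_derivation lie_ff // lie0l add0r.
Qed.

Definition lower_part (m : verma lam) := word_span v (fun s => s != [::]) m.

Lemma hgen_act_span a x b m : hgen f a x ->
  word_span v (fun s => content s == b) m ->
  word_span v (fun s => content s == (a + b)%MM) (act x m).
Proof.
move=> fx; elim: fx b m => {a x} [i|a|k a x y _ IHx _ IHy|a b x y _ IHx _ IHy] c m mc.
- move: m mc; apply: (@word_span_ind _ _ (verma lam) _ _ (fun m => word_span v _ (act _ m))).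
    split=> [|k w w' w0 w0']; first by rewrite act0r; apply: word_span0.
    by rewrite act_linearr; apply: (word_span_subspace _ _).2.
  move=> s /eqP sc; apply: (@word_span_mem _ _ _ _ _ (i :: s)).
  by rewrite content_cons sc.
- by rewrite act0l; apply: word_span0.
- by rewrite act_linearl; apply: (word_span_subspace _ _).2; [apply: IHx|apply: IHy].
- rewrite act_lie; apply: (subspaceB (word_span_subspace _ _)).
    by rewrite -addmA; apply/IHx/IHy.
  by rewrite [(a + b)%MM]addmC -addmA; apply/IHy/IHx.
Qed.

Lemma hgen_act_lower a x m : hgen f a x -> lower_part m -> lower_part (act x m).
Proof.
move=> fx; elim: fx m => {a x} [i|a|k a x y _ IHx _ IHy|a b x y _ IHx _ IHy] m ml.
- move: m ml; apply: (@word_span_ind _ _ (verma lam) _ _ (fun m => lower_part (act _ m))).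
    split=> [|k w w' w0 w0']; first by rewrite act0r; apply: word_span0.
    by rewrite act_linearr; apply: (word_span_subspace _ _).2.
  by move=> s _; apply: (@word_span_mem _ _ _ _ _ (i :: s)).
- by rewrite act0l; apply: word_span0.
- by rewrite act_linearl; apply: (word_span_subspace _ _).2; [apply: IHx|apply: IHy].
- by rewrite act_lie; apply: (subspaceB (word_span_subspace _ _)); [apply/IHx/IHy|apply/IHy/IHx].
Qed.

Lemma hgen_act_vector a x : hgen f a x -> lower_part (act x v).
Proof.
elim=> {a x} [i|a|k a x y _ IHx _ IHy|a b x y fx IHx fy IHy].
- exact: (@word_span_mem _ _ _ _ _ [:: i]).
- by rewrite act0l; apply: word_span0.
- by rewrite act_linearl; apply: (word_span_subspace _ _).2.
- rewrite act_lie; apply: (subspaceB (word_span_subspace _ _)).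
    exact: hgen_act_lower fx _.
  exact: hgen_act_lower fy _.
Qed.

(** The dual module is used here with values in g itself: f_s v goes to the right-normed bracket of
    s. *)
Definition dynkin (m : verma lam) : g := @verma_pair K n lam g m bracket_word.

Lemma dynkin_linear : linear dynkin.
Proof. exact: verma_pair_linearl. Qed.

Lemma dynkin_act a x m : hgen f a x -> lower_part m -> dynkin (act x m) = lie x (dynkin m).
Proof.
have lin := dynkin_linear.
move=> fx; elim: fx m => {a x} [i|a|k a x y _ IHx _ IHy|a b x y fx IHx fy IHy] m ml.
- move: m ml; apply: (@word_span_ind _ _ (verma lam) _ _ (fun m => dynkin (act _ m) = lie _ (dynkin m))).
    split=> [|k w w' w0 w0']; first by rewrite act0r !(lin0 lin) lie0r.
    by rewrite act_linearr !lin w0 w0' lie_linearr.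
  move=> s s0; rewrite -[act _ _]/(fword (i :: s) v) /dynkin !verma_pair_fword.
  by rewrite !bracket_word_canon bracket_word_cons.
- by rewrite act0l lie0l (lin0 lin).
- by rewrite act_linearl lie_linearl lin IHx // IHy.
- rewrite act_lie (linB lin).
  rewrite (IHx _ (hgen_act_lower fy ml)) (IHy _ (hgen_act_lower fx ml)).
  by rewrite (IHx _ ml) (IHy _ ml) [lie x (lie y _)]lie_derivation addrK.
Qed.

(* The Dynkin operator multiplies Lie elements by their degree. *)
Lemma dynkin_vector a x : hgen f a x -> dynkin (act x v) = (mdeg a)%:R *: x.
Proof.
have lin := dynkin_linear.
elim=> {a x} [i|a|k a x y _ IHx _ IHy|a b x y fx IHx fy IHy].
- rewrite -[act _ _]/(fword [:: i] v) /dynkin verma_pair_fword bracket_word_canon.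
  by rewrite mdeg1 scale1r.
- by rewrite act0l (lin0 lin) scaler0.
- by rewrite act_linearl lin IHx IHy scalerDr !scalerA mulrC.
- rewrite act_lie (linB lin) (dynkin_act fx (hgen_act_vector fy)).
  rewrite (dynkin_act fy (hgen_act_vector fx)) IHx IHy !lieZr [lie y x]lieC scalerN opprK.
  by rewrite -scalerDl -natrD mdegD addnC.
Qed.

(** The degree by which the Dynkin operator multiplies x is invertible in characteristic 0. *)
Lemma hgen_act_inj a x : a != 0%MM -> hgen f a x -> act x v = 0 -> x = 0.
Proof.
move=> a0 fx xv; have := dynkin_vector fx; rewrite xv (lin0 dynkin_linear) => /esym/eqP.
by rewrite scaler_eq0 pnatr_eq0 mdeg_eq0 (negPf a0) => /eqP.
Qed.

Lemma word_span_normal X (m : verma lam) : word_span v (fun s => content s == X) m ->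
  m = \sum_(s <- normal_words X) word_coef s m *: fword s v.
Proof.
have lin t : linear (@word_coef K n lam t : verma lam -> GRing.regular K).
  exact: (@verma_pair_linearl K n lam (GRing.regular K)).
move: m; apply: (@word_span_ind _ _ (verma lam) _ _ (fun m => m = _)).
  split=> [|k w w' wE w'E].
    by rewrite big1 // => s _; rewrite [word_coef _ _](lin0 (lin s)) scale0r.
  rewrite {1}wE {1}w'E scaler_sumr -big_split; apply: eq_bigr => s _.
  by rewrite [word_coef _ (_ + _)](lin s) scalerDl scalerA.
move=> s /eqP sX; rewrite (bigD1_seq (canon (@dep n) s)) ?normal_words_uniq //=; last first.
  by rewrite mem_normal_words content_canon sX canonK !eqxx.
rewrite word_coef_fword eqxx scale1r big1 ?addr0 => [|t /negPf st].
  by apply: fword_tequiv; apply: canonP.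
by rewrite word_coef_fword eq_sym st scale0r.
Qed.

(** The coordinates of x v on the finitely many normal words of content a embed the root space in
    row vectors. *)
Lemma hgen_basis a : a != 0%MM ->
  exists b : 'I_(subspace_dim (root_space (root_of K a))) -> g, is_basis (hgen f a) b.
Proof.
move=> a0; have -> : subspace_dim (root_space (root_of K a)) = subspace_dim (hgen f a).
  rewrite root_space_dim_opp; congr (subspace_dim _); apply/funext => u; apply/propext.
  exact: negative_root_space.
pose c x := \row_(k < nwords a) word_coef (nth [::] (normal_words a) k) (act x v).
apply: (@basis_exists _ _ _ _ c); last 1 first.
- move=> x fx cx; apply: (hgen_act_inj a0 fx).
  have v0 : word_span v (fun s => content s == 0%MM) v.
    by apply: (@word_span_mem _ _ _ _ _ [::]); rewrite content_nil.
  have := hgen_act_span fx v0; rewrite addm0 => /word_span_normal ->.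
  rewrite (big_nth [::]) big_mkord big1 // => k _.
  by have := congr1 (fun M : 'rV_(nwords a) => M 0 k) cx; rewrite !mxE => ->; rewrite scale0r.
- move=> k x y; apply/rowP => i; rewrite !mxE act_linearl.
  exact: word_coef_linear.
- exact: hgen_subspace.
Qed.
End Dynkin.

(** * The Poincare-Birkhoff-Witt count *)

Section Shuffle.
Variables (K : numFieldType) (n : nat) (lam : weight K n).
Local Notation g := (bkm K n).
Local Notation v := (verma_vector lam).
Local Notation f := (@bkm_f K n).
Local Notation D := (dual_module (GRing.regular K) lam).
Local Notation canon := (@canon _ (@dep n)).
Implicit Types (i j : 'I_n) (s t : seq 'I_n) (a b : 'X_{1..n}) (x y : g) (phi psi : D) (d e : nat).

Definition invariant phi := forall s, phi (canon s) = phi s.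

Lemma invariant_swap phi : invariant phi -> forall u i j w, ~~ dep i j ->
  phi (u ++ i :: j :: w) = phi (u ++ j :: i :: w).
Proof.
move=> iphi u i j w ij; rewrite -iphi -[RHS]iphi; congr (phi _); apply: canonE.
by apply: tequiv_swap; rewrite ?(dep_sym j) //; apply: dep_refl.
Qed.

(** The product dual to the coproduct for which the letters are primitive: a sum over the splittings
    of s into two complementary subwords. *)
Fixpoint shuffle phi psi s : K :=
  if s is i :: s' then
    shuffle (fun t => phi (i :: t)) psi s' + shuffle phi (fun t => psi (i :: t)) s'
  else phi [::] * psi [::].

Definition sh phi psi : D := shuffle phi psi.

Lemma shuffle_ext phi phi' psi psi' s : phi =1 phi' -> psi =1 psi' ->
  shuffle phi psi s = shuffle phi' psi' s.
Proof.
elim: s phi phi' psi psi' => [|i s IH] phi phi' psi psi' E E' /=; first by rewrite E E'.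
by congr (_ + _); apply: IH => // t.
Qed.

Lemma sh_linearl psi : linear (sh^~ psi).
Proof.
move=> k phi phi'; apply/funext => s; rewrite /sh.
transitivity (k * shuffle phi psi s + shuffle phi' psi s) => //.
elim: s phi phi' psi => [|i s IH] phi phi' psi /=.
  by rewrite [(k *: phi + phi') _](_ : _ = k * phi [::] + phi' [::]) // mulrDl mulrA.
have IH1 := IH (fun t => phi (i :: t)) (fun t => phi' (i :: t)) psi.
have IH2 := IH phi phi' (fun t => psi (i :: t)).
by rewrite mulrDr addrACA -IH1 -IH2.
Qed.

Lemma sh_linearr phi : linear (sh phi).
Proof.
move=> k psi psi'; apply/funext => s; rewrite /sh.
transitivity (k * shuffle phi psi s + shuffle phi psi' s) => //.
elim: s phi psi psi' => [|i s IH] phi psi psi' /=.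
  rewrite [(k *: psi + psi') _](_ : _ = k * psi [::] + psi' [::]) //.
  by rewrite mulrDr mulrCA.
have IH1 := IH (fun t => phi (i :: t)) psi psi'.
have IH2 := IH phi (fun t => psi (i :: t)) (fun t => psi' (i :: t)).
by rewrite mulrDr addrACA -IH1 -IH2.
Qed.

Lemma sh_invariant phi psi : invariant phi -> invariant psi -> invariant (sh phi psi).
Proof.
move=> /invariant_swap iphi /invariant_swap ipsi s.
apply/esym; apply: (tequiv_eq (@dep_refl n) (@dep_sym n) _ (canonP s)).
move=> u i j t ij; rewrite /sh; elim: u phi psi iphi ipsi => [|k u IH] phi psi iphi ipsi /=.
  have E1 : shuffle (fun t0 => phi [:: i, j & t0]) psi t =
      shuffle (fun t0 => phi [:: j, i & t0]) psi t.
    by apply: shuffle_ext => // r; apply: (iphi [::]).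
  have E2 : shuffle phi (fun t0 => psi [:: i, j & t0]) t =
      shuffle phi (fun t0 => psi [:: j, i & t0]) t.
    by apply: shuffle_ext => // r; apply: (ipsi [::]).
  by rewrite E1 E2 addrACA.
congr (_ + _); apply: IH => // u' i' j' w'.
  exact: (iphi (k :: u')).
exact: (ipsi (k :: u')).
Qed.

Lemma invariant_act a x phi : hgen f a x -> invariant phi -> invariant (act x phi).
Proof.
move=> fx; elim: fx phi => {a x} [i|a|k a x y _ IHx _ IHy|a b x y _ IHx _ IHy] phi iphi s.
- by rewrite !dual_fE canon_cons.
- by rewrite act0l.
- rewrite act_linearl; have := IHx _ iphi s; have := IHy _ iphi s => Ey Ex.
  by rewrite [LHS](congr2 (fun p q => k * p + q) Ex Ey).
- rewrite act_lie; have Ex := IHx _ (IHy _ iphi) s; have Ey := IHy _ (IHx _ iphi) s.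
  by rewrite [LHS](congr2 (fun p q => p - q) Ex Ey).
Qed.

(* Lie elements of the lower half act on functions by derivations of the *)
(* shuffle product: this is dual to their being primitive.               *)
Lemma sh_act a x phi psi : hgen f a x -> invariant phi -> invariant psi ->
  act x (sh phi psi) = sh (act x phi) psi + sh phi (act x psi).
Proof.
have [linl linr] := (sh_linearl, sh_linearr).
move=> fx; elim: fx phi psi => {a x} [i|a|k a x y _ IHx _ IHy|a b x y fx IHx fy IHy] phi psi iphi ipsi.
- apply/funext => s; rewrite dual_fE sh_invariant //.
  have E1 : sh (act (f i) phi) psi = - (sh (fun t => phi (i :: t)) psi).
    rewrite -(linN (linl psi)); apply/funext => t; apply: shuffle_ext => // r.
    by rewrite dual_fE iphi.
  have E2 : sh phi (act (f i) psi) = - (sh phi (fun t => psi (i :: t))).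
    rewrite -(linN (linr phi)); apply/funext => t; apply: shuffle_ext => // r.
    by rewrite dual_fE ipsi.
  by rewrite E1 E2 -opprD.
- by rewrite !act0l (lin0 (linl _)) (lin0 (linr _)) addr0.
- by rewrite !act_linearl linl linr IHx // IHy // scalerDr addrACA.
- have A := IHx _ _ (invariant_act fy iphi) ipsi.
  have B := IHx _ _ iphi (invariant_act fy ipsi).
  have C := IHy _ _ (invariant_act fx iphi) ipsi.
  have E := IHy _ _ iphi (invariant_act fx ipsi).
  rewrite !act_lie (IHy phi psi) // (IHx phi psi) // !actDr A B C E.
  rewrite (linB (linl psi)) (linB (linr phi)).
  move: (sh (act x (act y phi)) psi) (sh (act y phi) (act x psi)) (sh (act x phi) (act y psi))
    (sh phi (act x (act y psi))) (sh (act y (act x phi)) psi) (sh phi (act y (act x psi))).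
  by move=> c1 c2 c3 c4 c5 c6; zmod.
Qed.

(** Order of vanishing at v: the function is 0 on all products of fewer than d homogeneous elements
    of the lower half applied to v. *)
Fixpoint ord d phi : Prop :=
  if d is d'.+1 then
    phi [::] = 0 /\ forall a x, hgen f a x -> ord d' (act x phi)
  else True.

Lemma ord_subspace d : subspace (ord d).
Proof.
elim: d => [|d [IH0 IH]]; split=> //=.
  by split=> // a x _; rewrite act0r.
move=> k phi psi [p0 Hp] [q0 Hq]; split=> [|a x fx]; last first.
  by rewrite act_linearr; apply: IH; [apply: Hp fx | apply: Hq fx].
by rewrite [(k *: phi + psi) _](_ : _ = k * phi [::] + psi [::]) // p0 q0 mulr0 addr0.
Qed.

Lemma ordW d phi : ord d.+1 phi -> ord d phi.
Proof.
elim: d phi => // d IH phi [p0 Hp]; split=> // a x /Hp; exact: IH.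
Qed.

(** By the Leibniz rule an element of the lower half lowers the order of one factor by at most one
    and leaves the other factor alone. *)
Lemma ord_sh d e phi psi : invariant phi -> invariant psi -> ord d phi -> ord e psi ->
  ord (d + e) (sh phi psi).
Proof.
have [m] := ubnP (d + e); elim: m d e phi psi => // m IH d e phi psi de iphi ipsi dphi epsi.
case: d e => [|d] [|e] // in de dphi epsi *.
- split=> [|a x fx]; first by rewrite /sh /= epsi.1 mulr0.
  rewrite (sh_act fx) //; apply: (subspaceD (ord_subspace _)).
    apply: (IH 0%N e) => //; [exact: invariant_act fx _ | exact: ordW].
  by apply: (IH 0%N e) => //; [exact: invariant_act fx _ | exact: epsi.2 fx].
- rewrite addn0; split=> [|a x fx]; first by rewrite /sh /= dphi.1 mul0r.
  rewrite addn0 in de; rewrite (sh_act fx) // -[d]addn0; apply: (subspaceD (ord_subspace _)).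
    by apply: IH; rewrite ?addn0 //; [exact: invariant_act fx _ | exact: dphi.2 fx].
  by apply: IH; rewrite ?addn0 //; [exact: invariant_act fx _ | exact: ordW].
- split=> [|a x fx]; first by rewrite /sh /= dphi.1 mul0r.
  rewrite (sh_act fx) //; apply: (subspaceD (ord_subspace _)).
    by apply: (IH d e.+1) => //; [exact: invariant_act fx _ | exact: dphi.2 fx].
  rewrite -addSnnS; apply: (IH d.+1 e) => //; first by rewrite addSnnS.
    exact: invariant_act fx _.
  exact: epsi.2 fx.
Qed.

Definition counit : D := fun s => (s == [::])%:R.

Lemma counit_invariant : invariant counit.
Proof. by move=> s; rewrite /counit -!size_eq0 size_canon. Qed.

Lemma sh_counit phi : sh counit phi = phi.
Proof.
apply/funext => s; rewrite /sh; elim: s phi => [|i s IH] phi /=.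
  by rewrite /counit eqxx mul1r.
rewrite IH; have -> : shuffle (fun t => counit (i :: t)) phi s = 0; last by rewrite add0r.
have s0 (psi psi' : D) : (forall t, psi t = 0) -> shuffle psi psi' s = 0; last exact: s0.
elim: s psi psi' {IH} => [|j s IH] psi psi' psi0 /=; first by rewrite psi0 mul0r.
by rewrite IH ?IH ?addr0.
Qed.
End Shuffle.

(** * Ordered monomials in homogeneous basis vectors, up to height N *)

Section PBW.
Variables (K : numFieldType) (n : nat) (lam : weight K n).
Local Notation g := (bkm K n).
Local Notation v := (verma_vector lam).
Local Notation f := (@bkm_f K n).
Local Notation D := (dual_module (GRing.regular K) lam).
Local Notation canon := (@canon _ (@dep n)).
Local Notation vpair := (@verma_pair K n lam (GRing.regular K)).
Implicit Types (i j : 'I_n) (s t : seq 'I_n) (a b X : 'X_{1..n}) (x y : g) (phi psi : D) (d : nat).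

Variables (Z : finType) (deg : Z -> 'X_{1..n}) (vec : Z -> g) (N : nat).
Hypothesis deg_neq0 : forall z, deg z != 0%MM.
Hypothesis vec_hgen : forall z, hgen f (deg z) (vec z).
Hypothesis vec_gen : forall a x, a != 0%MM -> (mdeg a <= N)%N -> hgen f a x ->
  exists c : Z -> K, x = \sum_(z | deg z == a) c z *: vec z.
Hypothesis vec_free : forall a (c : Z -> K), \sum_(z | deg z == a) c z *: vec z = 0 ->
  forall z, deg z = a -> c z = 0.
Implicit Types (z : Z) (l : seq Z).

Lemma vpair_canon (m : verma lam) phi : vpair m (phi \o canon) = vpair m phi.
Proof.
have lin p := @verma_pair_linearl K n lam (GRing.regular K) p.
have [l [_ ->]] := verma_span m; rewrite !(lin_sum (lin _)); apply: eq_bigr => p _.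
by rewrite !(linZ (lin _)) !verma_pair_fword /= canonK.
Qed.

Lemma vpair_support a (m : verma lam) phi : word_span v (fun s => content s == a) m ->
  (forall s, content s = a -> phi s = 0) -> vpair m phi = 0.
Proof.
have lin := @verma_pair_linearl K n lam (GRing.regular K) phi.
move=> [l [/allP Pl ->]] phi0; rewrite (lin_sum lin) big_seq big1 // => p /Pl /eqP pa.
by rewrite (linZ lin) verma_pair_fword phi0 ?scaler0 // content_canon.
Qed.

Lemma vec_vector_span z : word_span v (fun s => content s == deg z) (act (vec z) v).
Proof.
have v0 : word_span v (fun s => content s == 0%MM) v.
  by apply: (@word_span_mem _ _ _ _ _ [::]); rewrite content_nil.
by have := hgen_act_span (vec_hgen z) v0; rewrite addm0.
Qed.

Definition word_delta t : D := fun s => (s == t)%:R.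

(** The coordinates on normal words of the vectors [vec z'] v, for z' of the degree of z, form a
    matrix with a right inverse, one of whose columns gives the coefficients of the functional. *)
Lemma dual_functional z : exists phi : D,
  [/\ invariant phi, phi [::] = 0 & forall z', vpair (act (vec z') v) phi = (z == z')%:R].
Proof.
pose a := deg z; pose A := [pred z' | deg z' == a].
have zA : z \in A by rewrite inE.
pose M := \matrix_(j < #|A|, k < nwords a)
  word_coef (nth [::] (normal_words a) k) (act (vec (enum_val j)) v).
(* A relation between the rows is one between the x v, hence between the x by [hgen_act_inj], hence
   trivial. *)
have /row_freeP[P MP] : row_free M.
  apply/inj_row_free => w wM; apply/rowP => j; rewrite mxE.
  pose c z' := if z' \in A then w 0 (enum_rank_in zA z') else 0.
  have cE q : c (enum_val q) = w 0 q by rewrite /c enum_valP enum_valK_in.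
  have sumE : \sum_(z' | deg z' == a) c z' *: vec z' = \sum_q w 0 q *: vec (enum_val q).
    rewrite (eq_bigl (fun z' => z' \in A)) // big_enum_val.
    by apply: eq_bigr => q _; rewrite cE.
  rewrite -cE; apply: (@vec_free a) => [|]; last exact/eqP/(enum_valP j).
  have fs : hgen f a (\sum_(z' | deg z' == a) c z' *: vec z').
    apply: (subspace_sum (hgen_subspace _ _)) => z' _ /eqP <-.
    exact: (subspaceZ (hgen_subspace _ _)).
  apply: (hgen_act_inj (lam := lam) (deg_neq0 z) fs); rewrite sumE.
  rewrite (lin_sum (act_linearl v)); set m := \sum_q _.
  have mX : word_span v (fun s => content s == a) m.
    apply: (subspace_sum (word_span_subspace _ _)) => q _ _; rewrite actZl.
    apply: (subspaceZ (word_span_subspace _ _)).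
    by have := vec_vector_span (enum_val q); rewrite (eqP (enum_valP q)).
  rewrite (word_span_normal mX) (big_nth [::]) big_mkord big1 // => k _.
  have := congr1 (fun M' : 'rV_(nwords a) => M' 0 k) wM; rewrite !mxE => wk.
  suff -> : word_coef (nth [::] (normal_words a) k) m = 0 by rewrite scale0r.
  have lin := @verma_pair_linearl K n lam (GRing.regular K)
    (fun s => (s == nth [::] (normal_words a) k)%:R).
  rewrite -[RHS]wk /word_coef /m (lin_sum lin); apply: eq_bigr => q _.
  by rewrite actZl (linZ lin) mxE.
pose i := enum_rank_in zA z.
pose psi : D := \sum_k P k i *: word_delta (nth [::] (normal_words a) k).
have psi0 s : content s != a -> psi s = 0.
  move=> sa; rewrite /psi fct_sumE big1 // => k _.
  have : nth [::] (normal_words a) k \in normal_words a by apply: mem_nth.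
  rewrite mem_normal_words => /andP[/eqP ka _].
  rewrite [LHS](_ : _ = P k i * (s == nth [::] (normal_words a) k)%:R) //.
  by case: eqP => [sk|_]; [rewrite sk ka eqxx in sa|rewrite mulr0].
exists (psi \o canon); split=> [s||z']; first by rewrite /= canonK.
  by rewrite /= canon_nil psi0 // content_nil eq_sym; apply: deg_neq0.
rewrite vpair_canon; have [z'A|z'A] := boolP (z' \in A); last first.
  rewrite (vpair_support (vec_vector_span z')) => [|s sz']; last first.
    by apply: psi0; rewrite sz'; apply: contra z'A => /eqP z'a; rewrite inE z'a.
  by case: eqP => // zz'; rewrite -zz' zA in z'A.
rewrite /psi (lin_sum (@verma_pair_linearr K n lam (GRing.regular K) _)).
have := congr1 (fun M' : 'M_#|A| => M' (enum_rank_in zA z') i) MP; rewrite !mxE.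
have -> : (enum_rank_in zA z' == i) = (z == z').
  rewrite eq_sym; apply/eqP/eqP => [zz'|zz'].
    by have := congr1 enum_val zz'; rewrite /i !enum_rankK_in.
  by apply: enum_val_inj; rewrite /i !enum_rankK_in.
move=> <-; apply: eq_bigr => k _.
rewrite (linZ (@verma_pair_linearr K n lam (GRing.regular K) _)) mxE enum_rankK_in //.
by rewrite mulrC.
Qed.

Lemma dual_functionals : exists phi : Z -> D, [/\ forall z, invariant (phi z),
  forall z, phi z [::] = 0 & forall z z', vpair (act (vec z') v) (phi z) = (z == z')%:R].
Proof.
have [phi phiP] := choice dual_functional; exists phi.
by split=> [z|z|z z']; have [] := phiP z.
Qed.

Definition pbw_act l (m : verma lam) : verma lam :=
  foldr (fun z w => act (vec z) w) m l.
Definition pbw_deg l : 'X_{1..n} := (\sum_(z <- l) deg z)%MM.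

Lemma pbw_act_linear l : linear (pbw_act l).
Proof. by elim: l => [|z l IH] k m m' //=; rewrite IH act_linearr. Qed.

Lemma pbw_act_cat l l' m : pbw_act (l ++ l') m = pbw_act l (pbw_act l' m).
Proof. exact: foldr_cat. Qed.

Section Independence.
Variable phi : Z -> D.
Hypothesis phi_inv : forall z, invariant (phi z).
Hypothesis phi_nil : forall z, phi z [::] = 0.
Hypothesis phi_dual : forall z z', vpair (act (vec z') v) (phi z) = (z == z')%:R.

(** Shuffle products of dual functionals: they detect the monomial of l among the monomials of
    length at most that of l. *)
Definition dual_word l : D := foldr (fun z psi => sh (phi z) psi) (counit lam) l.

Lemma dual_word_inv l : invariant (dual_word l).
Proof.
elim: l => [|z l IH] /=; first exact: counit_invariant.
exact: sh_invariant.
Qed.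

Fixpoint deletions l : seq (Z * seq Z) :=
  if l is z :: l' then (z, l') :: [seq (p.1, z :: p.2) | p <- deletions l'] else [::].

Lemma deletions_perm l p : p \in deletions l -> perm_eq l (p.1 :: p.2).
Proof.
elim: l p => //= z l IH p; rewrite inE => /orP[/eqP -> //|/mapP[q /IH lq ->]] /=.
by rewrite -(perm_cons z) in lq; apply: perm_trans lq _; rewrite (perm_catCA [:: z] [:: q.1]).
Qed.

Lemma deletions_mem l z : z \in l -> exists2 p, p \in deletions l & p.1 = z.
Proof.
elim: l => //= y l IH; rewrite inE => /orP[/eqP ->|/IH[p pl <-]].
  by exists (y, l); rewrite ?mem_head.
by exists (p.1, y :: p.2) => //; rewrite inE map_f ?orbT.
Qed.

Lemma vpair_act x m psi : vpair (act x m) psi = - vpair m (act x psi).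
Proof. exact: verma_pair_act. Qed.
Lemma vpair_vector psi : vpair v psi = psi [::].
Proof. by have := @verma_pair_fword K n (GRing.regular K) lam [::] psi; rewrite canon_nil. Qed.

Lemma ord_counit_phi z z' : ord 1 (act (vec z') (phi z) + (z == z')%:R *: counit lam).
Proof.
split=> //; rewrite [LHS](_ : _ = act (vec z') (phi z) [::] + (z == z')%:R * 1) //.
by rewrite mulr1 -phi_dual vpair_act vpair_vector addrN.
Qed.

Lemma ord_dual_word l : ord (size l) (dual_word l).
Proof.
elim: l => [//|z l IH]; rewrite [size _]/= -add1n; apply: ord_sh => //.
exact: dual_word_inv.
Qed.

(** Up to order [size l], the action of [vec z] is minus the partial derivative in the variable z:
    this is the Leibniz rule combined with [ord_counit_phi], the sign being that of the
    contragredient action. *)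
Lemma act_dual_word z l : ord (size l)
  (act (vec z) (dual_word l) + \sum_(p <- deletions l) (p.1 == z)%:R *: dual_word p.2).
Proof.
elim: l => [//|y l IH]; have fz := vec_hgen z.
rewrite -[size (y :: l)]/(1 + size l)%N [dual_word (y :: l)]/= [deletions (y :: l)]/=.
rewrite big_cons big_map.
have -> : \sum_(p <- deletions l) (p.1 == z)%:R *: sh (phi y) (dual_word p.2) =
    sh (phi y) (\sum_(p <- deletions l) (p.1 == z)%:R *: dual_word p.2).
  rewrite (lin_sum (sh_linearr _)); apply: eq_bigr => p _.
  by rewrite (linZ (sh_linearr _)).
rewrite (sh_act fz) //; last exact: dual_word_inv.
rewrite addrACA -(linD (sh_linearr _)) -[X in (_ == _)%:R *: X]sh_counit.
rewrite -(linZ (sh_linearl _)) -(linD (sh_linearl _)).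
have inv_sum : invariant (\sum_(p <- deletions l) (p.1 == z)%:R *: dual_word p.2).
  move=> s; rewrite !fct_sumE; apply: eq_bigr => p _.
  by rewrite dualZ [RHS]dualZ dual_word_inv.
apply: (subspaceD (ord_subspace lam (1 + size l))); apply: ord_sh => //.
- move=> s; rewrite dualD [RHS]dualD (invariant_act fz) //; congr (_ + _).
  by rewrite dualZ [RHS]dualZ counit_invariant.
- exact: dual_word_inv.
- exact: ord_counit_phi.
- exact: ord_dual_word.
- move=> s; rewrite dualD [RHS]dualD (invariant_act fz) ?inv_sum //.
  exact: dual_word_inv.
Qed.

Lemma vpair_ord d l psi : ord d psi -> (size l < d)%N -> vpair (pbw_act l v) psi = 0.
Proof.
elim: l d psi => [|z l IH] [|d] psi //=; first by move=> [p0 _] _; rewrite vpair_vector.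
move=> [_ /(_ _ _ (vec_hgen z)) Hp]; rewrite ltnS => /(IH _ _ Hp) E.
by rewrite vpair_act E oppr0.
Qed.

(** The number of bijections between the positions of the two lists that match equal entries: a
    product of factorials of multiplicities, or 0. *)
Fixpoint matchings l l' : nat :=
  if l' is z :: l'' then \sum_(p <- deletions l) (p.1 == z) * matchings p.2 l''
  else size l == 0%N.

Lemma matchings_gt0 l l' : (0 < matchings l l')%N = perm_eq l l'.
Proof.
elim: l' l => [|z l' IH] l /=; first by case: l => // y l; apply/esym/negP => /perm_size.
rewrite lt0n sum_nat_seq_neq0; apply/hasP/idP => [[p pl /=]|ll'].
  rewrite muln_eq0 negb_or -!lt0n IH lt0b => /andP[/eqP pz pl'].
  by apply: perm_trans (deletions_perm pl) _; rewrite pz perm_cons.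
have [p pl pz] : exists2 p, p \in deletions l & p.1 = z.
  by apply: deletions_mem; rewrite (perm_mem ll') mem_head.
exists p => //=; rewrite muln_eq0 negb_or -!lt0n IH pz eqxx /=.
by rewrite -(perm_cons z) -{1}pz -(permPl (deletions_perm pl)).
Qed.

(** Each factor differentiates the dual word; the error has order [size l] and pairs to 0 with the
    remaining, shorter product. *)
Lemma vpair_dual_word l l' : size l = size l' ->
  vpair (pbw_act l' v) (dual_word l) = (matchings l l')%:R.
Proof.
elim: l' l => [|z l' IH] l; first by move/size0nil => -> /=; rewrite vpair_vector.
move=> ll' /=; rewrite vpair_act.
have lin := @verma_pair_linearr K n lam (GRing.regular K) (pbw_act l' v).
have := vpair_ord (act_dual_word z l) (l := l'); rewrite ll' => /(_ (ltnSn _)).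
rewrite (linD lin) => /eqP; rewrite addrC addr_eq0 => /eqP <-.
rewrite (lin_sum lin) natr_sum big_seq [RHS]big_seq; apply: eq_bigr => p pl.
rewrite (linZ lin) natrM; case: eqP => [pz|_]; last by rewrite scale0r mul0r.
rewrite scale1r mul1r IH //; have := perm_size (deletions_perm pl).
by rewrite ll' /= => -[].
Qed.
End Independence.

(** As the degrees are nonzero, exponents up to N suffice in height at most N; this makes the set of
    exponents finite. *)
Definition pbw_exp := {ffun Z -> 'I_N.+1}.
Definition pbw_word (e : pbw_exp) : seq Z := flatten [seq nseq (e z) z | z <- enum Z].
Definition pbw_vector (e : pbw_exp) := pbw_act (pbw_word e) v.

Lemma count_pbw_word e z : count_mem z (pbw_word e) = e z.
Proof.
rewrite /pbw_word count_flatten -map_comp sumnE big_map big_enum /= (bigD1 z) //=.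
rewrite count_nseq /= eqxx mul1n big1 ?addn0 // => y /negPf yz.
by rewrite count_nseq /= yz mul0n.
Qed.

Lemma perm_pbw_word e e' : perm_eq (pbw_word e) (pbw_word e') -> e = e'.
Proof.
move=> /permP ee'; apply/ffunP => z; apply: val_inj.
by rewrite /= -!count_pbw_word ee'.
Qed.

(** Pair with the dual word of a longest monomial with nonzero coefficient. Shorter monomials pair
    to 0 by order, the others of that length because they are not permutations of it, and the
    monomial itself to a positive integer, nonzero in characteristic 0. *)
Lemma pbw_free (A : pred pbw_exp) (c : pbw_exp -> K) :
  \sum_(e | A e) c e *: pbw_vector e = 0 -> forall e, A e -> c e = 0.
Proof.
move=> c0 e0 Ae0; apply/eqP/negPn/negP => ce0.
have [phi [phi_inv phi_nil phi_dual]] := dual_functionals.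
pose P e := A e && (c e != 0).
have Pe0 : P e0 by rewrite /P Ae0.
case: (@arg_maxnP _ e0 P (fun e => size (pbw_word e)) Pe0) => e /andP[Ae ce] maxe.
have lin := @verma_pair_linearl K n lam (GRing.regular K) (dual_word phi (pbw_word e)).
have := congr1 (fun m => vpair m (dual_word phi (pbw_word e))) c0.
rewrite (lin0 lin) (lin_sum lin) (bigD1 e) //= big1 => [|e' /andP[Ae' e'e]].
  rewrite addr0 (linZ lin) vpair_dual_word // => /eqP; rewrite scaler_eq0 (negPf ce) /=.
  by rewrite pnatr_eq0 -leqn0 leqNgt matchings_gt0 perm_refl.
rewrite (linZ lin); have [->|ce'] := eqVneq (c e') 0; first by rewrite scale0r.
have /maxe : P e' by rewrite /P Ae' ce'.
rewrite /geq /= leq_eqVlt => /orP[/eqP ss|ss].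
  rewrite vpair_dual_word //; suff -> : matchings (pbw_word e) (pbw_word e') = 0%N by rewrite scaler0.
  apply/eqP; rewrite -leqn0 leqNgt matchings_gt0; apply: contra e'e => ee'.
  by rewrite (perm_pbw_word ee').
by rewrite (vpair_ord (ord_dual_word phi_inv phi_nil _) ss) scaler0.
Qed.

Definition pbw_span X (m : verma lam) := exists c : pbw_exp -> K,
  m = \sum_(e | pbw_deg (pbw_word e) == X) c e *: pbw_vector e.

Lemma pbw_span_subspace X : subspace (pbw_span X).
Proof.
split; first by exists (fun=> 0); rewrite big1 // => e _; rewrite scale0r.
move=> k _ _ [c ->] [c' ->]; exists (fun e => k * c e + c' e).
rewrite scaler_sumr -big_split; apply: eq_bigr => e _.
by rewrite scalerDl scalerA.
Qed.

Lemma pbw_span_mem e : pbw_span (pbw_deg (pbw_word e)) (pbw_vector e).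
Proof.
exists (fun e' => (e' == e)%:R); rewrite (bigD1 e) //= eqxx scale1r big1 ?addr0 //.
by move=> e' /andP[_ /negPf ->]; rewrite scale0r.
Qed.

Lemma pbw_deg_perm l l' : perm_eq l l' -> pbw_deg l = pbw_deg l'.
Proof. exact: perm_big. Qed.

Lemma pbw_deg_cons z l : pbw_deg (z :: l) = (deg z + pbw_deg l)%MM.
Proof. by rewrite /pbw_deg big_cons. Qed.

Lemma pbw_deg_cat l l' : pbw_deg (l ++ l') = (pbw_deg l + pbw_deg l')%MM.
Proof. by rewrite /pbw_deg big_cat. Qed.

Lemma size_le_pbw_deg l : (size l <= mdeg (pbw_deg l))%N.
Proof.
elim: l => //= z l IH; rewrite pbw_deg_cons mdegD -add1n leq_add //.
by rewrite lt0n mdeg_eq0.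
Qed.

(* Transposing two factors changes the product by a shorter one. *)
Lemma pbw_straighten l : (mdeg (pbw_deg l) <= N)%N -> pbw_span (pbw_deg l) (pbw_act l v).
Proof.
have [m] := ubnP (size l); elim: m l => // m IH l lm lN.
set X := pbw_deg l; have subX := pbw_span_subspace X.
have eN z : (count_mem z l < N.+1)%N.
  by rewrite ltnS (leq_trans (count_size _ _)) // (leq_trans (size_le_pbw_deg l)).
pose e : pbw_exp := [ffun z => Ordinal (eN z)].
have le : perm_eq l (pbw_word e).
  by apply/allP => z _ /=; rewrite count_pbw_word ffunE.
suff E : pbw_span X (pbw_act l v - pbw_act (pbw_word e) v).
  rewrite -[pbw_act l v](subrK (pbw_act (pbw_word e) v)); apply: (subspaceD subX) => //.
  by rewrite /X (pbw_deg_perm le); apply: pbw_span_mem.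
have eqs : ssrbool.symmetric (@eq_op Z) by move=> x y; rewrite eq_sym.
(* With equality as dependence relation all distinct letters commute and [tequiv] amounts to
   permutation. The induction principle is used modulo [pbw_span X], the commutators being the
   errors. *)
apply: (@tequiv_ind Z eq_op (@eqxx Z) eqs _ (fun m m' => pbw_span X (m - m'))
  (fun l => pbw_act l v) (fun l' => perm_eq l' l)) => //.
- by move=> w; rewrite subrr; apply: (subspace0 subX).
- move=> a b c ab bc; have := subspaceD subX ab bc.
  by rewrite addrA subrK.
- by move=> s t st; apply: perm_trans; rewrite perm_sym; exact: tequiv_perm st.
- move=> p y z q yz pl.
  rewrite !pbw_act_cat -(linB (pbw_act_linear _)) /= -act_lie.
  have dX : X = (pbw_deg p + ((deg y + deg z) + pbw_deg q))%MM.
    by rewrite /X -(pbw_deg_perm pl) pbw_deg_cat !pbw_deg_cons !addmA.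
  have yzN : (mdeg (deg y + deg z)%MM <= N)%N.
    by apply: leq_trans lN; rewrite -/X dX !mdegD [leqRHS]addnCA leq_addr.
  have yz0 : (deg y + deg z)%MM != 0%MM by rewrite mnmD_eq0 negb_and deg_neq0.
  have [c ->] := vec_gen yz0 yzN (hgen_lie (vec_hgen y) (vec_hgen z)).
  rewrite (lin_sum (act_linearl _)) (lin_sum (pbw_act_linear _)).
  apply: (subspace_sum subX) => z' _ /eqP z'E.
  rewrite actZl (linZ (pbw_act_linear _)); apply: (subspaceZ subX).
  have -> : pbw_act p (act (vec z') (pbw_act q v)) = pbw_act (p ++ z' :: q) v.
    by rewrite pbw_act_cat.
  have -> : X = pbw_deg (p ++ z' :: q) by rewrite dX pbw_deg_cat pbw_deg_cons z'E.
  apply: IH; last by rewrite pbw_deg_cat pbw_deg_cons z'E -dX.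
  by have := perm_size pl; rewrite !size_cat /=; lia.
- move=> x y /eqP <-; rewrite -[LHS]/(filter (pred2 x x) l).
  have red u : filter (pred2 x x) u = nseq (count_mem x u) x.
    by elim: u => //= w u ->; rewrite orbb; case: eqP => [->|].
  by rewrite !red (permP le).
Qed.

Lemma fword_pbw s : (size s <= N)%N -> pbw_span (content s) (fword s v).
Proof.
elim: s => [|i s IH] /= sN.
  pose e : pbw_exp := [ffun=> ord0].
  have e0 : pbw_word e = [::].
    have : perm_eq (pbw_word e) [::] by apply/allP => z _ /=; rewrite count_pbw_word ffunE.
    by move/perm_nilP.
  have := pbw_span_mem e; rewrite /pbw_vector e0 content_nil /=.
  by rewrite /pbw_deg big_nil.
have [c ->] := IH (ltnW sN).
have iN : (mdeg U_(i)%MM <= N)%N by rewrite mdeg1; apply: leq_trans sN.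
have i0 : U_(i)%MM != 0%MM :> 'X_{1..n} by rewrite mnm1_eq0.
have [d ->] := vec_gen i0 iN (hgen_gen f i).
have subX := pbw_span_subspace (content (i :: s)).
rewrite (lin_sum (act_linearr _)); apply: (subspace_sum subX) => e _ /eqP eX.
rewrite actZr; apply: (subspaceZ subX).
rewrite (lin_sum (act_linearl _)); apply: (subspace_sum subX) => z _ /eqP zi.
rewrite actZl; apply: (subspaceZ subX).
have dE : pbw_deg (z :: pbw_word e) = content (i :: s).
  by rewrite pbw_deg_cons content_cons zi eX.
rewrite -dE; apply: (pbw_straighten (l := z :: pbw_word e)).
by rewrite dE mdeg_content.
Qed.

Lemma pbw_act_content l : word_span v (fun s => content s == pbw_deg l) (pbw_act l v).
Proof.
elim: l => [|z l IH] /=.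
  by rewrite /pbw_deg big_nil; apply: (@word_span_mem _ _ _ _ _ [::]); rewrite content_nil.
by rewrite pbw_deg_cons; apply: hgen_act_span (vec_hgen z) IH.
Qed.

(** Ordered monomials and normal words are two bases of the same weight space of M(lam). *)
Lemma pbw_count X : (mdeg X <= N)%N ->
  #|[pred e : pbw_exp | pbw_deg (pbw_word e) == X]| = nwords X.
Proof.
move=> XN; set A := [pred e | _]; pose S := word_span v (fun s => content s == X).
have <- : subspace_dim S = #|A|.
  rewrite cardE; apply: (@list_dim _ _ _ _ _ pbw_vector); first exact: enum_uniq.
  - move=> e; rewrite mem_enum inE => /eqP eX.
    by have := pbw_act_content (pbw_word e); rewrite eX.
  - move=> c; rewrite big_enum /= => c0 e; rewrite mem_enum.
    exact: (pbw_free c0).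
  - have subX := pbw_span_subspace X.
    move=> w Sw; suff [c ->] : pbw_span X w by exists c; rewrite big_enum.
    move: w Sw; apply: (word_span_ind subX) => s /eqP sX.
    by rewrite -sX; apply: fword_pbw; rewrite -mdeg_content sX.
apply: (@list_dim _ _ _ _ _ (fun s => fword s v)); first exact: normal_words_uniq.
- move=> s; rewrite mem_normal_words => /andP[sX _].
  exact: word_span_mem.
- move=> c c0 s sX; have := @word_coef_sum K n lam s [seq (c t, t) | t <- normal_words X].
  rewrite !big_map /= c0 (bigD1_seq s) ?normal_words_uniq //= big_seq_cond big1 => [|t].
    have : s \in normal_words X by [].
    rewrite mem_normal_words => /andP[_ /eqP ->]; rewrite eqxx mulr1 addr0 => <-.
    exact: (lin0 (@verma_pair_linearl K n lam (GRing.regular K) _)).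
  by rewrite mem_normal_words => /andP[/andP[_ /eqP ->] /negPf ->]; rewrite mulr0.
- move=> w /word_span_normal wE; exists (fun s => word_coef s w).
  exact: wE.
Qed.

End PBW.

(** * The Weyl denominator *)

Section Truncation.
Variables (n : nat) (R : comNzRingType).
Implicit Types (p q : {mpoly R[n]}) (N : nat).

(** Power series are replaced by polynomials modulo degrees above N. *)
Definition agree N p q := forall m, (mdeg m <= N)%N -> p@_m = q@_m.

Lemma agree_mul N p p' q q' : agree N p p' -> agree N q q' -> agree N (p * q) (p' * q').
Proof.
move=> pp qq m mN; rewrite !mcoeffM; apply: eq_bigr => -[[a /= aN] [b /= bN]] /eqP /= mE.
by rewrite pp ?qq //; apply: leq_trans mN; rewrite -ltnS.
Qed.

Lemma agree_prod1 N (I : finType) (P : pred I) (F : I -> {mpoly R[n]}) :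
  (forall i, P i -> agree N (F i) 1) -> agree N (\prod_(i | P i) F i) 1.
Proof.
move=> F1; apply: (big_ind (fun p => agree N p 1)) => // p q p1 q1.
by rewrite -[X in agree _ _ X]mulr1; apply: agree_mul.
Qed.

Lemma agree_one_sub N a : (N < mdeg a)%N -> agree N (1 - 'X_[R, a]) 1.
Proof.
move=> aN m mN; rewrite mcoeffB mcoeffX; case: eqP => [am|_]; last by rewrite subr0.
by move: aN; rewrite am ltnNge mN.
Qed.

Lemma mdeg_sub_le (a b : 'X_{1..n}) : (mdeg (b - a) <= mdeg b)%N.
Proof. by rewrite !mdegE leq_sum // => i _; rewrite mnmBE leq_subr. Qed.

Lemma mcoeffXM a p m :
  ('X_[a] * p)@_m = if (a <= m)%MM then p@_(m - a) else 0.
Proof.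
case: ifP => am; first by rewrite -{1}(submK am) addmC mulrC mcoeffMX.
rewrite mulrC mcoeffM big1 // => -[[b /= _] [c /= _]] /eqP mE; rewrite mcoeffX.
case: eqP => [ac|_]; last by rewrite mulr0.
by move: am; rewrite mE -ac lem_addl.
Qed.

Lemma prod_bounded (F : 'X_{1..n} -> {mpoly R[n]}) (P : pred 'X_{1..n}) M N :
  (M <= N)%N -> (forall a, P a -> (M < mdeg a)%N -> agree M (F a) 1) ->
  agree M (\prod_(a : 'X_{1..n < N.+1} | P (bmnm a)) F (bmnm a))
          (\prod_(a : 'X_{1..n < M.+1} | P (bmnm a)) F (bmnm a)).
Proof.
move=> MN F1.
have aN (a : 'X_{1..n < M.+1}) : (mdeg (bmnm a) < N.+1)%N.
  by apply: leq_trans (bmdeg a) _; rewrite ltnS.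
pose h a := BMultinom (aN a).
pose k (a : 'X_{1..n < N.+1}) : 'X_{1..n < M.+1} := insubd bm0 (bmnm a).
have -> : \prod_(a : 'X_{1..n < M.+1} | P (bmnm a)) F (bmnm a) =
          \prod_(a : 'X_{1..n < N.+1} | P (bmnm a) && (mdeg (bmnm a) <= M)%N) F (bmnm a).
  rewrite (reindex_onto h k) /=; last first.
    by move=> a /andP[_ aM]; apply/val_inj; rewrite /= /k insubdK // -topredE /= ltnS.
  apply: eq_bigl => a; rewrite -ltnS bmdeg andbT; case: (P _) => //=.
  by apply/esym/eqP/val_inj; rewrite /k insubdK // -topredE /= bmdeg.
rewrite (bigID (fun a : 'X_{1..n < N.+1} => mdeg (bmnm a) <= M)%N) /= -[X in agree _ _ X]mulr1.
apply: agree_mul; first by [].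
by apply: agree_prod1 => a /andP[Pa]; rewrite -ltnNge; apply: F1.
Qed.

End Truncation.

(** * The denominator as the inverse of the generating function of words *)

Section Denominator.
Variables (K : numFieldType) (n : nat) (lam : weight K n).
Local Notation g := (bkm K n).
Local Notation f := (@bkm_f K n).
Implicit Types (a b w : 'X_{1..n}).

(** The degree 0 is excluded since the root space of weight 0 contains the Cartan subalgebra. *)
Definition root_dim a := if a == 0%MM then 0%N else subspace_dim (root_space (root_of K a)).

Lemma root_dimE a : `[< positive_root K a >] \/ root_dim a = 0%N.
Proof.
rewrite /root_dim; case: eqP => [_|a0]; first by right.
have [pa|npa] := pselect (positive_root K a); [left; exact/asboolP|right].
apply: (@list_dim _ _ _ unit [::] (fun=> 0)) => // u au; exists (fun=> 0); rewrite big_nil.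
by apply: contrapT => u0; apply: npa; split=> //; exists u.
Qed.

Lemma root_vectors a : exists b : 'I_(root_dim a) -> g, a != 0%MM -> is_basis (hgen f a) b.
Proof.
rewrite /root_dim; case: eqVneq => [_|a0]; first by exists (fun=> 0).
by have [b bb] := hgen_basis lam a0; exists b.
Qed.

Variable N : nat.
(** One index for each basis vector of each lower root space of height at most N: multiplicities
    become distinct indices, and a power of 1 - X^a a product of simple factors. *)
Let Z := {a : 'X_{1..n < N.+1} & 'I_(root_dim (bmnm a))}.
Let mk (a : 'X_{1..n < N.+1}) (i : 'I_(root_dim (bmnm a))) : Z :=
  Tagged (fun a : 'X_{1..n < N.+1} => 'I_(root_dim (bmnm a))) i.
Let deg (z : Z) : 'X_{1..n} := bmnm (tag z).
Let vec (z : Z) : g := sval (cid (root_vectors (bmnm (tag z)))) (tagged z).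

Let deg_neq0 z : deg z != 0%MM.
Proof.
case: z => a i; have := leq_ltn_trans (leq0n i) (ltn_ord i).
by rewrite /root_dim /deg /=; case: eqP.
Qed.

Let vec_hgen z : hgen f (deg z) (vec z).
Proof.
by have := deg_neq0 z; rewrite /vec; case: cid => b bb /= /bb[+ _ _]; apply.
Qed.

Let sum_fiber (a : 'X_{1..n < N.+1}) (F : Z -> g) :
  \sum_(z | deg z == bmnm a) F z = \sum_i F (@mk a i).
Proof.
transitivity (\sum_(a1 : 'X_{1..n < N.+1} | a1 == a)
  \sum_(i < root_dim (bmnm a1)) F (@mk a1 i)).
  by rewrite sig_big_dep /=; apply: eq_big => [z|[a1 i] //]; rewrite andbT bmeqP.
by rewrite big_pred1_eq.
Qed.

Let vec_gen a x : a != 0%MM -> (mdeg a <= N)%N -> hgen f a x ->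
  exists c : Z -> K, x = \sum_(z | deg z == a) c z *: vec z.
Proof.
move=> a0 aN ax; pose a' := BMultinom (aN : (mdeg a < N.+1)%N).
have C (a1 : 'X_{1..n < N.+1}) : exists c : 'I_(root_dim (bmnm a1)) -> K, a1 = a' ->
    x = \sum_i c i *: vec (@mk a1 i).
  have [->|a1a] := eqVneq a1 a'; last by exists (fun=> 0) => /eqP; rewrite (negPf a1a).
  rewrite /vec /=; case: cid => b /= /(_ a0)[_ _ /(_ x ax)[c xE]].
  by exists c.
exists (fun z => sval (cid (C (tag z))) (tagged z)).
by rewrite (sum_fiber a') /=; case: cid => c /= /(_ erefl).
Qed.

Let vec_free a (c : Z -> K) : \sum_(z | deg z == a) c z *: vec z = 0 ->
  forall z, deg z = a -> c z = 0.
Proof.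
move=> c0 [a1 i] za; have := deg_neq0 (@mk a1 i).
move: c0; rewrite -za sum_fiber /vec /=; case: cid => b /= bb c0 /bb[_ free _].
exact: (free (fun i => c (Tagged _ i)) c0 i).
Qed.

(** Truncated geometric series: expanding [H] enumerates the exponents in [pbw_exp], and [H * Q] is
    a product of factors 1 - X^((N+1) deg z), hence 1 up to degree N. *)
Let H : {mpoly int[n]} := \prod_z \sum_(j < N.+1) 'X_[deg z] ^+ j.
Let Q : {mpoly int[n]} := \prod_z (1 - 'X_[deg z]).

Let coef_H b : (mdeg b <= N)%N -> H@_b = (nwords b)%:Z.
Proof.
move=> bN; rewrite -(pbw_count lam deg_neq0 vec_hgen vec_gen vec_free bN).
rewrite /H bigA_distr_bigA raddf_sum -[RHS]natz -sum1_card natr_sum /= big_mkcond /=.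
rewrite [RHS]big_mkcond /=; apply: eq_bigr => e _.
have -> : \prod_z 'X_[deg z] ^+ e z = 'X_[int, pbw_deg deg (pbw_word e)].
  rewrite /pbw_deg /pbw_word big_flatten big_map big_enum /=
    (big_morph (mpolyX int) (mpolyXD int) (mpolyX0 n int)).
  apply: eq_bigr => z _; rewrite mpolyXn; congr 'X_[_].
  by rewrite big_nseq; elim: (nat_of_ord (e z)) => [|k IH]; rewrite ?mulm0n // mulmS IH.
by rewrite mcoeffX inE; case: eqP.
Qed.

Let HQ : agree N (H * Q) 1.
Proof.
rewrite /H /Q -big_split; apply: agree_prod1 => z _ /=.
rewrite mulrC -opprB mulNr -subrX1 opprB mpolyXn; apply: agree_one_sub.
by rewrite mdegMn leq_pmull // lt0n mdeg_eq0.
Qed.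

(** Moving the cutoff of the product from the height of c to N only adds factors that are 1 up to
    that height, and degrees that are not positive roots have exponent 0. *)
Let denominatorE c : (mdeg c <= N)%N -> denominator K n c = Q@_c.
Proof.
move=> cN; rewrite /denominator.
pose F a : {mpoly int[n]} := (1 - 'X_[int, a]) ^+ subspace_dim (root_space (root_of K a)).
have F1 a : `[< positive_root K a >] -> (mdeg c < mdeg a)%N -> agree (mdeg c) (F a) 1.
  move=> _ ca; rewrite /F -[subspace_dim _]card_ord -prodr_const.
  by apply: agree_prod1 => i _; apply: agree_one_sub.
rewrite -(prod_bounded cN F1 (leqnn _)) /Q; congr (_ @_ _).
transitivity (\prod_(a : 'X_{1..n < N.+1}) (1 - 'X_[int, bmnm a]) ^+ root_dim (bmnm a)).
  rewrite big_mkcond; apply: eq_bigr => a _; case: ifPn => [/asboolP[a0 _]|pa].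
    by rewrite /F /root_dim; case: eqP.
  by have [|->] := root_dimE (bmnm a); rewrite ?(negPf pa) ?expr0.
transitivity (\prod_(a : 'X_{1..n < N.+1}) \prod_(i < root_dim (bmnm a)) (1 - 'X_[int, bmnm a])).
  by apply: eq_bigr => a _; rewrite prodr_const card_ord.
by rewrite sig_big_dep.
Qed.

(** The series on the left is X^w times the generating function of words; it counts the words right
    divisible by a fixed word of content w. *)
Lemma denominator_inverse w b : mdeg b = N ->
  series_mul (fun a => if (w <= a)%MM then (nwords (a - w))%:Z else 0) (denominator K n) b
  = (w == b)%:R.
Proof.
move=> bN; have -> : (w == b)%:R = ('X_[w] * (H * Q))@_b.
  rewrite mcoeffXM; case: ifP => wb; last by case: eqP wb => // ->; rewrite lepm_refl.
  rewrite HQ ?mcoeff1; last by rewrite -bN mdeg_sub_le.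
  by congr (_ %:R); rewrite -{1}(submK wb) -{1}[w]add0m (inj_eq (@addIm _ w)) eq_sym.
rewrite mulrA -[_ * _]/(mpoly_mul _ _) (mcoeff_poly_mul_lin _ _ (ltnSn _)).
apply: eq_bigr => a ab.
rewrite mcoeffXM denominatorE; last by rewrite -bN mdeg_sub_le.
by case: ifP => // wa; rewrite coef_H // (leq_trans (mdeg_sub_le _ _)) // -ltnS -bN bmdeg.
Qed.

End Denominator.

(** * Presentation by holes and the character formula *)

Section CharacterFormula.
Variables (K : numFieldType) (n : nat).
Local Notation rho := (weyl K n).
Variables (V : lieModType (bkm K n)) (pi : verma rho -> V).
Hypotheses (hpi : is_module_hom pi) (spi : forall u, exists m, pi m = u).
Hypothesis V0 : exists u : V, u <> 0.

Lemma iso_holes : module_iso V (higher_verma rho (holes rho V)).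
Proof.
by apply: (kernel_iso hpi spi) => m; apply: (kernel_holes hpi spi (hom_vector_neq0 hpi spi V0)).
Qed.

Lemma iso_minimal_holes : module_iso V (higher_verma rho (minimal_holes rho V)).
Proof.
apply: (kernel_iso hpi spi) => m; rewrite (kernel_holes hpi spi (hom_vector_neq0 hpi spi V0)).
exact: (span_minimal_holes hpi spi).
Qed.

Lemma minimal_hole_independent H : H \in minimal_holes rho V -> independent H.
Proof. by rewrite inE => /minsetp; rewrite inE => /and3P[]. Qed.

(** A set S of minimal holes occurs for a single I, its union, so the double sum collapses. *)
Lemma numeratorE b : numerator rho V (rho - root_of K b) =
  \sum_(S : {set {set 'I_n}} | (S \subset minimal_holes rho V) && independent (finset.cover S))
     (-1) ^+ #|S| * (content (square_word (finset.cover S)) == b)%:R.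
Proof.
rewrite /numerator [RHS](partition_big finset.cover (@independent n)) => [|S /andP[]] //=.
apply: eq_bigr => I Ii; apply: eq_big => [S|S /andP[_ /eqP SI]].
  by case: eqVneq => [->|]; rewrite ?andbF // Ii !andbT.
congr (_ * _); rewrite /fexp -root_of_square SI.
by rewrite (inj_eq (@addrI _ _)) eqr_opp (inj_eq (@root_of_inj K n)) eq_sym.
Qed.

Lemma char_quotient : is_quotient rho (char V) (numerator rho V) (denominator K n).
Proof.
have E := char_iso iso_minimal_holes; split.
- move=> mu; rewrite E => c0; apply: contrapT => nmu; apply: c0.
  by apply: char_higher_verma0 => X muX; apply: nmu; exists X.
- move=> mu c0; apply: contrapT => nmu; apply: c0; rewrite /numerator big1 // => I Ii.
  rewrite big1 // => S _; rewrite /fexp; case: eqP => [muI|_]; last by rewrite mulr0.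
  by case: nmu; exists (content (square_word I)); rewrite muI root_of_square.
move=> b; rewrite numeratorE /series_mul.
(* Inclusion-exclusion is applied to each coefficient of the character; after the exchange of sums,
   the denominator inverts the count of words separately for each S. *)
transitivity (\sum_(a : 'X_{1..n < (mdeg b).+1} | (bmnm a <= b)%MM)
  \sum_(S : {set {set 'I_n}} | (S \subset minimal_holes rho V) && independent (finset.cover S))
    (-1) ^+ #|S| * ((let w := content (square_word (finset.cover S)) in
      if (w <= bmnm a)%MM then (nwords (bmnm a - w))%:Z else 0) * denominator K n (b - bmnm a)%MM)).
  apply: eq_bigr => a _; rewrite E (char_higher_verma _ minimal_hole_independent).
  rewrite (inclusion_exclusion _ minimal_hole_independent) mulr_suml.
  by apply: eq_bigr => S _; rewrite mulrA /=; case: ifP.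
rewrite exchange_big; apply: eq_bigr => S _; rewrite -mulr_sumr; congr (_ * _).
exact: (denominator_inverse rho _ (erefl (mdeg b))).
Qed.

End CharacterFormula.

Lemma iso_simple (K : numFieldType) (n : nat) :
  module_iso (verma_simple (weyl K n)) (higher_verma (weyl K n) (singletons n)).
Proof.
have hpi := quot_proj_hom (@proper_sum K n (weyl K n)).
have spi := @quot_proj_surj _ _ _ (@proper_sum K n (weyl K n)).
apply: (kernel_iso hpi spi) => m.
rewrite (kernel_holes hpi spi (@simple_vector_neq0 K n)).
exact: singleton_holes.
Qed.

Theorem theorem3p4 (R : realType) (n : nat) (hn : (1 <= n)%N)
    (V : lieModType (bkm R[i] n))
    (hV : highest_weight_module (weyl R[i] n) V) :
  (* (a) *)
  (forall X : 'X_{1..n},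
     let mu := weyl R[i] n - root_of R[i] X in
     let form := independent (mnm_supp X) /\
       exists I : {set 'I_n}, independent I /\
         forall i, X i = (if i \in I then 2 else 0)%N in
     (isotropic_eq X <-> isotropic_eq' X) /\
     (isotropic_eq X ->
        ((exists v : V, weight_space mu v /\ v <> 0) ->
           ((exists v : V, weight_space mu v /\ maximal_vector v) <-> form)) /\
        ((exists v : verma (weyl R[i] n),
            weight_space mu v /\ maximal_vector v) <-> form))) /\
  (* (b) *)
  [/\ module_iso V (higher_verma (weyl R[i] n) (holes (weyl R[i] n) V)),
      module_iso V (higher_verma (weyl R[i] n) (minimal_holes (weyl R[i] n) V))
    & module_iso (verma_simple (weyl R[i] n))
                 (higher_verma (weyl R[i] n) (singletons n))] /\
  (* (c) *)
  [/\ char (verma_simple (weyl R[i] n))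
        =1 char (higher_verma (weyl R[i] n) (singletons n)),
      char V =1 char (higher_verma (weyl R[i] n) (holes (weyl R[i] n) V))
    & is_quotient (weyl R[i] n) (char V) (numerator (weyl R[i] n) V)
                  (denominator R[i] n)].
Proof.
have [V0 [pi [hpi spi]]] := hV.
(* M(rho) is a highest weight module through the identity, so the lemmas on V also give the
   statement about M(rho). *)
have hid : is_module_hom (id : verma (weyl R[i] n) -> verma (weyl R[i] n)) by [].
have sid (u : verma (weyl R[i] n)) : exists m, id m = u by exists u.
have isoH := iso_holes hpi spi V0.
have isoL := @iso_simple R[i] n.
split; last first.
  split; first by split=> //; apply: (iso_minimal_holes hpi spi V0).
  by split; [exact: char_iso isoL|exact: char_iso isoH|exact: (char_quotient hpi spi V0)].
move=> X mu form; split; first exact: isotropicE.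
move=> _; split=> [Vmu|]; (split; first by [apply: (maximal_form hpi spi)|apply: (maximal_form hid sid)]).
  by move=> [_ [I [Ii XI]]]; apply: (form_maximal hpi spi Ii XI).
move=> [_ [I [Ii XI]]]; apply: (form_maximal hid sid Ii XI).
(* In M(rho) the weight space is never 0: no word kills the highest weight vector. *)
exists (fword (square_word I) (verma_vector (weyl R[i] n))); split; last by apply/eqP/fword_neq0.
rewrite /mu (_ : X = content (square_word I)); last first.
  by apply/mnmP => i; rewrite XI content_square.
by case: (square_hw (verma_vector_hw (weyl R[i] n)) Ii).
Qed.
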